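(* For every positive integer $n$ and every finite subgroup $\Gamma$ of $SU(2)$, $$N(\Gamma,SU(n))=N(\Gamma,PU(n)).$$
   Context: For a finite group $\Gamma$ and a compact Lie group $G$, $N(\Gamma,G)$ denotes the number of homomorphisms $f:\Gamma\to G$ up to conjugation by $G$ (i.e. $f_1\sim f_2$ iff there is $g\in G$ with $f_2(\gamma)=gf_1(\gamma)g^{-1}$ for all $\gamma\in\Gamma$). $PU(n)=U(n)/U(1)=SU(n)/\mathbb{Z}_n$. *)

(* Defs.v *)
From HB Require Import structures.
From mathcomp Require Import all_boot all_order all_algebra all_fingroup.
From mathcomp Require Import spectral sesquilinear generic_quotient finmap.
From mathcomp Require Import boolp classical_sets functions cardinality reals.
From mathcomp Require Import complex.

Set Implicit Arguments.
Unset Strict Implicit.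
Unset Printing Implicit Defensive.

Import GRing.Theory Num.Theory.

Local Open Scope ring_scope.
Local Open Scope sesquilinear_scope.
Local Open Scope complex_scope.
Local Open Scope quotient_scope.

Section UnitaryGroup.
Variables (R : realType) (n : nat).

Definition U := {A : 'M[R[i]]_n | A \is unitarymx}.

HB.instance Definition _ := SubType.on U.
HB.instance Definition _ := Choice.on U.

Lemma U_one_subproof : (1%:M : 'M[R[i]]_n) \is unitarymx.
Proof. by apply/unitarymxP; rewrite trmx1 map_mx1 mulmx1. Qed.

Lemma U_inv_subproof (A : U) : (val A)^t* \is unitarymx.
Proof. by rewrite trmxC_unitary (valP A). Qed.

Definition U_one : U := Sub 1%:M U_one_subproof.
Definition U_mul (A B : U) : U :=
  Sub (val A *m val B) (mul_unitarymx (valP A) (valP B)).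
Definition U_inv (A : U) : U := Sub ((val A)^t*) (U_inv_subproof A).

Lemma U_mulA : associative U_mul.
Proof. by move=> A B C; apply: val_inj; rewrite /= mulmxA. Qed.

Lemma U_mul1 : left_id U_one U_mul.
Proof. by move=> A; apply: val_inj; rewrite /= mul1mx. Qed.

Lemma U_mulr1 : right_id U_one U_mul.
Proof. by move=> A; apply: val_inj; rewrite /= mulmx1. Qed.

Lemma U_mulrV : right_inverse U_one U_inv U_mul.
Proof. by move=> A; apply: val_inj; rewrite /=; exact/unitarymxP/(valP A). Qed.

Lemma U_mulV : left_inverse U_one U_inv U_mul.
Proof.
by move=> A; apply: val_inj; apply: mulmx1C; apply/unitarymxP; exact: (valP A).
Qed.

HB.instance Definition _ :=
  isGroup.Build U U_mulA U_mul1 U_mulr1 U_mulV U_mulrV.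

Definition special : {pred U} := [pred A : U | \det (val A) == 1].

Lemma special_group_closed : group_closed special.
Proof.
split=> [|A B]; rewrite !inE /=; first by rewrite det1.
move=> /eqP dA /eqP dB; rewrite det_mulmx dA mul1r.
by rewrite det_map_mx det_tr dB rmorph1.
Qed.

Definition SU := {A : U | A \in special}.

HB.instance Definition _ := SubType.on SU.
HB.instance Definition _ := Choice.on SU.
HB.instance Definition _ :=
  SubChoice_isSubGroup.Build U special SU special_group_closed.

Definition eq_upto_U1 : rel U :=
  fun A B => `[< exists z : R[i], `|z| = 1 /\ val A = z *: val B >].

Lemma eq_upto_U1_refl : reflexive eq_upto_U1.
Proof. by move=> A; apply/asboolP; exists 1; rewrite normr1 scale1r. Qed.

Lemma eq_upto_U1_sym : symmetric eq_upto_U1.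
Proof.
suff impl A B : eq_upto_U1 A B -> eq_upto_U1 B A.
  by move=> A B; apply/idP/idP; exact: impl.
move=> /asboolP[z [z1 AB]]; apply/asboolP; exists z^-1.
have z0 : z != 0 by rewrite -normr_eq0 z1 oner_eq0.
by rewrite normfV z1 invr1 AB scalerA mulVf// scale1r.
Qed.

Lemma eq_upto_U1_trans : transitive eq_upto_U1.
Proof.
move=> B A C /asboolP[z [z1 AB]] /asboolP[w [w1 BC]]; apply/asboolP.
by exists (z * w); rewrite normrM z1 w1 mulr1 AB BC scalerA.
Qed.

Canonical eq_upto_U1_equiv :=
  EquivRel eq_upto_U1 eq_upto_U1_refl eq_upto_U1_sym eq_upto_U1_trans.

Definition PU := {eq_quot eq_upto_U1}.

HB.instance Definition _ := Choice.on PU.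
HB.instance Definition _ := EqQuotient.on PU.

Definition PU_one : PU := lift_cst PU U_one.
Definition PU_mul := lift_op2 PU U_mul.
Definition PU_inv := lift_op1 PU U_inv.

Canonical pi_PU_one := PiConst PU_one.

Lemma PU_reprP A : eq_upto_U1 A (repr (\pi_PU A)).
Proof. by rewrite -(@eqquotE _ _ PU) reprK. Qed.

Lemma pi_PU_mul : {morph \pi_PU : A B / U_mul A B >-> PU_mul A B}.
Proof.
move=> A B; unlock PU_mul; apply/eqmodP/asboolP => /=.
have /asboolP[z [z1 Az]] := PU_reprP A.
have /asboolP[w [w1 Bw]] := PU_reprP B.
exists (z * w); split; first by rewrite normrM z1 w1 mulr1.
by rewrite [in LHS]Az [in LHS]Bw -scalemxAl -scalemxAr scalerA.
Qed.
Canonical pi_PU_mul_morph := PiMorph2 pi_PU_mul.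

Lemma pi_PU_inv : {morph \pi_PU : A / U_inv A >-> PU_inv A}.
Proof.
move=> A; unlock PU_inv; apply/eqmodP/asboolP => /=.
have /asboolP[z [z1 Az]] := PU_reprP A.
exists (Num.conj z); rewrite norm_conjC z1; split=> //.
by rewrite [in LHS]Az linearZ/= map_mxZ.
Qed.
Canonical pi_PU_inv_morph := PiMorph1 pi_PU_inv.

Lemma PU_mulA : associative PU_mul.
Proof.
elim/quotW=> A; elim/quotW=> B; elim/quotW=> C.
by rewrite !piE U_mulA.
Qed.

Lemma PU_mul1 : left_id PU_one PU_mul.
Proof. by elim/quotW=> A; rewrite !piE U_mul1. Qed.

Lemma PU_mulr1 : right_id PU_one PU_mul.
Proof. by elim/quotW=> A; rewrite !piE U_mulr1. Qed.

Lemma PU_mulV : left_inverse PU_one PU_inv PU_mul.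
Proof. by elim/quotW=> A; rewrite !piE U_mulV. Qed.

Lemma PU_mulrV : right_inverse PU_one PU_inv PU_mul.
Proof. by elim/quotW=> A; rewrite !piE U_mulrV. Qed.

HB.instance Definition _ :=
  isGroup.Build PU PU_mulA PU_mul1 PU_mulr1 PU_mulV PU_mulrV.

End UnitaryGroup.

Section Subgroup.
Variables (G : groupType) (S : groupClosed G).

Definition subgroup := {x : G | x \in S}.

Lemma groupClosed_closed : group_closed S.
Proof. by split=> [|x y Sx Sy]; rewrite ?gpred1 ?gpredM ?gpredVr. Qed.

HB.instance Definition _ := SubType.on subgroup.
HB.instance Definition _ := Choice.on subgroup.
HB.instance Definition _ :=
  SubChoice_isSubGroup.Build G _ subgroup groupClosed_closed.

End Subgroup.

Section Count.
Variables Gam G : groupType.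
Local Open Scope group_scope.
Local Open Scope classical_set_scope.

Definition conj_hom (f1 f2 : {multiplicative Gam -> G}) : Prop :=
  exists g : G, forall x : Gam, f2 x = g * f1 x * g^-1.

Definition hom_classes : set (set {multiplicative Gam -> G}) :=
  range (fun f => [set f' | conj_hom f f']).

(* [fset_set] is empty on infinite sets, so this is only the number of classes
   when [hom_classes] is finite. *)
Definition num_hom_classes : nat := #|` fset_set hom_classes|.

End Count.

Arguments hom_classes : clear implicits.

(* Main.v *)
(* The Sylow subgroups of [Gam] are cyclic or generalized quaternion, hence have
   trivial Schur multiplier; by transfer so does [Gam], and every homomorphism to
   [PU(n)] lifts to a representation of [Gam], unique up to a linear character.
   Classes of homomorphisms to [SU(n)] are thus the multiplicity vectors of total
   degree [n] with trivial determinant, and classes to [PU(n)] are the orbits of all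
   multiplicity vectors of total degree [n] under the group [A] of linear characters.

   Suppose that [A] has a symmetric nondegenerate pairing [e] such that, for all [k]
   and all [c] in [A], the sum of [e (det i) c] over the irreducibles [i] of degree [k]
   is the number of those fixed by [c]. The same identity for the powers of [c] and
   Newton's recursion carry it over to multiplicity vectors of degree [n]; averaging
   over [c], orthogonality on one side and Burnside's lemma on the other show that both
   classes are equinumerous. The pairing is found by following the McKay graph of
   [Gam] from the trivial representation: cyclic, dihedral, or exceptional. *)

Require Import Defs.
From HB Require Import structures.
From mathcomp Require Import all_boot all_order all_algebra all_fingroup.
From mathcomp Require Import all_solvable separable cyclotomic.
From mathcomp Require Import mxrepresentation character.
From mathcomp Require Import spectral sesquilinear boolp.
From mathcomp Require Import zify ring.

Set Implicit Arguments.
Unset Strict Implicit.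
Unset Printing Implicit Defensive.

Import Order.TTheory GRing.Theory Num.Theory.

Local Open Scope ring_scope.

(** The condition on [e] says that two actions of [A] on the space with basis [I], graded by degree,
    have equal traces: the diagonal one, where [c] scales [i] by [e (det i) c], and the permutation
    one. They are therefore isomorphic, and so are their symmetric algebras, whose monomials are the
    multiplicity vectors. In degree [n] the first trace is the sum of [e (det_mult m) c] and the
    second counts the vectors fixed by [c]. Newton's recursion is this passage to symmetric powers
    in terms of traces alone, which is why powers of [c] enter. The finite subgroups of $SU(2)$ are
    not classified beforehand: the possible diagrams come out of the equation that the neighbours of
    [i] have total degree [2 * d i], with connectivity and determinants. *)

Lemma porbit_expg_fix (T : finType) (s : {perm T}) (x : T) k :
  ((s ^+ k)%g x == x) = (#|porbit s x| %| k)%N.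
Proof.
set l := #|porbit s x|; have l0 : (0 < l)%N by rewrite lt0n card_porbit_neq0.
have fixl q : iter (q * l) s x = x.
  by elim: q => [|q IH] //; rewrite mulSn iterD IH iter_porbit.
rewrite permX {1}(divn_eq k l) addnC iterD fixl /dvdn.
have ltl : (k %% l < l)%N by rewrite ltn_mod.
have /(uniqP x) inj := uniq_traject_porbit s x.
apply/eqP/eqP => [E|->//].
apply: (inj (k %% l)%N 0%N); rewrite ?inE ?size_traject //.
by rewrite !nth_traject //= E.
Qed.

(** A cycle of length [l] enters Newton's recursion through multiples of [l], and the trace of a
    [k]-th power through the [k] divisible by [l]. Positive integers are written [k.+1]. *)
Lemma sum_multiples (C : nmodType) (g : nat -> C) N l : (0 < l)%N ->
    (forall j, (N < j)%N -> g j = 0) ->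
  \sum_(k < N) g (l * k.+1)%N = \sum_(k < N | (l %| k.+1)%N) g k.+1.
Proof.
move=> l0 g0.
rewrite (bigID (fun k : 'I_N => l * k.+1 <= N)%N) /= [X in _ + X]big1 ?addr0;
  last by move=> k; rewrite -ltnNge => /g0.
have [->|N0] := posnP N; first by rewrite !big_ord0.
case: N N0 g0 => // N _ g0.
rewrite (reindex_onto (fun k : 'I_N.+1 => inord (k.+1 %/ l).-1)
                      (fun k : 'I_N.+1 => inord (l * k.+1).-1)) /=; last first.
  move=> k kN; apply: val_inj => /=.
  have E : (l * k.+1).-1.+1 = (l * k.+1)%N by rewrite prednK ?muln_gt0 ?l0.
  have -> : nat_of_ord (inord (l * k.+1).-1 : 'I_N.+1) = (l * k.+1).-1.
    by rewrite inordK // E.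
  by rewrite E mulKn //= inordK.
apply: eq_big => [k|k].
  have kl : ((k.+1 %/ l).-1 < N.+1)%N.
    by have := leq_div k.+1 l; have := ltn_ord k; case: (_ %/ _)%N => [|q] /=; lia.
  rewrite inordK //.
  have [dv|ndv] := boolP (l %| k.+1)%N.
    have q0 : (0 < k.+1 %/ l)%N by rewrite divn_gt0 // dvdn_leq.
    rewrite prednK // mulnC divnK // ltn_ord /=.
    by apply/eqP/val_inj; rewrite /= inordK.
  apply/negbTE/negP => /andP [le /eqP /(congr1 val)] /=.
  rewrite inordK; last by rewrite prednK ?muln_gt0 ?l0.
  move=> E; case/negP: ndv; apply/dvdnP; exists (k.+1 %/ l).-1.+1.
  have : ((l * (k.+1 %/ l).-1.+1).-1.+1 = l * (k.+1 %/ l).-1.+1)%N.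
    by rewrite prednK ?muln_gt0 ?l0.
  by rewrite E mulnC.
move=> /andP [le /eqP /(congr1 val)] /=.
set x := (l * _)%N; have x0 : (0 < x)%N by rewrite muln_gt0 l0.
by rewrite inordK ?prednK // => <-; rewrite prednK.
Qed.

(** * Newton's recursion for weighted and for invariant multiplicity vectors *)

Section PowerSums.
Variables (C : numFieldType) (I : finType) (d : I -> nat) (N : nat).
Hypothesis d_gt0 : forall i, (0 < d i)%N.

Notation mult := {ffun I -> 'I_N.+1}.

Definition invariants (pi : {perm I}) n : {set mult} :=
  [set m : mult | (\sum_i d i * m i == n)%N & [forall i, m (pi i) == m i]].

(** For [n <= N], the coefficient of [t ^ n] in the product, over the cycles of [pi], of the series
    [1 / (1 - w_B * t ^ d_B)], with [w_B] the product of [w] and [d_B] the sum of [d] over the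
    cycle. One formula serves both sides: [pi = 1] weighs all vectors, [w = 1] counts the invariant
    ones. *)
Definition weight_sum (pi : {perm I}) (w : I -> C) n : C :=
  \sum_(m in invariants pi n) \prod_i w i ^+ m i.

Lemma le_mult n (m : mult) i : (\sum_i d i * m i = n)%N -> (d i * m i <= n)%N.
Proof. by move=> <-; rewrite (bigD1 i) //= leq_addr. Qed.

Lemma invariants_porbit pi n m i j :
  m \in invariants pi n -> j \in porbit pi i -> m j = m i.
Proof.
rewrite inE => /andP [_ /forallP inv] /porbitP [k ->].
elim: k => [|k IH]; first by rewrite expg0 perm1.
by rewrite expgSr permM (eqP (inv _)).
Qed.

(** Lowering [m] by [k] on the whole cycle of [i] keeps it invariant and is undone by raising it
    again; [n <= N] keeps the raised values in range. *)
Lemma weight_sum_shift pi w n k i : (n <= N)%N ->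
  \sum_(m in invariants pi n | (k <= m i)%N) \prod_i w i ^+ m i =
  (if (k * \sum_(j in porbit pi i) d j <= n)%N then
    (\prod_(j in porbit pi i) w j) ^+ k *
      weight_sum pi w (n - k * \sum_(j in porbit pi i) d j)%N else 0).
Proof.
move=> nN; set B := porbit pi i; set b := (\sum_(j in B) _)%N.
have Bpi j : (pi j \in B) = (j \in B).
  by rewrite /B -!eq_porbit_mem -(porbit_perm pi 1 j) expg1.
case: leqP => [kb|nkb]; last first.
  apply: big1 => m /andP [mS mi]; exfalso.
  have allB j : j \in B -> (k <= m j)%N.
    by move=> /(invariants_porbit mS) ->.
  move: mS; rewrite inE => /andP [/eqP Sm _].
  move: nkb; rewrite -Sm (bigID (mem B)) /= ltnNge.
  case/negP; apply: (@leq_trans (\sum_(j in B) d j * m j)%N); last exact: leq_addr.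
  rewrite /b big_distrr /=; apply: leq_sum => j jB.
  by rewrite mulnC leq_mul2l allB ?orbT.
have kN j : j \in B -> (k <= N)%N.
  move=> jB; apply: leq_trans (leq_trans kb nN); rewrite /b (bigD1 j) //=.
  by rewrite mulnDr -{1}[k]muln1; apply: leq_trans (leq_addr _ _);
    rewrite leq_mul2l d_gt0 orbT.
pose up (m : mult) : mult := [ffun j => if j \in B then inord (m j + k) else m j].
pose dn (m : mult) : mult := [ffun j => if j \in B then inord (m j - k) else m j].
have upE m : m \in invariants pi (n - k * b)%N ->
    forall j, val (up m j) = (m j + k * (j \in B))%N.
  rewrite inE => /andP [/eqP Sm _] j; rewrite ffunE.
  case: ifP => jB; rewrite /= ?muln0 ?addn0 ?muln1 // inordK // ltnS.
  have le1 := le_mult j Sm.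
  have le2 : (k * d j <= k * b)%N by rewrite leq_mul2l /b (bigD1 j) //= leq_addr orbT.
  by have := d_gt0 j; nia.
have dnE (m : mult) j : val (dn m j) = (m j - k * (j \in B))%N.
  rewrite ffunE.
  case: ifP => jB; rewrite /= ?muln0 ?subn0 ?muln1 // inordK // ltnS.
  by apply: leq_trans (leq_subr _ _) _; rewrite -ltnS.
rewrite /weight_sum big_distrr /=.
rewrite (reindex_onto up dn) /=; last first.
  move=> m /andP [mS mi]; apply/ffunP => j; apply/val_inj.
  rewrite /up ffunE; case: ifP => jB; last by rewrite /= dnE jB muln0 subn0.
  have kj : (k <= m j)%N by rewrite (invariants_porbit mS jB).
  by rewrite /= dnE jB muln1 subnK // inordK.
have key m : m \in invariants pi (n - k * b)%N ->
   [/\ up m \in invariants pi n, (k <= up m i)%N & dn (up m) = m].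
  move=> mS; have E := upE _ mS; split; last first.
  - by apply/ffunP => j; apply/val_inj; rewrite dnE E addnK.
  - by rewrite E porbit_id muln1 leq_addl.
  move: mS; rewrite !inE => /andP [/eqP Sm /forallP inv].
  apply/andP; split; last first.
    by apply/forallP => j; rewrite -val_eqE !E Bpi (eqP (inv j)).
  rewrite (eq_bigr (fun j => d j * m j + k * (d j * (j \in B)))%N); last first.
    by move=> j _; rewrite E mulnDr; congr addn; rewrite mulnCA.
  rewrite big_split /= Sm -big_distrr /=.
  rewrite -[(\sum_i0 d i0 * _)%N]/(\sum_j d j * _)%N.
  have -> : (\sum_i d i * (i \in B) = b)%N.
    by rewrite /b [RHS]big_mkcond /=; apply: eq_bigr => j _; case: (j \in B); lia.
  by rewrite subnK.
apply: eq_big => [m|m].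
  apply/idP/idP => [|mS]; last by have [-> -> ->] := key _ mS; rewrite eqxx.
  move=> /andP [/andP [uS ui] /eqP E]; rewrite -E.
  rewrite inE; have := uS; rewrite inE => /andP [/eqP Sm /forallP inv].
  have ge j : j \in B -> (k <= up m j)%N.
    by move=> jB; rewrite (invariants_porbit uS jB).
  apply/andP; split; last first.
    by apply/forallP => j; rewrite -val_eqE !dnE Bpi (eqP (inv j)).
  rewrite -Sm /b big_distrr /= [X in (_ - X)%N]big_mkcond /= -sumnB; last first.
    move=> j _; case: ifP => // jB; rewrite mulnC leq_mul2l ge ?orbT //.
  apply/eqP/eq_bigr => j _; rewrite dnE; case: ifP => jB; last by rewrite muln0 !subn0.
  by rewrite muln1 mulnBr [(k * _)%N]mulnC.
move=> /andP [/andP [uS ui] /eqP dnup].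
have E j : val (up m j) = (m j + k * (j \in B))%N.
  rewrite -[in RHS]dnup dnE.
  case: (boolP (j \in B)) => jB; rewrite ?muln0 ?subn0 ?addn0 // muln1 subnK //.
  by rewrite (invariants_porbit uS jB).
rewrite (eq_bigr (fun j => w j ^+ m j * (if j \in B then w j ^+ k else 1))); last first.
  by move=> j _; rewrite E exprD; case: (j \in B); rewrite ?muln1 ?muln0 ?expr0.
by rewrite big_split /= mulrC -prodrXl [in RHS]big_mkcond.
Qed.

(** Write [n] as the sum of the [d i * m i] and each [m i] as the number of positive [k <= m i];
    then shift [k] away for each pair of [i] and [k]. *)
Lemma weight_sum_rec pi w n : (n <= N)%N ->
  n%:R * weight_sum pi w n =
  \sum_i \sum_(k < N) (d i)%:R *
   (if (k.+1 * \sum_(j in porbit pi i) d j <= n)%N then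
    (\prod_(j in porbit pi i) w j) ^+ k.+1 *
      weight_sum pi w (n - k.+1 * \sum_(j in porbit pi i) d j)%N else 0).
Proof.
move=> nN; rewrite /weight_sum big_distrr /=.
transitivity (\sum_(m in invariants pi n) \sum_i \sum_(k < N)
   (if (k.+1 <= m i)%N then (d i)%:R * \prod_i w i ^+ m i else 0)).
  apply: eq_bigr => m; rewrite inE => /andP [/eqP {1}<- _].
  rewrite natr_sum big_distrl /=; apply: eq_bigr => i _.
  rewrite -big_mkcond /= sumr_const natrM mulrAC mulr_natr; congr (_ *+ _).
  rewrite -sum1_card.
  have := leq_ord (m i); move: (nat_of_ord _) => x xN.
  rewrite -(big_mkord (fun k => k < x)%N (fun=> 1%N)).
  by rewrite -(big_nat_widen 0 x N xpredT) //= sum_nat_const_nat subn0 muln1.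
rewrite exchange_big /=; apply: eq_bigr => i _.
rewrite exchange_big /=; apply: eq_bigr => k _.
rewrite -weight_sum_shift // big_distrr /= -big_mkcondr /=.
by [].
Qed.

Lemma weight_sum0 pi w : weight_sum pi w 0 = 1.
Proof.
have E m : (m \in invariants pi 0) = (m == [ffun=> ord0]).
  rewrite inE; apply/andP/eqP => [[/eqP Sm _]|->]; last first.
    by split; [rewrite big1 // => i; rewrite ffunE muln0 | apply/forallP => i; rewrite !ffunE].
  apply/ffunP => i; rewrite ffunE; apply/val_inj => /=.
  by have := le_mult i Sm; have := d_gt0 i; nia.
rewrite /weight_sum (eq_bigl _ _ E) big_pred1_eq big1 // => i _.
by rewrite ffunE expr0.
Qed.

(* Both sides satisfy Newton's recursion with the same power sums. *)
Lemma weight_sum_perm (pi : {perm I}) w : (forall i, d (pi i) = d i) ->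
    (forall k e, \sum_(i | d i == e) w i ^+ k =
                 #|[set i | (d i == e) && ((pi ^+ k)%g i == i)]|%:R) ->
  forall n, (n <= N)%N ->
  weight_sum 1 w n = #|invariants pi n|%:R.
Proof.
move=> dpi tr.
have dporb i : (\sum_(j in porbit pi i) d j = #|porbit pi i| * d i)%N.
  rewrite -sum_nat_const; apply: eq_bigr => j /porbitP [k ->].
  by elim: k => [|k IH]; rewrite ?expg0 ?perm1 // expgSr permM dpi.
have cardE n : #|invariants pi n|%:R = weight_sum pi (fun=> 1) n.
  rewrite /weight_sum -sum1_card natr_sum; apply: eq_bigr => m _.
  by rewrite big1 // => i _; rewrite expr1n.
move=> n; rewrite cardE.
elim/ltn_ind: n => n IH nN.
have [->|n0] := posnP n; first by rewrite !weight_sum0.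
apply: (@mulfI _ n%:R); first by rewrite pnatr_eq0 -lt0n.
rewrite !weight_sum_rec //.
pose g k e := if (k.+1 * e <= n)%N then weight_sum 1 w (n - k.+1 * e)%N else 0.
have gN k e : (0 < e)%N -> (N <= k)%N -> g k e = 0.
  move=> e0 Nk; rewrite /g leqNgt (_ : (n < _)%N) //.
  by apply: leq_ltn_trans nN _; nia.
have gd k i : (N < d i)%N -> g k (d i) = 0.
  by move=> Ndi; rewrite /g leqNgt (_ : (n < _)%N) //; nia.
(* Grouping the indices by degree leaves only the power sums over each degree, which is what the
   hypothesis compares. *)
have byd (P : pred I) (F : nat -> I -> C) :
  \sum_(i | P i) \sum_(k < N) (d i)%:R * (F k i * g k (d i)) =
  \sum_(k < N) \sum_(e < N.+1) e%:R * g k e * \sum_(i | P i && (d i == e)) F k i.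
  rewrite exchange_big /=; apply: eq_bigr => k _.
  rewrite (bigID (fun i => d i <= N)%N) /= [X in _ + X]big1 ?addr0; last first.
    by move=> i /andP[_]; rewrite -ltnNge => /(gd k) ->; rewrite !mulr0.
  rewrite (partition_big (fun i => inord (d i) : 'I_N.+1) xpredT) //=.
  apply: eq_bigr => e _; rewrite big_distrr /=; apply: eq_big => [i|i].
    rewrite -andbA; congr (_ && _); apply/andP/eqP => [[dN /eqP <-]|->].
      by rewrite inordK.
    by rewrite inord_val eqxx -ltnS ltn_ord.
  move=> /andP [/andP[_ dN] /eqP <-]; by rewrite inordK // mulrA mulrAC.
transitivity (\sum_i \sum_(k < N) (d i)%:R * (w i ^+ k.+1 * g k (d i))).
  apply: eq_bigr => i _; apply: eq_bigr => k _.
  have -> : porbit (1 : {perm I}) i = [set i].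
    apply/setP => j; rewrite inE; apply/porbitP/eqP => [[x ->]|->].
      by rewrite expg1n perm1.
    by exists 0%N; rewrite expg0 perm1.
  rewrite !big_set1 /g; case: ifP => _; rewrite ?mulr0 //.
rewrite (byd xpredT (fun k i => w i ^+ k.+1)).
(* On the permutation side a cycle of length [l] has degree [l * d i], so its terms are those of
   degree [d i] at the multiples of [l], exactly where the power of [pi] fixes [i]. *)
transitivity (\sum_i \sum_(k < N) (d i)%:R * (((pi ^+ k.+1)%g i == i)%:R * g k (d i)));
  last first.
  apply: eq_bigr => i _; rewrite -!big_distrr /=; congr (_ * _).
  rewrite (eq_bigr (fun k : 'I_N => if (#|porbit pi i| %| k.+1)%N then g k (d i) else 0));
    last by move=> k _; rewrite porbit_expg_fix; case: ifP; rewrite ?mul1r ?mul0r.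
  rewrite -big_mkcond /= -(@sum_multiples _ (fun k => g k.-1 (d i))); last first.
  - by case=> // k Nk; apply: gN.
  - by rewrite lt0n card_porbit_neq0.
  apply: eq_bigr => k _; rewrite dporb.
  set l := #|porbit pi i|.
  have l0 : (0 < l)%N by rewrite lt0n card_porbit_neq0.
  rewrite /g prednK ?muln_gt0 ?l0 // mulnA [(k.+1 * l)%N]mulnC.
  case: ifP => // le; rewrite big1 ?expr1n ?mul1r //.
  apply: IH.
    rewrite ltn_subrL n0 andbT !muln_gt0 l0 d_gt0 //.
  by apply: leq_trans (leq_subr _ _) nN.
rewrite (byd xpredT (fun k i => ((pi ^+ k.+1)%g i == i)%:R)).
apply: eq_bigr => k _; apply: eq_bigr => e _; congr (_ * _).
rewrite tr -sum1_card natr_sum /= [LHS]big_mkcond [RHS]big_mkcond /=.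
apply: eq_bigr => i _; rewrite inE; case: (d i == e) => //=.
by case: (_ == _).
Qed.

End PowerSums.

Section MultAction.
Variables (I : finType) (n : nat).
Notation mult := {ffun I -> 'I_n.+1}.

Definition mult_perm (m : mult) (a : {perm I}) : mult :=
  [ffun i => m ((a^-1)%g i)].

Lemma mult_perm1 m : mult_perm m 1 = m.
Proof. by apply/ffunP => i; rewrite ffunE invg1 perm1. Qed.

Lemma mult_permM m a b : mult_perm m (a * b) = mult_perm (mult_perm m a) b.
Proof. by apply/ffunP => i; rewrite !ffunE invMg permM. Qed.

Canonical mult_action := TotalAction mult_perm1 mult_permM.
End MultAction.

(** * Counting multiplicity vectors *)

(* [I] indexes the irreducible representations, of degrees [d]; [o] is the
   trivial one, [A] the group of linear characters acting by tensoring, and [det]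
   sends a representation to its determinant character. *)
Section DetCount.
Variables (C : numFieldType) (I : finType) (d : I -> nat) (o : I).
Variables (A : {group {perm I}}) (det : I -> {perm I}).

(* The last condition for [k = 1] makes [e] nondegenerate; for all [k] it equates
   the traces of [c] on [C[I]], acting by the characters [e _ c] of the determinants
   on one side and by permutations on the other. *)
Definition dual_pairing (e : {perm I} -> {perm I} -> C) :=
  [/\ {in A &, forall a b, e a b = e b a},
      {in A &, forall a b, {in A, forall c, e (a * b)%g c = e a c * e b c}},
      {in A, forall c, e 1%g c = 1} &
      {in A, forall (c : {perm I}) k, \sum_(i | d i == k) e (det i) c =
                         #|[set i | (d i == k) && (c i == i)]|%:R}].

Definition mult_set n : {set {ffun I -> 'I_n.+1}} :=
  [set m : {ffun I -> 'I_n.+1} | (\sum_i d i * m i == n)%N].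

Definition det_mult n (m : {ffun I -> 'I_n.+1}) : {perm I} :=
  (\prod_i det i ^+ m i)%g.

Hypotheses (d_gt0 : forall i, (0 < d i)%N)
  (dA : {in A, forall (a : {perm I}) i, d (a i) = d i})
  (detA : forall i, det i \in A)
  (regA : {in A &, forall a b : {perm I}, a o = b o -> a = b})
  (linA : forall i, d i = 1%N -> exists2 a : {perm I}, a \in A & a o = i)
  (do1 : d o = 1%N)
  (det_lin : {in A, forall a : {perm I}, det (a o) = a}).

Lemma det_count e : dual_pairing e -> forall n,
  #|[set m in mult_set n | det_mult m == 1%g]| =
  #|[set orbit (mult_action I n) A m | m in mult_set n]|.
Proof.
move=> [eC eM e1 tr] n.
(* The trace identity for [k = 1]: the irreducibles of degree 1 are the [c o], and [A] moves them
   freely, so only [a = 1] fixes any. *)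
have orth a : a \in A -> \sum_(c in A) e a c = #|A|%:R * (a == 1%g)%:R.
  move=> aA; have := tr a aA 1%N.
  rewrite (reindex_onto (fun c : {perm I} => c o) det) /=; last first.
    by move=> i /eqP /linA [c cA <-]; rewrite det_lin.
  have AE (c : {perm I}) : (d (c o) == 1%N) && (det (c o) == c) = (c \in A).
    apply/andP/idP => [[_ /eqP <-] //|cA].
    by rewrite dA // do1 det_lin.
  rewrite (eq_bigl _ _ AE) => E.
  transitivity (\sum_(c in A) e (det (c o)) a).
    by apply: eq_bigr => c cA; rewrite det_lin // eC.
  rewrite E; have [->|a1] := eqVneq a 1%g; last first.
    rewrite mulr0 -[RHS]/(0%:R); congr (_%:R); apply: eq_card0 => i.
    rewrite inE; apply/negP => /andP [/eqP /linA [b bA <-]].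
    rewrite -!permM => /eqP ab; case/eqP: a1; apply: (mulgI b).
    by rewrite mulg1; apply: regA; rewrite ?groupM.
  rewrite mulr1; congr (_%:R).
  have inj : {in A &, injective (fun c : {perm I} => c o)} by move=> b c; apply: regA.
  rewrite -(card_in_imset inj).
  apply: eq_card => i; rewrite inE perm1 eqxx andbT.
  apply/eqP/imsetP => [/linA [c cA <-]|[c cA ->]]; first by exists c.
  by rewrite dA.
have eX a c k : a \in A -> c \in A -> e (a ^+ k)%g c = e a c ^+ k.
  move=> aA cA; elim: k => [|k IH]; first by rewrite expg0 e1.
  by rewrite expgS exprS eM ?groupX // IH.
have eXr a c k : a \in A -> c \in A -> e a (c ^+ k)%g = e a c ^+ k.
  by move=> aA cA; rewrite eC ?groupX // eX // eC.
have det_multA m : @det_mult n m \in A.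
  by apply: group_prod => i _; rewrite groupX.
have e_mult m c : c \in A -> e (@det_mult n m) c = \prod_i e (det i) c ^+ m i.
  move=> cA; rewrite /det_mult.
  suff [] : \prod_i e (det i) c ^+ m i = e (\prod_i det i ^+ m i)%g c /\
        (\prod_i det i ^+ m i)%g \in A by [].
  elim/big_rec2: _ => [|i x y _ [-> xA]]; first by rewrite e1.
  by rewrite eM ?eX ?groupM ?groupX.
have wsE c : c \in A -> \sum_(m in mult_set n) e (det_mult m) c =
    #|'Fix_(mult_set n | mult_action I n)[c]%g|%:R.
  move=> cA.
  (* The power sums of these weights are the sums of the trace identity at the powers of [c]. *)
  have := @weight_sum_perm C I d n d_gt0 c (fun i => e (det i) c) (dA cA).
  move=> /(_ _ n (leqnn n)) H.
  have -> : 'Fix_(mult_set n | mult_action I n)[c]%g = invariants d n c n.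
    apply/setP => m; rewrite in_setI [RHS]in_set [m \in mult_set n]in_set.
    apply/andP/andP => [[-> /afix1P/ffunP fx]|[-> /forallP inv]]; split => //.
      by apply/forallP => i; have := fx (c i); rewrite /= ffunE permK => <-.
    apply/afix1P/ffunP => i; rewrite /= ffunE.
    by rewrite -[in RHS](permKV c i) (eqP (inv _)).
  rewrite -H.
    rewrite /weight_sum; apply: eq_big => [m|m _]; last exact: e_mult.
    by rewrite !inE [X in _ = _ && X](_ : _ = true) ?andbT //;
       apply/forallP => i; rewrite perm1.
  move=> k l; rewrite -tr ?groupX //.
  by apply: eq_bigr => i _; rewrite eXr.
have acts : [acts A, on mult_set n | mult_action I n].
  apply/subsetP => a aA; rewrite !inE /=; apply/subsetP => m; rewrite !inE /=.
  move=> /eqP S; apply/eqP/(etrans _ S); rewrite (reindex_inj (@perm_inj _ a)) /=.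
  by apply: eq_bigr => i _; rewrite ffunE permK dA.
have := Frobenius_Cauchy acts => /(congr1 (fun k => k%:R : C)).
rewrite natr_sum natrM => FC.
apply/eqP; rewrite -(eqr_nat C); apply/eqP.
apply: (@mulIf _ #|A|%:R); first by rewrite pnatr_eq0 -lt0n cardG_gt0.
rewrite -FC -(eq_bigr _ (fun c cA => wsE c cA)) exchange_big /=.
rewrite (eq_bigr _ (fun m _ => orth _ (det_multA m))) -big_distrr /= mulrC.
congr (_ * _); rewrite -sum1_card natr_sum [LHS]big_mkcond [RHS]big_mkcond /=.
by apply: eq_bigr => m _; rewrite !inE; case: (_ == _); case: (_ == _).
Qed.

End DetCount.

(** * Roots of unity and pairings on the group of linear characters *)

Lemma prim_root_exists_closed (C : numClosedFieldType) n : (0 < n)%N ->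
  exists z : C, n.-primitive_root z.
Proof.
move=> n0; have [r Dr] := closed_field_poly_normal ('X^n - 1 : {poly C}).
have lc : lead_coef ('X^n - 1 : {poly C}) = 1 by apply/eqP; rewrite -monicE monicXnsubC.
rewrite lc scale1r in Dr.
have sz : size r = n.
  by apply/eqP; rewrite -eqSS -(size_prod_XsubC _ id) -Dr size_XnsubC.
have ur : uniq r.
  rewrite -separable_prod_XsubC -Dr.
  by apply: separable_Xn_sub_1; rewrite pnatr_eq0 -lt0n.
have rr : all n.-unity_root r.
  by apply/allP => z; rewrite -root_prod_XsubC -Dr.
have := has_prim_root n0 rr ur.
by rewrite sz leqnn => /(_ isT) /hasP [z _ pz]; exists z.
Qed.

Section Pairings.
Variables (C : numClosedFieldType) (I : finType) (d : I -> nat) (o : I).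
Variables (A : {group {perm I}}) (det : I -> {perm I}).
Hypotheses
  (dA : {in A, forall (a : {perm I}) i, d (a i) = d i})
  (detA : forall i, det i \in A)
  (regA : {in A &, forall a b : {perm I}, a o = b o -> a = b})
  (linA : forall i, d i = 1%N -> exists2 a : {perm I}, a \in A & a o = i)
  (do1 : d o = 1%N)
  (det_lin : {in A, forall a : {perm I}, det (a o) = a}).

Lemma sum_character_eq0 (f : {perm I} -> C) c : c \in A ->
  {in A &, forall a b, f (a * b)%g = f a * f b} -> f c != 1 ->
  \sum_(a in A) f a = 0.
Proof.
move=> cA fM fc1; set s := \sum_(a in A) f a.
have : s = f c * s.
  rewrite {1}/s (reindex_inj (mulgI c)) /= /s big_distrr /=.
  by apply: eq_big => [a|a]; rewrite groupMl // => aA; rewrite fM.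
move/eqP; rewrite -subr_eq0 -{1}[s]mul1r -mulrBl mulf_eq0 subr_eq0 eq_sym.
by rewrite (negbTE fc1) => /eqP.
Qed.

(** In degree 1 the trace identity follows from nondegeneracy: [A] acts regularly there, so both
    sides are the order of [A] at [c = 1] and 0 elsewhere. *)
Lemma dual_pairing_intro e :
    {in A &, forall a b, e a b = e b a} ->
    {in A &, forall a b, {in A, forall c, e (a * b)%g c = e a c * e b c}} ->
    {in A, forall c, e 1%g c = 1} ->
    {in A, forall c, c != 1%g -> exists2 a, a \in A & e a c != 1} ->
    {in A, forall (c : {perm I}) k, k != 1%N ->
       \sum_(i | d i == k) (e (det i) c - (c i == i)%:R) = 0} ->
  dual_pairing (C := C) d A det e.
Proof.
move=> eC eM e1 nd tr; split=> // c cA k.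
have -> : #|[set i | d i == k & c i == i]|%:R =
          \sum_(i | d i == k) (c i == i)%:R :> C.
  rewrite -sum1_card natr_sum big_mkcond [RHS]big_mkcond /=.
  by apply: eq_bigr => i _; rewrite inE; case: (d i == k) => //=; case: (_ == _).
apply/eqP; rewrite -subr_eq0 -sumrB; apply/eqP.
have [->|k1] := eqVneq k 1%N; last exact: tr.
rewrite (reindex_onto (fun c : {perm I} => c o) det) /=; last first.
  by move=> i /eqP /linA [b bA <-]; rewrite det_lin.
have AE (b : {perm I}) : (d (b o) == 1%N) && (det (b o) == b) = (b \in A).
  apply/andP/idP => [[_ /eqP <-] //|bA].
  by rewrite dA // do1 det_lin.
rewrite (eq_bigl _ _ AE) sumrB.
rewrite (eq_bigr (fun b => e b c)); last by move=> b bA; rewrite det_lin.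
rewrite [X in _ - X](eq_bigr (fun b => (c == 1%g)%:R)); last first.
  move=> b bA; suff -> : (c (b o) == b o) = (c == 1%g) by [].
  apply/eqP/eqP => [|->]; last by rewrite perm1.
  by rewrite -!permM => /regA E; apply: (mulgI b); rewrite mulg1 E ?groupM.
have [->|c1] := eqVneq c 1%g.
  by rewrite (eq_bigr (fun=> 1)) ?subrr // => b bA; rewrite eC // e1.
rewrite [X in _ - X]big1 // subr0.
have [a aA ac] := nd c cA c1.
by apply: (@sum_character_eq0 (fun b => e b c) a) => // x y xA yA; rewrite eM.
Qed.

(** The pairing of [c ^+ i] and [c ^+ j] is [z ^+ (i * j)] for a primitive root [z]. The last clause
    is for the cases that need actual values such as [-1]. *)
Lemma cyclic_pairing c : A :=: <[c]>%g -> exists e : {perm I} -> {perm I} -> C,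
  [/\ {in A &, forall a b, e a b = e b a},
      {in A &, forall a b, {in A, forall c, e (a * b)%g c = e a c * e b c}},
      {in A, forall c, e 1%g c = 1},
      {in A, forall c, c != 1%g -> exists2 a, a \in A & e a c != 1} &
      #[c]%g.-primitive_root (e c c)].
Proof.
move=> Ac; have [z zP] := prim_root_exists_closed C (order_gt0 c).
(* A discrete logarithm to base [c]; on [A] the default 0 is never reached. *)
pose lg a := odflt 0%N (omap val [pick k : 'I_#[c]%g | (c ^+ k)%g == a]).
have lgP a : a \in A -> (c ^+ lg a)%g = a.
  rewrite Ac => /cyclePmin [k kc ->]; rewrite /lg; case: pickP => [j /eqP //|].
  by move=> /(_ (Ordinal kc)) /=; rewrite eqxx.
pose e a b := z ^+ (lg a * lg b).
have zE j k : (c ^+ j)%g = (c ^+ k)%g -> forall l, z ^+ (j * l) = z ^+ (k * l).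
  move=> /eqP; rewrite eq_expg_mod_order => jk l.
  by apply/eqP; rewrite (eq_prim_root_expr zP) -modnMml (eqP jk) modnMml.
have lgz a k : a \in A -> (c ^+ k)%g = a -> forall l, z ^+ (lg a * l) = z ^+ (k * l).
  by move=> aA E; apply: zE; rewrite lgP // E.
have cA : c \in A by rewrite Ac cycle_id.
exists e; split.
- by move=> a b aA bA; rewrite /e mulnC.
- move=> a b aA bA x xA; rewrite /e (@lgz _ (lg a + lg b)%N) ?groupM //.
    by rewrite mulnDl exprD.
  by rewrite expgD !lgP.
- by move=> x xA; rewrite /e (@lgz _ 0%N) ?group1 // mul0n.
- move=> x xA x1; exists c => //; rewrite /e (@lgz _ 1%N) // mul1n.
  apply: contraNneq x1 => /eqP; rewrite -(prim_order_dvd zP) => /dvdnP [q E].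
  by rewrite -(lgP x) // E mulnC expgM expg_order expg1n.
- by rewrite /e (@lgz _ 1%N) // mul1n -[lg c]muln1 (@lgz _ 1%N) // expr1.
Qed.

End Pairings.

(** * The pairing read off the McKay graph *)

(* [M] is the adjacency matrix of the McKay graph: tensoring [i] with the
   two-dimensional representation gives [\sum_j M i j * j]. *)
Section McKay.
Variables (C : numClosedFieldType) (I : finType) (d : I -> nat) (o : I).
Variables (M : I -> I -> nat) (A : {group {perm I}}) (det : I -> {perm I}).
Hypotheses
  (d_gt0 : forall i, (0 < d i)%N)
  (dA : {in A, forall (a : {perm I}) i, d (a i) = d i})
  (detA : forall i, det i \in A)
  (regA : {in A &, forall a b : {perm I}, a o = b o -> a = b})
  (linA : forall i, d i = 1%N -> exists2 a : {perm I}, a \in A & a o = i)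
  (do1 : d o = 1%N)
  (det_lin : {in A, forall a : {perm I}, det (a o) = a})
  (M_sym : forall i j, M i j = M j i)
  (M_d : forall i, (\sum_j M i j * d j = 2 * d i)%N)
  (conn : forall S : pred I, S o ->
     (forall i j, S i -> (0 < M i j)%N -> S j) -> forall i, S i)
  (MA : {in A, forall (a : {perm I}) i j, M (a i) (a j) = M i j})
  (det_act : {in A, forall (a : {perm I}) i, det (a i) = (a ^+ d i * det i)%g})
  (det_M : forall i (s : seq I), uniq s ->
     (forall j, (0 < M i j)%N -> j \in s) ->
     (\prod_(j <- s) det j ^+ M i j = det i ^+ 2)%g)
  (abA : abelian A).

Notation has_pairing := (exists e, dual_pairing (C := C) d A det e).

(** The search of the diagram rests on this count and its three consequences: a bound on a neighbour
    outside a list, the existence of one when the list falls short, and completeness of the list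
    when it does not. *)
Lemma M_split i (s : seq I) : uniq s ->
  (\sum_(j <- s) M i j * d j + \sum_(j | j \notin s) M i j * d j = 2 * d i)%N.
Proof. by move=> us; rewrite -M_d [RHS](bigID (mem s)) /= big_uniq. Qed.

Lemma M_room i s j : uniq s -> j \notin s ->
  (\sum_(k <- s) M i k * d k + M i j * d j <= 2 * d i)%N.
Proof. by move=> us js; rewrite -(M_split i us) leq_add2l (bigD1 j) //= leq_addr. Qed.

Lemma M_more i s : uniq s -> (\sum_(k <- s) M i k * d k < 2 * d i)%N ->
  exists2 j, j \notin s & (0 < M i j)%N.
Proof.
move=> us lt; case: (pickP [pred j | (j \notin s) && (0 < M i j)%N]) => [j|none].
  by case/andP; exists j.
have := M_split i us; rewrite [X in (_ + X)%N]big1 ?addn0 => [E|j js]; first by rewrite E ltnn in lt.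
by have := none j; rewrite /= js /= lt0n => /negbFE /eqP ->.
Qed.

Lemma M_full i s j : uniq s -> (2 * d i <= \sum_(k <- s) M i k * d k)%N ->
  (0 < M i j)%N -> j \in s.
Proof.
move=> us le nb; apply/negPn/negP => js.
have := M_room i us js; have := d_gt0 j; nia.
Qed.

Lemma det_o : det o = 1%g.
Proof. by rewrite -{1}[o](perm1 o) det_lin // group1. Qed.

Lemma M_act a i j : a \in A -> M (a i) j = M i ((a^-1)%g j).
Proof. by move=> aA; rewrite -{1}[j](permKV a) MA. Qed.

Lemma d_act a i : a \in A -> d ((a^-1)%g i) = d i.
Proof. by move=> aA; rewrite dA // groupV. Qed.

(** By translation and connectivity every node is linear. The determinants of the neighbours of [o],
    with multiplicity, multiply to 1, so a single one of them generates [A]. *)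
Lemma pairing_cyclic : (forall j, (0 < M o j)%N -> d j = 1%N) -> has_pairing.
Proof.
move=> lin.
have all1 i : d i = 1%N.
  apply/eqP; move: i; apply: (@conn (fun i => d i == 1%N)) => [|i j]; first by rewrite do1.
  move=> /eqP /linA [a aA <-]; rewrite M_act // => /lin.
  by rewrite d_act // => ->.
have [j0 _ nb0] : exists2 j, j \notin [::] & (0 < M o j)%N.
  by apply: M_more; rewrite // big_nil do1.
have [c cA cj] := linA (all1 j0).
have dj0 : det j0 = c by rewrite -cj det_lin.
have nbc k : (0 < M o k)%N -> det k \in <[c]>%g.
  move=> nbk; have [->|kj] := eqVneq k j0; first by rewrite dj0 cycle_id.
  have us : uniq [:: j0; k] by rewrite /= inE eq_sym kj.
  have ks : k \notin [:: j0] by rewrite inE.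
  have := M_room o (isT : uniq [:: j0]) ks; rewrite big_seq1 !all1 !muln1 => le2.
  have ful : forall j, (0 < M o j)%N -> j \in [:: j0; k].
    by move=> j; apply: M_full; rewrite // !big_cons big_nil !all1; lia.
  have := det_M us ful; rewrite !big_cons big_nil mulg1 det_o expg1n.
  have -> : M o j0 = 1%N by lia.
  have -> : M o k = 1%N by lia.
  rewrite !expg1 dj0 => /eqP; rewrite -eq_invg_mul => /eqP <-.
  by rewrite groupV cycle_id.
have Ac : A :=: <[c]>%g.
  apply/eqP; rewrite eqEsubset cycle_subG cA andbT; apply/subsetP => a aA.
  rewrite -(det_lin aA).
  move: (a o); apply: (@conn (fun i => det i \in <[c]>%g)) => [|i j]; first by rewrite det_o group1.
  have [b bA <-] := linA (all1 i).
  rewrite det_lin // => bc; rewrite M_act // => /nbc.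
  have [b' b'A <-] := linA (all1 j); rewrite -permM (det_lin b'A).
  have bb : (b' * b^-1)%g \in A by rewrite groupM ?groupV.
  by rewrite (det_lin bb) groupMr // groupV.
have [e [eC eM e1 nd _]] := cyclic_pairing C Ac.
exists e; apply: (dual_pairing_intro (o := o)) => // b bA k k1.
by rewrite big_pred0 // => i; rewrite all1 eq_sym (negbTE k1).
Qed.

(** * Diagrams in which the two-dimensional representation is irreducible *)

Section Irreducible.
Variable V : I.
Hypotheses (dV : d V = 2%N) (MoV : M o V = 1%N).

Lemma nb_o j : (0 < M o j)%N -> j = V.
Proof.
move=> nb; apply/eqP; rewrite -(mem_seq1 j V).
by apply: M_full nb => //; rewrite big_seq1 MoV dV do1.
Qed.

Lemma nb_lin a j : a \in A -> (0 < M (a o) j)%N -> j = a V.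
Proof.
by move=> aA; rewrite M_act // => /nb_o <-; rewrite permKV.
Qed.

Lemma nb_lin_r a j : a \in A -> (0 < M j (a o))%N -> j = a V.
Proof. by rewrite M_sym; apply: nb_lin. Qed.

Lemma M_lin a : a \in A -> M (a o) (a V) = 1%N.
Proof. by move=> aA; rewrite MA. Qed.

Lemma det_V : det V = 1%g.
Proof.
have := @det_M o [:: V] isT; rewrite big_seq1 MoV det_o expg1 expg1n; apply.
by move=> j /nb_o ->; rewrite inE.
Qed.

(* The long arm of an exceptional diagram, with degrees 1, 2, ..., [m.+1] *)
Definition chain m (s : nat -> I) :=
  [/\ s 0%N = o, s 1%N = V, (forall k, k <= m -> d (s k) = k.+1)%N &
     (forall k, k < m -> M (s k) (s k.+1) = 1)%N].

Lemma chain_nb m s k j : chain m s -> (0 < k < m)%N -> (0 < M (s k) j)%N ->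
  j \in [:: s k.-1; s k.+1].
Proof.
case=> _ _ ds Ms /andP [k0 km]; apply: M_full.
  rewrite /= inE andbT; apply: contra_eqN (ds k.+1 km) => /eqP <-.
  by rewrite ds; lia.
case: k k0 km => // k _ km /=.
by rewrite !big_cons big_nil [M _ (s k)]M_sym !Ms ?ds; lia.
Qed.

Lemma max_chain : exists m s, [/\ (0 < m)%N, chain m s &
  forall j, (0 < M (s m) j)%N -> d j != m.+2].
Proof.
(* Either a maximal chain exists or there are chains of every length; the degrees along a chain are
   distinct, so the size of [I] bounds the length. *)
suff step n : (exists m s, [/\ (0 < m)%N, chain m s &
     forall j, (0 < M (s m) j)%N -> d j != m.+2]) \/ exists s, chain n.+1 s.
  case: (step #|I|) => // [[s [_ _ ds _]]].
  have inj : injective (fun k : 'I_#|I|.+1 => s k).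
    move=> k l /(congr1 d); rewrite !ds //; last by rewrite ltnW.
      by case=> /val_inj.
    by rewrite ltnW.
  by have := leq_card _ inj; rewrite card_ord ltnn.
elim: n => [|n [?|[s cs]]].
- right; exists (fun k => if k == 0%N then o else V); split=> //.
    by case=> [|[|]].
  by case.
- by left.
case: (pickP [pred j | (0 < M (s n.+1) j)%N && (d j == n.+3)]) => [j|none]; last first.
  left; exists n.+1, s; split=> // j nb.
  by have := none j; rewrite /= nb /= => ->.
case/andP=> nb /eqP dj; right; case: cs => s0 s1 ds Ms.
exists (fun k => if k == n.+2 then j else s k); split=> //.
  move=> k kn; case: eqP => [->|] // /eqP kn'; rewrite ds //.
  by rewrite -ltnS ltn_neqAle kn'.
move=> k kn; rewrite eqSS (ltn_eqF kn); case: eqP => [->|/eqP kn']; last first.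
  by rewrite Ms // ltn_neqAle kn' -ltnS.
have js : j \notin [:: s n].
  by rewrite inE; apply: contra_eqN dj => /eqP ->; rewrite ds //; lia.
have := M_room (s n.+1) (isT : uniq [:: s n]) js.
by rewrite big_seq1 M_sym Ms // !ds // dj; move: nb; nia.
Qed.

(* The branch point of an exceptional diagram: the remaining neighbours of the
   end [s m] of a maximal chain. *)
Lemma chain_end m s : (1 < m)%N -> chain m s ->
    (forall j, (0 < M (s m) j)%N -> d j != m.+2) ->
  exists X Y, [/\ uniq [:: s m.-1; X; Y], M (s m) X = 1%N, M (s m) Y = 1%N,
    (d X + d Y = m.+2)%N /\ (m.+1 <= 2 * d X /\ d X <= d Y)%N &
    forall j, (0 < M (s m) j)%N -> j \in [:: s m.-1; X; Y]].
Proof.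
move=> m1 [_ _ ds Ms] maxm; set x := s m; set p := s m.-1.
have dx : d x = m.+1 by rewrite ds.
have dp : d p = m by rewrite ds ?prednK; lia.
have Mxp : M x p = 1%N.
  by rewrite M_sym; have := Ms m.-1; rewrite prednK; [apply; lia | lia].
(* Seen from [j], the node [x] of degree [m.+1] has to fit into [2 * d j]. *)
have low j : (M x j * m.+1 <= 2 * d j)%N.
  have := @M_room j [::] x isT isT; rewrite big_nil M_sym dx; lia.
(* Besides [p], the neighbours of [x] have total degree [m.+2]. A single one of that degree is
   excluded by maximality, so there are at least two. *)
have room j : j != p -> (0 < M x j)%N -> M x j = 1%N /\ (d j <= m.+1)%N.
  move=> jp nb; have js : j \notin [:: p] by rewrite inE.
  have := @M_room x [:: p] j isT js; rewrite big_seq1 Mxp dp dx.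
  have := low j; have := maxm j nb; nia.
have [X Xp nbX] : exists2 j, j \notin [:: p] & (0 < M x j)%N.
  by apply: M_more; rewrite // big_seq1 Mxp dp dx; lia.
rewrite inE in Xp; have [MX dX] := room X Xp nbX.
have upX : uniq [:: p; X] by rewrite /= inE eq_sym Xp.
have [Y Ys nbY] : exists2 j, j \notin [:: p; X] & (0 < M x j)%N.
  apply: M_more => //; rewrite !big_cons big_nil Mxp MX dp dx; lia.
have := Ys; rewrite !inE negb_or => /andP [Yp YX].
have [MY dY] := room Y Yp nbY.
have upXY : uniq [:: p; X; Y].
  by rewrite /= !inE negb_or eq_sym Xp eq_sym Yp eq_sym YX.
have le : (d X + d Y <= m.+2)%N.
  have := M_room x upX Ys; rewrite !big_cons big_nil Mxp MX MY dp dx; lia.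
have lX := low X; have lY := low Y; rewrite MX in lX; rewrite MY in lY.
(* By [low], a third neighbour would require [3 * m.+1 <= 2 * m.+2], which fails for [1 < m]. *)
have dXY : (d X + d Y = m.+2)%N.
  have [->|/eqP ne] := eqVneq (d X + d Y)%N m.+2 => //.
  have [W Ws nbW] : exists2 j, j \notin [:: p; X; Y] & (0 < M x j)%N.
    by apply: M_more; rewrite // !big_cons big_nil Mxp MX MY dp dx; lia.
  have := M_room x upXY Ws; rewrite !big_cons big_nil Mxp MX MY dp dx.
  have := low W; nia.
have ful j : (0 < M x j)%N -> j \in [:: p; X; Y].
  by apply: M_full; rewrite // !big_cons big_nil Mxp MX MY dp dx; lia.
case: (leqP (d X) (d Y)) => leXY; first by exists X, Y; split=> //; split=> //; lia.
exists Y, X; split=> //.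
- by rewrite /= !inE negb_or eq_sym Yp eq_sym Xp YX.
- by split; lia.
by move=> j /ful; rewrite !inE => /or3P [] ->; rewrite ?orbT.
Qed.

Lemma linear_nb Z j : (0 < M Z j)%N -> d j = 1%N ->
  exists2 a, a \in A & [/\ j = a o, Z = a V, d Z = 2%N & M Z j = 1%N].
Proof.
move=> nb /linA [a aA E]; exists a => //; move: nb; rewrite -E => nb.
have EZ := nb_lin_r aA nb; split=> //; first by rewrite EZ dA.
by rewrite EZ M_sym M_lin.
Qed.

(** Besides [x], the neighbours of [Z] have total degree 1, so there is one and it is linear. Then
    [Z] is a twist of [V], of degree 2, whence [m = 2]. *)
Lemma chain_end_half m x Z : d x = m.+1 -> (1 < m)%N -> M Z x = 1%N ->
    (2 * d Z = m.+2)%N ->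
  m = 2%N /\ exists2 a, a \in A & Z = a V /\
    forall j, (0 < M Z j)%N -> j \in [:: x; a o].
Proof.
move=> dx m1 MZ dZ.
have [j jx nb] : exists2 j, j \notin [:: x] & (0 < M Z j)%N.
  by apply: M_more; rewrite // big_seq1 MZ dx; lia.
have := M_room Z (isT : uniq [:: x]) jx; rewrite big_seq1 MZ dx => le.
have dj : d j = 1%N by have := d_gt0 j; nia.
have [a aA [Ej EZ dZ2 MZj]] := linear_nb nb dj.
split; first by lia.
exists a => //; split=> //; rewrite -Ej => k; apply: M_full.
  by move: jx; rewrite /= !inE eq_sym andbT.
by rewrite !big_cons big_nil MZ MZj dx dj; lia.
Qed.

Lemma trace_at_1 e (k : nat) : {in A &, forall a b, e a b = e b a} ->
    {in A, forall c, e 1%g c = 1} ->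
  \sum_(i | d i == k) (e (det i) 1%g - ((1 : {perm I})%g i == i)%:R) = 0 :> C.
Proof.
move=> eC e1; rewrite big1 // => i _.
by rewrite eC ?group1 // e1 // perm1 eqxx subrr.
Qed.

(** [A] has order 3 and permutes the three arms. The nodes of degree 2 are the [f V] with [f] in
    [A]: they are moved freely and have determinant [f ^+ 2]. As 3 is odd, the square of a
    nontrivial character is nontrivial and sums to 0. The only node of degree 3 has trivial
    determinant. *)
Lemma pairing_E6 s X Y : chain 2 s -> uniq [:: V; X; Y] ->
    d X = 2%N -> d Y = 2%N -> M (s 2%N) X = 1%N -> M (s 2%N) Y = 1%N ->
    (forall j, (0 < M (s 2%N) j)%N -> j \in [:: V; X; Y]) ->
  has_pairing.
Proof.
move=> cs uXY dX dY MX MY fulx; have [s0 s1 ds Ms] := cs.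
set x := s 2%N in MX MY fulx; have dx : d x = 3%N by rewrite ds.
rewrite M_sym in MX; rewrite M_sym in MY.
have dX' : (2 * d X = 4)%N by rewrite dX.
have dY' : (2 * d Y = 4)%N by rewrite dY.
have [_ [a aA [EX fulX]]] := chain_end_half dx (isT : 1 < 2)%N MX dX'.
have [_ [b bA [EY fulY]]] := chain_end_half dx (isT : 1 < 2)%N MY dY'.
have fulV j : (0 < M V j)%N -> j \in [:: o; x].
  by move=> nb; have := chain_nb (k := 1) cs isT; rewrite s1 s0; apply.
have all_in i : i \in [:: o; V; x; X; Y; a o; b o].
  move: i; apply: (@conn (fun i => i \in [:: o; V; x; X; Y; a o; b o])).
    by rewrite inE eqxx.
  move=> i j; rewrite !inE => /or4P [||| /or4P []] /eqP ->.
  - by move/nb_o ->; rewrite eqxx ?orbT.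
  - by move/fulV; rewrite !inE => /orP [] ->; rewrite ?orbT.
  - by move/fulx; rewrite !inE => /or3P [] ->; rewrite ?orbT.
  - by move/fulX; rewrite !inE => /orP [] ->; rewrite ?orbT.
  - by move/fulY; rewrite !inE => /orP [] ->; rewrite ?orbT.
  - by move/(nb_lin aA) ->; rewrite -EX eqxx ?orbT.
  - by move/(nb_lin bA) ->; rewrite -EY eqxx ?orbT.
have dao : d (a o) = 1%N by rewrite dA.
have dbo : d (b o) = 1%N by rewrite dA.
have := uXY; rewrite /= !inE negb_or => /andP [/andP [VX VY] /andP [XY _]].
have a1 : a != 1%g by apply: contraNneq VX => a1; rewrite EX a1 perm1.
have b1 : b != 1%g by apply: contraNneq VY => b1; rewrite EY b1 perm1.
have ab : a != b by apply: contraNneq XY => ab; rewrite EX EY ab.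
have AE c : c \in A -> c \in [:: 1%g; a; b].
  move=> cA; have dc : d (c o) = 1%N by rewrite dA.
  have := all_in (c o); rewrite !inE => /or4P [||| /or4P []] /eqP E;
    move: dc; rewrite E ?do1 ?dV ?dx ?dX ?dY // => _.
  - by rewrite -{2}[o](perm1 o) in E; rewrite (regA cA (group1 A) E) eqxx.
  - by rewrite (regA cA aA E) eqxx orbT.
  - by rewrite (regA cA bA E) eqxx !orbT.
have cardA : #|A| = 3%N.
  have us : uniq [:: 1%g; a; b] by rewrite /= !inE negb_or eq_sym a1 eq_sym b1 ab.
  have <- : #|[:: 1%g; a; b]| = 3%N by rewrite (card_uniqP us).
  apply: eq_card => c; apply/idP/idP; first exact: AE.
  by rewrite !inE => /or3P [] /eqP ->.
have /cyclicP [c Ac] : cyclic A by rewrite prime_cyclic // cardA.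
have [e [eC eM e1 nd _]] := cyclic_pairing C Ac.
exists e; apply: (dual_pairing_intro (o := o)) => // {c Ac} c cA k k1.
have injV : {in A &, injective (fun c : {perm I} => c V)}.
  move=> f g fA gA /= fg; apply: regA => //.
  have : (0 < M V ((g^-1)%g (f o)))%N by rewrite -M_act // -fg MA // M_sym MoV.
  move/fulV; rewrite !inE => /orP [] /eqP E; first by rewrite -[f o](permKV g) E.
  by move: dx; rewrite -E d_act // dA // do1.
have d_x i : (d i == 3%N) = (i == x).
  apply/eqP/eqP => [di|-> //]; have := all_in i.
  by rewrite !inE => /or4P [||| /or4P []] /eqP // E;
    move: di; rewrite E ?do1 ?dV ?dX ?dY ?dao ?dbo.
have det_x : det x = 1%g.
  have M1 : M V o = 1%N by rewrite M_sym.
  have M2 : M V x = 1%N by have := Ms 1%N isT; rewrite s1.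
  have us : uniq [:: o; x].
    by rewrite /= inE andbT; apply: contra_eqN dx => /eqP <-; rewrite do1.
  have := det_M us fulV; rewrite !big_cons big_nil M1 M2 det_V det_o.
  by rewrite !expg1 expg1n mulg1 mul1g.
have d_V i : (d i == 2%N) = (i \in [set (c : {perm I}) V | c in A]).
  apply/eqP/imsetP => [di|[f fA ->]]; last by rewrite dA.
  have := all_in i; rewrite !inE => /or4P [||| /or4P []] /eqP E;
    move: di; rewrite E ?do1 ?dV ?dx ?dX ?dY ?dao ?dbo // => _.
  - by exists 1%g; rewrite ?group1 ?perm1.
  - by exists a.
  - by exists b.
have [k2|k2] := eqVneq k 2%N; last first.
  have [->|k3] := eqVneq k 3%N.
    rewrite (big_pred1 x) // det_x e1 //.
    by have := d_x (c x); rewrite dA // dx eqxx => /esym ->; rewrite subrr.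
  rewrite big_pred0 // => i; apply/eqP => di; move: k1 k2 k3; rewrite -di.
  have := all_in i; rewrite !inE => /or4P [||| /or4P []] /eqP ->;
   by rewrite ?do1 ?dV ?dx ?dX ?dY ?dao ?dbo.
rewrite k2 (eq_bigl _ _ d_V) big_imset //=.
have [->|c1] := eqVneq c 1%g.
  by rewrite big1 // => f fA; rewrite perm1 eqxx eC ?group1 // e1 // subrr.
rewrite sumrB [X in _ - X]big1 ?subr0; last first.
  move=> f fA; case: eqP => // /eqP; rewrite -permM (inj_in_eq injV) ?groupM //.
  by rewrite -{2}[f]mulg1 (inj_eq (mulgI f)) (negbTE c1).
rewrite (eq_bigr (fun f => e f c ^+ 2)); last first.
  by move=> f fA; rewrite det_act // dV det_V mulg1 eM.
have [f fA fc] := nd c cA c1.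
apply: (@sum_character_eq0 C I A _ f) => // [g h gA hA|].
  by rewrite eM // exprMn.
apply: contra fc => /eqP f2.
have f3 : (f * (f * f) = 1)%g.
  by have := expg_cardG fA; rewrite cardA !expgS expg0 mulg1.
have : e f c ^+ 3 = 1 by rewrite exprS expr2 -!eM ?groupM // f3 e1.
by rewrite exprS f2 mulr1 => ->.
Qed.

(** [A] has order 2, and its generator [a] reflects the diagram: it exchanges [V] with [Z] and [s 2]
    with [Y], and fixes [s 3] and [X]. The determinant is [a] on [X] and [Y] and trivial on the
    other nodes of degree at least 2. As [e a a = -1], the sums at [c = a] in degrees 2, 3, 4 are 1,
    0, 1, the numbers of fixed nodes. *)
Lemma pairing_E7 s X Y Z : chain 3 s -> uniq [:: s 2%N; X; Y] ->
    d X = 2%N -> d Y = 3%N -> d Z = 2%N ->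
    M (s 3%N) X = 1%N -> M (s 3%N) Y = 1%N -> M Y Z = 1%N ->
    (forall j, (0 < M (s 3%N) j)%N -> j \in [:: s 2%N; X; Y]) ->
    (forall j, (0 < M X j)%N -> j \in [:: s 3%N]) ->
    (forall j, (0 < M Y j)%N -> j \in [:: s 3%N; Z]) ->
  has_pairing.
Proof.
move=> cs uXY dX dY dZ MX MY MZ fulx fulX fulY; have [s0 s1 ds Ms] := cs.
set x := s 3%N in MX MY fulx fulX fulY; set p := s 2%N in uXY fulx.
have dx : d x = 4%N by rewrite ds.
have dp : d p = 3%N by rewrite ds.
have Mpx : M p x = 1%N by rewrite Ms.
have MVp : M V p = 1%N by rewrite -s1 Ms.
have fulV j : (0 < M V j)%N -> j \in [:: o; p].
  by move=> nb; have := chain_nb (k := 1) cs isT; rewrite s1 s0; apply.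
have fulp j : (0 < M p j)%N -> j \in [:: V; x].
  by move=> nb; have := chain_nb (k := 2) cs isT; rewrite s1; apply.
rewrite M_sym in MZ.
have [l lY nbl] : exists2 j, j \notin [:: Y] & (0 < M Z j)%N.
  by apply: M_more; rewrite // big_seq1 MZ dY dZ.
have := M_room Z (isT : uniq [:: Y]) lY; rewrite big_seq1 MZ dY dZ => le.
have dl : d l = 1%N by have := d_gt0 l; nia.
have [a aA [El EZ _ MZl]] := linear_nb nbl dl.
have uYl : uniq [:: Y; l] by rewrite /= inE andbT; move: lY; rewrite inE eq_sym.
have fulZ j : (0 < M Z j)%N -> j \in [:: Y; l].
  by apply: M_full; rewrite // !big_cons big_nil MZ MZl dY dl dZ.
have all_in i : i \in [:: o; V; p; x; X; Y; Z; l].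
  move: i; apply: (@conn (fun i => i \in [:: o; V; p; x; X; Y; Z; l])).
    by rewrite inE eqxx.
  move=> i j; rewrite !inE => /or4P [||| /or4P [|||/orP []]] /eqP ->.
  - by move/nb_o ->; rewrite eqxx ?orbT.
  - by move/fulV; rewrite !inE => /orP [] ->; rewrite ?orbT.
  - by move/fulp; rewrite !inE => /orP [] ->; rewrite ?orbT.
  - by move/fulx; rewrite !inE => /or3P [] ->; rewrite ?orbT.
  - by move/fulX; rewrite !inE => ->; rewrite ?orbT.
  - by move/fulY; rewrite !inE => /orP [] ->; rewrite ?orbT.
  - by move/fulZ; rewrite !inE => /orP [] ->; rewrite ?orbT.
  - by rewrite El => /(nb_lin aA) ->; rewrite -EZ eqxx ?orbT.
have := uXY; rewrite /= !inE negb_or => /andP [/andP [pX pY] /andP [XY _]].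
have VZ : V != Z.
  apply: contraNneq pY => VZ; have : (0 < M V Y)%N by rewrite VZ MZ.
  by move/fulV; rewrite !inE => /orP [] /eqP E; [move: dY; rewrite E do1 | rewrite E].
have VX : V != X.
  apply/eqP => VX; have : (0 < M V x)%N by rewrite VX M_sym MX.
  by move/fulV; rewrite !inE => /orP [] /eqP E; move: dx; rewrite E ?do1 ?dp.
have XZ : X != Z.
  apply/eqP => XZ; have : (0 < M Z x)%N by rewrite -XZ M_sym MX.
  by move/fulZ; rewrite !inE => /orP [] /eqP E; move: dx; rewrite E ?dY ?dl.
have a1 : a != 1%g by apply: contraNneq VZ => a1; rewrite EZ a1 perm1.
have AE c : c \in A -> c = 1%g \/ c = a.
  move=> cA; have dc : d (c o) = 1%N by rewrite dA.
  have := all_in (c o); rewrite !inE => /or4P [||| /or4P [|||/orP []]] /eqP E;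
    move: dc; rewrite E ?do1 ?dV ?dx ?dX ?dY ?dZ ?dp // => _.
  - by left; rewrite -{2}[o](perm1 o) in E; exact: (regA cA (group1 A) E).
  - by right; rewrite El in E; exact: (regA cA aA E).
have aa : (a * a = 1)%g.
  have [//|/eqP] := AE (a * a)%g (groupM aA aA).
  by rewrite -{3}[a]mulg1 (inj_eq (mulgI a)) (negbTE a1).
have aZ : a Z = V by rewrite EZ -permM aa perm1.
have cardA : A :=: <[a]>%g.
  apply/eqP; rewrite eqEsubset cycle_subG aA andbT; apply/subsetP => c.
  by move=> /AE [] ->; rewrite ?group1 ?cycle_id.
have aX : a X = X.
  have daX : d (a X) = 2%N by rewrite dA.
  have := all_in (a X); rewrite !inE => /or4P [||| /or4P [|||/orP []]] /eqP E //;
    move: daX; rewrite E ?do1 ?dx ?dY ?dl ?dp // => _.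
  - by case/eqP: XZ; apply: (@perm_inj _ a); rewrite E aZ.
  - by case/eqP: VX; apply: (@perm_inj _ a); rewrite E EZ.
have ap : a p = Y.
  have dap : d (a p) = 3%N by rewrite dA.
  have := all_in (a p); rewrite !inE => /or4P [||| /or4P [|||/orP []]] /eqP E //;
    move: dap; rewrite E ?do1 ?dx ?dX ?dZ ?dV ?dl // => _.
  have : (0 < M p Z)%N by rewrite -E EZ MA // M_sym MVp.
  by move/fulp; rewrite !inE => /orP [] /eqP E'; [case/eqP: VZ | move: dx; rewrite -E' dZ].
have aY : a Y = p by rewrite -ap -permM aa perm1.
have ax : a x = x.
  have dax : d (a x) = 4%N by rewrite dA.
  by have := all_in (a x); rewrite !inE => /or4P [||| /or4P [|||/orP []]] /eqP E //;
    move: dax; rewrite E ?do1 ?dX ?dY ?dZ ?dV ?dl ?dp.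
(* Determinants propagate along the arms: those of the neighbours of a node multiply to the square
   of its own. *)
have det_p : det p = 1%g.
  have us : uniq [:: o; p].
    by rewrite /= inE andbT; apply: contra_eqN dp => /eqP <-; rewrite do1.
  have := det_M us fulV; rewrite !big_cons big_nil [M V o]M_sym MoV MVp det_V det_o.
  by rewrite !expg1 expg1n mulg1 mul1g.
have det_x : det x = 1%g.
  have us : uniq [:: V; x].
    by rewrite /= inE andbT; apply: contra_eqN dx => /eqP <-; rewrite dV.
  have := det_M us fulp; rewrite !big_cons big_nil [M p V]M_sym MVp Mpx det_V det_p.
  by rewrite !expg1 expg1n mulg1 mul1g.
have det_Z : det Z = 1%g by rewrite EZ det_act // dV det_V mulg1.
have det_Y : det Y = a.
  have := det_M uYl fulZ; rewrite !big_cons big_nil MZ MZl det_Z El det_lin //.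
  rewrite !expg1 expg1n mulg1 -aa => E.
  by apply: (mulIg a).
have det_X : det X = a.
  have := det_M uXY fulx; rewrite !big_cons big_nil [M x p]M_sym Mpx MX MY det_x det_p.
  rewrite det_Y !expg1 expg1n mulg1 mul1g -aa => E.
  by apply: (mulIg a).
have [e [eC eM e1 nd ea]] := cyclic_pairing C cardA.
have oa : #[a]%g = 2%N.
  by apply: nt_prime_order => //.
rewrite oa in ea.
have eaa : e a a = -1.
  have := prim_expr_order ea; move/eqP; rewrite -subr_eq0 -[X in _ - X](expr1n _ 2).
  rewrite subr_sqr mulf_eq0 subr_eq0 addr_eq0 => /orP [/eqP h|/eqP //].
  by have := prim_order_dvd ea 1; rewrite expr1 h eqxx.
have e1a : e 1%g a = 1 by apply: e1.
exists e; apply: (dual_pairing_intro (o := o)) => // c cA k k1.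
have [->|->] := AE c cA; first exact: trace_at_1.
have [->|k2] := eqVneq k 2%N.
  have P i : (d i == 2%N) = (i \in [:: V; X; Z]).
    apply/eqP/idP => [di|].
      by have := all_in i; rewrite !inE => /or4P [||| /or4P [|||/orP []]] /eqP E;
       move: di; rewrite E ?do1 ?dx ?dX ?dY ?dZ ?dV ?dl ?dp ?eqxx ?orbT.
    by rewrite !inE => /or3P [] /eqP ->.
  have us : uniq [:: V; X; Z] by rewrite /= !inE negb_or VX VZ XZ.
  rewrite (eq_bigl _ _ P) -big_uniq //= !big_cons big_nil addr0.
  rewrite -EZ aX aZ det_V det_X det_Z eaa e1a eqxx eq_sym (negbTE VZ).
  by rewrite !subr0 subrK subrr.
have [->|k3] := eqVneq k 3%N.
  have P i : (d i == 3%N) = (i \in [:: p; Y]).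
    apply/eqP/idP => [di|].
      by have := all_in i; rewrite !inE => /or4P [||| /or4P [|||/orP []]] /eqP E;
       move: di; rewrite E ?do1 ?dx ?dX ?dY ?dZ ?dV ?dl ?dp ?eqxx ?orbT.
    by rewrite !inE => /orP [] /eqP ->.
  have us : uniq [:: p; Y] by rewrite /= inE pY.
  rewrite (eq_bigl _ _ P) -big_uniq //= !big_cons big_nil addr0.
  rewrite ap aY det_p det_Y eaa e1a eq_sym (negbTE pY).
  by rewrite !subr0 subrr.
have [->|k4] := eqVneq k 4%N.
  have P i : (d i == 4%N) = (i == x).
    apply/eqP/idP => [di|/eqP -> //].
    by have := all_in i; rewrite !inE => /or4P [||| /or4P [|||/orP []]] /eqP E;
       move: di; rewrite E ?do1 ?dx ?dX ?dY ?dZ ?dV ?dl ?dp ?eqxx ?orbT.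
  by rewrite (big_pred1 x) // det_x e1a ax eqxx subrr.
rewrite big_pred0 // => i; apply/eqP => di; move: k1 k2 k3 k4; rewrite -di.
by have := all_in i; rewrite !inE => /or4P [||| /or4P [|||/orP []]] /eqP ->;
   rewrite ?do1 ?dV ?dx ?dX ?dY ?dZ ?dl ?dp.
Qed.

Lemma pairing_trivial : (forall i, d i = 1%N -> i = o) -> has_pairing.
Proof.
move=> lin1; have A1 c : c \in A -> c = 1%g.
  by move=> cA; apply: regA; rewrite ?perm1 //; apply: lin1; rewrite dA.
exists (fun _ _ => 1); apply: (dual_pairing_intro (o := o)) => //.
- by move=> a b aA bA c cA; rewrite mulr1.
- by move=> c /A1 ->; rewrite eqxx.
by move=> c /A1 -> k _; apply: (trace_at_1 (e := fun _ _ => 1)).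
Qed.

(** The diagram closes up with [o] as its only linear node, so [A] is trivial. *)
Lemma pairing_E8 s X Y Z : chain 5 s -> d X = 3%N -> d Y = 4%N -> d Z = 2%N ->
    M Y Z = 1%N ->
    (forall j, (0 < M (s 5%N) j)%N -> j \in [:: s 4%N; X; Y]) ->
    (forall j, (0 < M X j)%N -> j \in [:: s 5%N]) ->
    (forall j, (0 < M Y j)%N -> j \in [:: s 5%N; Z]) ->
  has_pairing.
Proof.
move=> cs dX dY dZ MZ fulx fulX fulY; have [s0 s1 ds Ms] := cs.
have fulZ j : (0 < M Z j)%N -> j \in [:: Y].
  by apply: M_full; rewrite // big_seq1 M_sym MZ dY dZ.
pose L := [:: s 0; s 1; s 2; s 3; s 4; s 5; X; Y; Z]%N.
have all_in i : i \in L.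
  move: i; apply: (@conn (fun i => i \in L)).
    by rewrite inE s0 eqxx.
  have cn k j : (0 < k < 5)%N -> (0 < M (s k) j)%N -> (j == s k.-1) || (j == s k.+1).
    by move=> k5 /(chain_nb cs k5); rewrite !inE.
  move=> i j; rewrite {1}/L !inE => /or4P [||| /or4P [||| /or3P []]] /eqP ->.
  - by rewrite s0 => /nb_o ->; rewrite -s1 eqxx orbT.
  - by case/(@cn 1%N _ isT)/orP => ->; rewrite ?orbT.
  - by case/(@cn 2%N _ isT)/orP => ->; rewrite ?orbT.
  - by case/(@cn 3%N _ isT)/orP => ->; rewrite ?orbT.
  - by case/(@cn 4%N _ isT)/orP => ->; rewrite ?orbT.
  - by move/fulx; rewrite !inE => /or3P [] ->; rewrite ?orbT.
  - by move/fulX; rewrite !inE => ->; rewrite ?orbT.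
  - by move/fulY; rewrite !inE => /orP [] ->; rewrite ?orbT.
  - by move/fulZ; rewrite !inE => ->; rewrite ?orbT.
apply: pairing_trivial => i; have := all_in i.
by rewrite !inE => /or4P [||| /or4P [||| /or3P []]] /eqP ->; rewrite ?s0 ?ds ?dX ?dY ?dZ.
Qed.

Lemma pairing_exceptional m s : (1 < m)%N -> chain m s ->
    (forall j, (0 < M (s m) j)%N -> d j != m.+2) -> has_pairing.
Proof.
move=> m1 cs maxm.
have [X [Y [uXY MX MY [dXY [lX leXY]] fulx]]] := chain_end m1 cs maxm.
have [s0 s1 ds Ms] := cs.
have dx : d (s m) = m.+1 by rewrite ds.
(* The arms are equal in degree, or [2 * d X = m.+1] and [2 * d Y = m.+3]; in the second case [X] is
   a leaf and [Y] has a further neighbour. *)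
have [eqd|eqd] : d X = d Y \/ d Y = (d X).+1 by lia.
  have MX' : M X (s m) = 1%N by rewrite M_sym.
  have dX' : (2 * d X = m.+2)%N by lia.
  have [m2 _] := chain_end_half dx m1 MX' dX'.
  move: cs uXY MX MY dX' fulx; rewrite m2 /= s1 => cs uXY MX MY dX' fulx.
  by apply: (@pairing_E6 s X Y) => //; lia.
have fulX j : (0 < M X j)%N -> j \in [:: s m].
  by apply: M_full; rewrite // big_seq1 M_sym MX dx; lia.
have [Z Zx nbZ] : exists2 j, j \notin [:: s m] & (0 < M Y j)%N.
  by apply: M_more; rewrite // big_seq1 M_sym MY dx; lia.
have := M_room Y (isT : uniq [:: s m]) Zx; rewrite big_seq1 M_sym MY dx => le.
have dZ1 : d Z != 1%N.
  by apply/eqP => dZ; have [a _ [_ _ dY _]] := linear_nb nbZ dZ; lia.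
have [MZ dZ] : M Y Z = 1%N /\ d Z = 2%N by have := d_gt0 Z; move/eqP: dZ1; nia.
have fulY j : (0 < M Y j)%N -> j \in [:: s m; Z].
  apply: M_full; first by rewrite /= inE andbT; move: Zx; rewrite inE eq_sym.
  by rewrite !big_cons big_nil [M Y (s m)]M_sym MY MZ dx dZ; lia.
(* [Y] has to fit among the neighbours of [Z], so [d Y <= 4], which bounds [m] by 5. *)
have := @M_room Z [::] Y isT isT; rewrite big_nil M_sym MZ dZ => leY.
have [m3|m5] : m = 3%N \/ m = 5%N by lia.
  move: cs uXY MX MY dXY eqd fulx fulX fulY; rewrite m3 => *.
  by apply: (@pairing_E7 s X Y Z) => //; lia.
move: cs uXY MX MY dXY eqd fulx fulX fulY; rewrite m5 => *.
by apply: (@pairing_E8 s X Y Z) => //; lia.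
Qed.

(** * Dihedral diagrams *)

Section Dihedral.
Variable p : {perm I}.
Hypotheses (pA : p \in A) (p1 : p != 1%g) (pV : p V = V) (MVp : M V (p o) = 1%N).

(* The end of a dihedral diagram where [o] and [p o] are both attached to
   [V = v 0] *)
Definition before (v : nat -> I) j := if j is i.+1 then [:: v i] else [:: o; p o].

(** The middle of the diagram, in degree 2. The last clause records what the pairing has to match:
    [p] fixes every node, and the determinants alternate between 1 and [p]. *)
Definition dchain k (v : nat -> I) :=
  [/\ v 0%N = V, (forall j, j <= k -> d (v j) = 2)%N,
      (forall i j, i <= k -> j <= k -> v i = v j -> i = j)%N,
      (forall j, j < k -> M (v j) (v j.+1) = 1)%N &
      (forall j, j <= k -> p (v j) = v j /\ det (v j) = (p ^+ j)%g)%N].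

Lemma pp : (p * p = 1)%g.
Proof.
have := det_act pA V; rewrite pV dV det_V mulg1 => /esym.
by rewrite !expgS expg0 mulg1.
Qed.

Lemma pXX n : ((p ^+ n) ^+ 2 = 1)%g.
Proof. by rewrite -expgM mulnC expgM expgS expg1 pp expg1n. Qed.

Lemma po_neq : o != p o.
Proof.
apply: contraNneq p1 => po; apply/eqP; apply: regA; rewrite ?group1 //.
by rewrite perm1.
Qed.

Lemma before_weight k v j : dchain k v -> (j <= k)%N ->
  uniq (before v j) /\ (\sum_(i <- before v j) M (v j) i * d i = 2)%N.
Proof.
case=> v0 dv _ Mv _; case: j => [|j] jk /=.
  rewrite inE po_neq v0 !big_cons big_nil M_sym MoV MVp do1 dA // do1.
  by split.
by split=> //; rewrite big_seq1 M_sym Mv ?dv //; lia.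
Qed.

Lemma before_det k v j : dchain k v -> (j <= k)%N ->
  (\prod_(i <- before v j) det i ^+ M (v j) i = p ^+ j.+1)%g.
Proof.
case=> v0 dv _ Mv pv; case: j => [|j] jk /=.
  rewrite !big_cons big_nil v0 M_sym MoV MVp det_o det_lin //.
  by rewrite expg1n mulg1 mul1g.
rewrite big_seq1 M_sym Mv //; have [_ ->] := pv j (ltnW jk).
by rewrite expg1 !expgS mulgA pp mul1g.
Qed.

Lemma dchain_nb k v j i : dchain k v -> (j < k)%N -> (0 < M (v j) i)%N ->
  i \in v j.+1 :: before v j.
Proof.
move=> dc jk; have [ub wb] := before_weight dc (ltnW jk).
have [v0 dv vinj Mv _] := dc.
apply: M_full; last by rewrite big_cons wb Mv // !dv // ltnW.
rewrite /= ub andbT; case: j jk ub wb => [|j] jk _ _ /=.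
  rewrite !inE; apply/norP; split; apply: contra_eqN (dv 1%N jk) => /eqP ->;
  by rewrite ?dA // do1.
by rewrite inE; apply/eqP => /vinj; lia.
Qed.

Lemma dchain_ext k v i : dchain k v -> i \notin before v k ->
    (0 < M (v k) i)%N -> d i = 2%N ->
  dchain k.+1 (fun j => if j == k.+1 then i else v j).
Proof.
move=> dc ib nb di.
have [ub wb] := before_weight dc (leqnn k).
have [v0 dv vinj Mv pv] := dc.
have Mi : M (v k) i = 1%N.
  by have := M_room (v k) ub ib; rewrite wb di dv //; lia.
have us : uniq (i :: before v k) by rewrite /= ib.
have ful j : (0 < M (v k) j)%N -> j \in i :: before v k.
  by apply: M_full => //; rewrite big_cons wb Mi di dv.
have deti : det i = (p ^+ k.+1)%g.
  have := det_M us ful; rewrite big_cons Mi expg1 (before_det dc) //.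
  have [_ ->] := pv k (leqnn k); rewrite pXX.
  move=> E; apply: (mulIg (p ^+ k.+1)%g); rewrite E.
  by have := pXX k.+1; rewrite expgS expg1.
(* The determinants [p ^+ k.+1] and [p ^+ k] differ, which separates [i] from [v k]. The neighbours
   of an earlier [v j] are already known, and [v k] is among them only in its place. *)
have new j : (j <= k)%N -> i <> v j.
  move=> jk E; have [ejk|jk'] := eqVneq j k.
    have := deti; rewrite E ejk; have [_ ->] := pv k (leqnn k).
    rewrite expgS -{1}[(p ^+ k)%g]mul1g => /mulIg /esym p1'.
    by case/eqP: p1.
  have jltk : (j < k)%N by rewrite ltn_neqAle jk'.
  have := @dchain_nb k v j (v k) dc jltk; rewrite M_sym -E => /(_ nb).
  rewrite inE => /orP [/eqP /vinj e|].
    by move: ib; rewrite (_ : k = j.+1) /= ?E ?inE ?eqxx //; apply: e.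
  case: {E jk'} j jk jltk => [|j] jk jltk /=.
    rewrite !inE => /orP [] /eqP E; move: (dv k (leqnn k)); rewrite E ?dA // do1 //.
  by rewrite inE => /eqP /vinj; lia.
(* [p] fixes [v k], so it permutes its neighbours, and it cannot send [i] into [before v k]. *)
have pi : p i = i.
  have : (0 < M (v k) (p i))%N.
    by have [E _] := pv k (leqnn k); rewrite -{1}E MA.
  move/ful; rewrite inE => /orP [/eqP //|].
  case: k dc ib {nb ub wb Mi us ful deti} v0 dv vinj Mv pv new => [|k] dc ib v0 dv vinj Mv pv new /=.
    by rewrite !inE => /orP [] /eqP E; have := di; rewrite -(dA pA) E ?dA // do1.
  rewrite inE => /eqP E; case: (new k); first by lia.
  by apply: (@perm_inj _ p); rewrite E; have [] := pv k (leqnSn k).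
split=> //=.
- by move=> j jk; case: eqP => // /eqP jk'; rewrite dv //; lia.
- move=> a b ak bk; case: eqP => [->|/eqP ak']; case: eqP => [->|/eqP bk'] //.
  + by move/new; lia.
  + by move/esym/new; lia.
  by apply: vinj; lia.
- move=> j jk; rewrite eqSS (ltn_eqF jk); case: eqP => [->//|/eqP jk'].
  by apply: Mv; lia.
by move=> j jk; case: eqP => [->//|/eqP jk']; apply: pv; lia.
Qed.

Lemma max_dchain : exists k v, dchain k v /\
  forall i, i \notin before v k -> (0 < M (v k) i)%N -> d i = 1%N.
Proof.
have room k v i : dchain k v -> i \notin before v k -> (0 < M (v k) i)%N ->
    d i = 1%N \/ d i = 2%N.
  move=> dc ib nb; have [ub wb] := before_weight dc (leqnn k).
  have [_ dv _ _ _] := dc.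
  have := M_room (v k) ub ib; rewrite wb dv //; have := d_gt0 i; nia.
(* As for the long arm, chains of every length are excluded by the size of [I], here because the
   nodes are distinct. *)
suff step n : (exists k v, dchain k v /\ forall i, i \notin before v k ->
      (0 < M (v k) i)%N -> d i = 1%N) \/ exists v, dchain n v.
  case: (step #|I|) => // [[v [_ _ vinj _ _]]].
  have inj : injective (fun k : 'I_#|I|.+1 => v k).
    by move=> k l /vinj kl; apply: val_inj; apply: kl; rewrite -ltnS.
  by have := leq_card _ inj; rewrite card_ord ltnn.
elim: n => [|n [?|[v dc]]]; last 2 first.
- by left.
- case: (pickP [pred i | [&& i \notin before v n, (0 < M (v n) i)%N & d i == 2%N]]).
    move=> i /and3P [ib nb /eqP di]; right.
    by exists (fun j => if j == n.+1 then i else v j); apply: dchain_ext.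
  move=> none; left; exists n, v; split=> // i ib nb.
  case: (room n v i dc ib nb) => // di.
  by have := none i; rewrite /= ib nb di.
right; exists (fun=> V); split=> //.
  by case=> // -[].
by case=> // _; rewrite pV det_V.
Qed.

(** The hyperbolic pairing on a Klein four-group: exponents [i, j] and [i', j'] of [q, p] give
    [(-1) ^ (i * j' + j * i')]. It suits a chain of nodes with determinants [p ^+ j] that [p] fixes,
    so that [e p p = 1], and [q] reverses, so that [e p q = -1]. *)
Lemma four_group_pairing (q : {perm I}) : q \in A -> (q * q = 1)%g ->
    q != 1%g -> q != p ->
    (forall c, c \in A -> exists i j : bool, c = (q ^+ i * p ^+ j)%g) ->
  exists e : {perm I} -> {perm I} -> C,
  [/\ {in A &, forall a b, e a b = e b a},
      {in A &, forall a b, {in A, forall c, e (a * b)%g c = e a c * e b c}},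
      {in A, forall c, e 1%g c = 1}, e p q = -1 & e p p = 1].
Proof.
move=> qA qq q1 qp gen.
have pq : (p * q = q * p)%g by apply: (centsP abA).
pose g (i j : bool) := (q ^+ i * p ^+ j)%g.
(* [u] and [w] read off the exponents of [p] and of [q]. *)
pose u a := (a == p) || (a == q * p)%g.
pose w a := (a == q) || (a == q * p)%g.
have qpq : (q * p == q)%g = false.
  by rewrite -{2}[q]mulg1 (inj_eq (mulgI q)) (negbTE p1).
have qpp : (q * p == p)%g = false.
  by rewrite -{2}[p]mul1g (inj_eq (mulIg p)) (negbTE q1).
have qp1 : (1 == q * p)%g = false.
  by rewrite -pp (inj_eq (mulIg p)) eq_sym (negbTE qp).
have uE i j : u (g i j) = j.
  rewrite /u /g; case: i; case: j; rewrite /= ?expg1 ?expg0 ?mulg1 ?mul1g ?eqxx ?orbT //.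
    by rewrite (negbTE qp) [q == _]eq_sym qpq.
  by rewrite eq_sym (negbTE p1) qp1.
have wE i j : w (g i j) = i.
  rewrite /w /g; case: i; case: j; rewrite /= ?expg1 ?expg0 ?mulg1 ?mul1g ?eqxx ?orbT //.
    by rewrite eq_sym (negbTE qp) [p == _]eq_sym qpp.
  by rewrite eq_sym (negbTE q1) qp1.
have gM i j i' j' : (g i j * g i' j' = g (i (+) i') (j (+) j'))%g.
  have comm a b : commute (q ^+ a)%g (p ^+ b)%g.
    by apply: commuteX; apply: commute_sym; apply: commuteX.
  have sq (x : {perm I}) : (x * x = 1)%g -> forall a b : bool, (x ^+ a * x ^+ b = x ^+ (a (+) b))%g.
    by move=> xx [] [] /=; rewrite !(expg1, xx, expg0, mulg1, mul1g).
  rewrite /g -!mulgA (mulgA (p ^+ j)%g) -(comm i' j) -!mulgA (sq _ pp).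
  by rewrite !mulgA (sq _ qq).
pose e a b : C := (-1) ^+ (u a && w b) * (-1) ^+ (w a && u b).
exists e; split.
- by move=> a b _ _; rewrite /e mulrC [u a && _]andbC [w a && _]andbC.
- move=> a b /gen [i [j ->]] /gen [i' [j' ->]] c /gen [i'' [j'' ->]].
  rewrite -/(g i j) -/(g i' j') -/(g i'' j'') gM /e !uE !wE.
  by case: i; case: j; case: i'; case: j'; case: i''; case: j'' => /=;
    rewrite !(expr1, expr0, mulr1, mul1r, mulrN1, opprK).
- move=> c /gen [i [j ->]]; have -> : 1%g = g false false by rewrite /g !expg0 mulg1.
  by rewrite -/(g i j) /e !uE !wE !andFb mulr1.
- have -> : p = g false true by rewrite /g expg0 expg1 mul1g.
  have -> : q = g true false by rewrite /g expg0 expg1 mulg1.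
  by rewrite /e !uE !wE expr1 expr0 mulr1.
have -> : p = g false true by rewrite /g expg0 expg1 mul1g.
by rewrite /e !uE !wE expr0 mulr1.
Qed.

(** The trace identity for the reversal of a chain of [k.+1] nodes: for even [k] the signs sum to 1
    and the middle node is fixed, for odd [k] both counts are 0. *)
Lemma alternating_sum k :
  \sum_(j < k.+1) ((-1) ^+ j - (2 * j == k)%N%:R) = 0 :> C.
Proof.
rewrite sumrB.
have -> : \sum_(j < k.+1) (-1) ^+ j = (~~ odd k)%:R :> C.
  elim: k => [|k IH]; first by rewrite big_ord1.
  by rewrite big_ord_recr IH /= -signr_odd /=; case: (odd k); rewrite ?expr1 ?subrr // expr0 add0r.
suff -> : \sum_(j < k.+1) (2 * j == k)%N%:R = (~~ odd k)%:R :> C by rewrite subrr.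
have [ok|ek] := boolP (odd k).
  by rewrite big1 // => j _; case: eqP => // jk; move: ok; rewrite -jk oddM.
have hk : (2 * k./2 = k)%N by have := odd_double_half k; rewrite (negbTE ek) -mul2n.
have lt : (k./2 < k.+1)%N by lia.
rewrite (bigD1 (Ordinal lt)) //= hk eqxx big1 ?addr0 // => j ne.
case: eqP => // jk; case/eqP: ne; apply: val_inj => /=; lia.
Qed.

Lemma pairing_dihedral : has_pairing.
Proof.
have [k [v [dc maxv]]] := max_dchain.
have [v0 dv vinj Mv pv] := dc.
have [ub wb] := before_weight dc (leqnn k).
have [j jb nbj] : exists2 j, j \notin before v k & (0 < M (v k) j)%N.
  by apply: M_more; rewrite // wb dv.
(* The chain ends at the twist [q V]; its linear neighbours turn out to be [q o] and [(q * p) o]. *)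
have [q qA [Ej EV _ Mvj]] := linear_nb nbj (maxv j jb nbj).
have dj : d j = 1%N by apply: maxv.
have q1 : q != 1%g.
  apply: contraNneq jb => E; move: EV; rewrite E perm1 -v0 => /vinj k0.
  by rewrite k0 // Ej E perm1 inE eqxx.
have qp : q != p.
  apply: contraNneq jb => E; move: EV; rewrite E pV -v0 => /vinj k0.
  by rewrite k0 // Ej E !inE eqxx orbT.
have pq : (p * q = q * p)%g by apply: (centsP abA).
pose l := (q * p)%g o.
have lA : (q * p)%g \in A by rewrite groupM.
have dl : d l = 1%N by rewrite /l dA.
have Mvl : M (v k) l = 1%N.
  by have [E _] := pv k (leqnn k); rewrite /l permM -{1}E MA // -Ej.
have uA x : x \in A -> x o = o -> x = 1%g.
  by move=> xA E; apply: regA; rewrite ?group1 ?perm1.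
have lj : l != j.
  rewrite /l Ej; apply/eqP => /(regA lA qA) /eqP.
  by rewrite -{2}[q]mulg1 (inj_eq (mulgI q)) (negbTE p1).
have lb : l \notin before v k.
  case: k {dc maxv ub wb jb nbj EV Mvj Mvl vinj Mv pv} dv => [|k] dv /=; last first.
    by rewrite inE; apply: contra_eqN dl => /eqP ->; rewrite dv.
  rewrite !inE negb_or /l; apply/andP; split; apply/eqP.
    move=> /(uA _ lA) /eqP; rewrite -pp (inj_eq (mulIg p)) (negbTE qp) //.
  by move=> /(regA lA pA) /eqP; rewrite -{2}[p]mul1g (inj_eq (mulIg p)) (negbTE q1).
have us : uniq [:: j, l & before v k] by rewrite /= inE negb_or eq_sym lj jb lb.
have fulk i : (0 < M (v k) i)%N -> i \in [:: j, l & before v k].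
  by apply: M_full; rewrite // !big_cons wb Mvj Mvl dj dl dv.
(* The determinants around [v k] give this relation, which makes [A] cyclic of order 4 for odd [k]
   and a Klein four-group for even [k]. *)
have qq : (q * q = p ^+ k)%g.
  have := det_M us fulk; rewrite !big_cons Mvj Mvl !expg1 (before_det dc) //.
  rewrite /l Ej !det_lin // ; have [_ ->] := pv k (leqnn k); rewrite (pXX k).
  rewrite expgS -!mulgA (mulgA p p) pp mul1g mulgA => E.
  by apply: (mulIg (p ^+ k)%g); rewrite E; have := pXX k; rewrite expgS expg1.
have all_in i : i \in [:: o; p o; q o; (q * p)%g o] \/ exists2 a, (a <= k)%N & i = v a.
  suff : (i \in [:: o; p o; q o; (q * p)%g o]) || [exists a : 'I_k.+1, i == v a].
    by case/orP => [|/existsP [a /eqP ->]]; [left | right; exists a; rewrite // -ltnS].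
  pose S i := (i \in [:: o; p o; q o; (q * p)%g o]) || [exists a : 'I_k.+1, i == v a].
  have Sv a : (a <= k)%N -> S (v a).
    move=> ak; apply/orP; right; apply/existsP.
    by exists (Ordinal (ak : (a < k.+1)%N)); rewrite /=.
  have Sb a x : (a <= k)%N -> x \in before v a -> S x.
    case: a => [|a] ak /=.
      by rewrite !inE => /orP [] /eqP ->; rewrite /S !inE eqxx ?orbT.
    by rewrite inE => /eqP ->; apply: Sv; apply: ltnW.
  move: i; apply: (@conn S) => [|i i']; first by rewrite /S !inE eqxx.
  case/orP => [|/existsP [[a ak] /= /eqP ->]].
    have SV : S V by rewrite -v0 Sv.
    have Sq : S (v k) by apply: Sv.
    rewrite !inE => /or4P [] /eqP ->.
    - by move/nb_o ->.
    - by move/(nb_lin pA) ->; rewrite pV.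
    - by move/(nb_lin qA) ->; rewrite -EV.
    - by move/(nb_lin lA) ->; rewrite permM -EV; have [->] := pv k (leqnn k).
  have [eak|nak] := eqVneq a k.
    rewrite eak => /fulk; rewrite !in_cons => /or3P [/eqP ->|/eqP ->|].
    - by rewrite /S Ej !inE eqxx ?orbT.
    - by rewrite /S /l !inE eqxx ?orbT.
    by apply: Sb.
  have ltak : (a < k)%N by rewrite ltn_neqAle nak.
  move/(dchain_nb dc ltak); rewrite in_cons => /orP [/eqP ->|]; first exact: Sv.
  by apply: Sb.
have AE c : c \in A -> [\/ c = 1%g, c = p, c = q | c = (q * p)%g].
  move=> cA; have dc' : d (c o) = 1%N by rewrite dA.
  case: (all_in (c o)) => [|[a ak E]]; last by move: dc'; rewrite E dv.
  rewrite !inE => /or4P [] /eqP E.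
  - by constructor 1; apply: uA.
  - by constructor 2; apply: regA.
  - by constructor 3; apply: regA.
  - by constructor 4; apply: regA.
have dlin i : i \in [:: o; p o; q o; (q * p)%g o] -> d i = 1%N.
  by rewrite !inE => /or4P [] /eqP ->; rewrite ?dA.
(* [q] sends the start of the chain to its end, hence reverses it. The induction carries two
   consecutive nodes, because the next one is the other neighbour. *)
have qv a : (a <= k)%N -> q (v a) = v (k - a)%N.
  suff H : forall a, ((a <= k)%N -> q (v a) = v (k - a)%N) /\
       ((a.+1 <= k)%N -> q (v a.+1) = v (k - a.+1)%N) by case: (H a).
  elim=> [|b [IH1 IH2]].
    split=> [_|k1]; first by rewrite subn0 v0 -EV.
    have : (0 < M (v k) (q (v 1%N)))%N by rewrite EV -v0 MA // Mv.
    case: (all_in (q (v 1%N))) => [/dlin|[a' _ _]]; first by rewrite dA // dv.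
    move/fulk; rewrite !in_cons => /or3P [/eqP E'|/eqP E'|].
    - by move: dj; rewrite -E' dA // dv.
    - by move: dl; rewrite -E' dA // dv.
    by case: (k) k1 => // k' _ /=; rewrite inE subSS subn0 => /eqP.
  split=> // b2; have := IH2 (ltnW b2); have := IH1 (ltnW (ltnW b2)) => qb qb1.
  have : (0 < M (v (k - b.+1)%N) (q (v b.+2)))%N by rewrite -qb1 MA // Mv.
  have lt : (k - b.+1 < k)%N by rewrite subnSK ?leq_subr // ltnW.
  move/(dchain_nb dc lt); rewrite subnSK; last exact: ltnW.
  rewrite in_cons => /orP [/eqP|].
    rewrite -qb => /perm_inj /vinj E.
    by have /eqP := E b2 (ltnW (ltnW b2)); rewrite -addn2 -{2}[b]addn0 eqn_add2l.
  rewrite -(subnSK b2).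
  by rewrite inE => /eqP.
(* In degree 2 the determinants are powers of [p], so the trace identity depends only on the values
   at [p]. *)
suff [e [eC eM e1 nd [epq epp]]] : exists e : {perm I} -> {perm I} -> C,
  [/\ {in A &, forall a b, e a b = e b a},
      {in A &, forall a b, {in A, forall c, e (a * b)%g c = e a c * e b c}},
      {in A, forall c, e 1%g c = 1},
      {in A, forall c, c != 1%g -> exists2 a, a \in A & e a c != 1} &
      e p q = -1 /\ e p p = 1].
  have eX a c n : a \in A -> c \in A -> e (a ^+ n)%g c = e a c ^+ n.
    move=> aA cA; elim: n => [|n IH]; first by rewrite expg0 expr0 e1.
    by rewrite expgS exprS eM ?groupX // IH.
  exists e; apply: (dual_pairing_intro (o := o)) => // c cA n n1.
  have [->|n2] := eqVneq n 2%N; last first.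
    rewrite big_pred0 // => i; apply/eqP => di; move: n1 n2; rewrite -di.
    by case: (all_in i) => [/dlin ->|[a ak ->]]; rewrite ?dv.
  have P i : (d i == 2%N) = (i \in [set v (val a) | a in 'I_k.+1]).
    apply/eqP/imsetP => [di|[a _ ->]]; last by rewrite dv // leq_ord.
    case: (all_in i) => [/dlin|[a ak ->]]; first by rewrite di.
    by exists (Ordinal (ak : (a < k.+1)%N)).
  rewrite (eq_bigl _ _ P) big_imset /=; last first.
    by move=> a b _ _ /vinj ab; apply: val_inj; apply: ab; rewrite leq_ord.
  have flip : e p c = -1 -> (forall a, (a <= k)%N -> c (v a) = v (k - a)%N) ->
      \sum_(i < k.+1) (e (det (v i)) c - (c (v i) == v i)%:R) = 0.
    move=> epc cv; rewrite -[RHS](alternating_sum k); apply: eq_bigr => x _.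
    move: (nat_of_ord x) (leq_ord x) => {}x xk.
    have [_ ->] := pv x xk; rewrite eX // epc; congr (_ - _).
    rewrite cv //; suff -> : (v (k - x)%N == v x) = (2 * x == k)%N by [].
    have -> : (2 * x == k)%N = (k - x == x)%N.
      by rewrite mul2n -addnn -{1}(subnK xk) eq_sym eqn_add2r.
    by apply/eqP/eqP => [/vinj E|-> //]; apply: E; rewrite ?leq_subr.
  transitivity (\sum_(i < k.+1) (e (det (v i)) c - (c (v i) == v i)%:R)).
    exact: eq_bigl.
  case: (AE c cA) => E.
  - by rewrite big1 // => a _; rewrite E perm1 eqxx eC ?group1 // e1 // subrr.
  - rewrite big1 // => a _; have [pa ->] := pv a (leq_ord a).
    by rewrite E pa eX // epp expr1n eqxx subrr.
  - by apply: flip; rewrite E.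
  - apply: flip; first by rewrite E eC // eM // [e q p]eC // epq epp mulr1.
    by move=> a ak; rewrite E permM qv //; have [|->] := pv (k - a)%N; rewrite // leq_subr.
have neg1 : (-1 == 1 :> C) = false.
  by rewrite eq_sym -subr_eq0 opprK -(natrD _ 1 1) pnatr_eq0.
have [kodd|keven] := boolP (odd k).
  (* Here [q] generates [A], and [p = q ^+ 2] being an involution makes [e p q] a nontrivial square
     root of 1. *)
  have q2 : (q * q = p)%g.
    by rewrite qq -(odd_double_half k) kodd -mul2n add1n expgS mulnC expgM pXX mulg1.
  have Aq : A :=: <[q]>%g.
    apply/eqP; rewrite eqEsubset cycle_subG qA andbT; apply/subsetP => c.
    by case/AE => ->; rewrite ?group1 -?q2 ?groupM ?cycle_id.
  have [e [eC eM e1 nd eq]] := cyclic_pairing C Aq.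
  have eXq n : e (q ^+ n)%g q = e q q ^+ n.
    elim: n => [|n IH]; first by rewrite expg0 expr0 e1.
    by rewrite expgS exprS eM ?groupX // IH.
  have epq : e p q = -1.
    have p2 : p = (q ^+ 2)%g by rewrite -q2 expgS expg1.
    have : e p q != 1.
      by rewrite p2 eXq -(prim_order_dvd eq) order_dvdn -p2.
    have : e p q ^+ 2 == 1.
      by rewrite p2 eXq -exprM -(prim_order_dvd eq) order_dvdn expgM -p2 expgS expg1 pp.
    by rewrite sqrf_eq1 => /orP [->//|/eqP].
  exists e; split=> //; split=> //.
  by rewrite -{2}q2 eC ?groupM // eM // [e q p]eC // epq mulrNN mulr1.
have q2 : (q * q = 1)%g.
  by rewrite qq -(odd_double_half k) (negbTE keven) add0n -mul2n mulnC expgM pXX.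
have gen c : c \in A -> exists i j : bool, c = (q ^+ i * p ^+ j)%g.
  case/AE => ->; [exists false, false | exists false, true | exists true, false
    | exists true, true]; by rewrite ?expg0 ?expg1 ?mulg1 ?mul1g.
have [e [eC eM e1 epq epp]] := four_group_pairing qA q2 q1 qp gen.
exists e; split=> // c /AE [] ->; rewrite ?eqxx //.
- by exists q => //; rewrite eC // epq neg1.
- by exists p => //; rewrite epq neg1.
by exists p => //; rewrite eC // eM // [e q p]eC // epq epp mulr1 neg1.
Qed.

End Dihedral.

Lemma pairing_irreducible : has_pairing.
Proof.
have [m [s [m0 cs maxm]]] := max_chain.
have [m1|m1] := ltnP 1 m; first exact: pairing_exceptional cs maxm.
have no3 j : (0 < M V j)%N -> d j != 3%N.
  have E : m = 1%N by lia.
  by move: cs maxm; rewrite E => -[_ s1 _ _] h; rewrite -s1; apply: h.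
have MVo : M V o = 1%N by rewrite M_sym.
(* Besides [o], the neighbours of [V] have total degree 3 and none has degree 3, so one of them is
   linear. *)
suff [j [jo nbj dj]] : exists j, [/\ j != o, (0 < M V j)%N & d j = 1%N].
  have [p pA [Ej EV _ Mj]] := linear_nb nbj dj.
  apply: (@pairing_dihedral p) => //; last by rewrite -Ej.
  by apply: contraNneq jo => p1; rewrite Ej p1 perm1.
have [j jo nbj] : exists2 j, j \notin [:: o] & (0 < M V j)%N.
  by apply: M_more; rewrite // big_seq1 MVo do1 dV.
have := M_room V (isT : uniq [:: o]) jo; rewrite big_seq1 MVo do1 dV => le.
rewrite inE in jo.
have [dj|dj1] := eqVneq (d j) 1%N; first by exists j.
have [Mj dj] : M V j = 1%N /\ d j = 2%N.
  move: le nbj dj1 (no3 j nbj) (d_gt0 j).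
  by case: (M V j) => [|[|[|[|x]]]]; case: (d j) => [|[|[|[|y]]]] //; lia.
have us : uniq [:: o; j] by rewrite /= inE eq_sym jo.
have [l ls nbl] : exists2 l, l \notin [:: o; j] & (0 < M V l)%N.
  by apply: M_more; rewrite // !big_cons big_nil MVo Mj do1 dj dV.
have := M_room V us ls; rewrite !big_cons big_nil MVo Mj do1 dj dV => le2.
exists l; split=> //; first by move: ls; rewrite !inE negb_or => /andP [].
by move: le2 nbl (d_gt0 l); case: (M V l) => // x; case: (d l) => [|[|y]] //; lia.
Qed.

End Irreducible.

Theorem mckay_pairing : has_pairing.
Proof.
case: (pickP [pred j | (0 < M o j)%N && (d j != 1%N)]) => [V|lin]; last first.
  apply: pairing_cyclic => j nb; apply/eqP.
  by have := lin j; rewrite /= nb /= => /negbFE.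
case/andP=> nb /eqP dV1.
have := @M_room o [::] V isT isT; rewrite big_nil do1 => le.
have [MV dV] : M o V = 1%N /\ d V = 2%N by move: le nb dV1 (d_gt0 V); case: (M o V) => [|[|[|x]]]; case: (d V) => [|[|[|y]]] //; lia.
exact: (@pairing_irreducible V).
Qed.

End McKay.

(** * Irreducible characters and their twists *)

Section Representations.
Variables (C : numClosedFieldType) (gT : finGroupType).
Notation G := [set: gT]%G.
Notation reprG := (mx_representation C G).
Notation iG := (DecSocleType (regular_repr C G) : irrType C G).
Implicit Types (r : representation C G) (i j : iG) (s : seq iG).

Lemma pchar'G : ([pchar C]^'.-group G)%g.
Proof. by apply/pgroupP => p _; rewrite inE /= pchar_num. Qed.

Definition irr_of i : representation C G := Representation (irr_repr i).
Definition dsum s : representation C G :=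
  foldr (fun i r => dadd_grepr (irr_of i) r) grepr0 s.

Lemma dsum_cons i s : dsum (i :: s) = dadd_grepr (irr_of i) (dsum s).
Proof. by []. Qed.

Lemma dadd_rsim r1 r2 r1' r2' : mx_rsim r1 r1' -> mx_rsim r2 r2' ->
  mx_rsim (dadd_grepr r1 r2) (dadd_grepr r1' r2').
Proof.
move=> [B1 d1 f1 h1] [B2 d2 f2 h2].
exists (block_mx B1 0 0 B2) => [||x Gx] /=.
- by rewrite d1 d2.
- have [B1' B1K] := row_freeP f1; have [B2' B2K] := row_freeP f2.
  apply/row_freeP; exists (block_mx B1' 0 0 B2').
  rewrite mulmx_block !(mulmx0, mul0mx, addr0, add0r) B1K B2K.
  by rewrite -scalar_mx_block.
by rewrite !mulmx_block !(mulmx0, mul0mx, addr0, add0r) h1 // h2.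
Qed.

Lemma dadd_swap r1 r2 r3 :
  mx_rsim (dadd_grepr r1 (dadd_grepr r2 r3)) (dadd_grepr r2 (dadd_grepr r1 r3)).
Proof.
case: r1 r2 r3 => [n1 r1] [n2 r2] [n3 r3] /=.
pose T n1 n2 : 'M[C]_(n1 + (n2 + n3), n2 + (n1 + n3)) :=
  col_mx (row_mx 0 (row_mx 1%:M 0))
         (col_mx (row_mx 1%:M 0) (row_mx 0 (row_mx 0 1%:M))).
exists (T n1 n2) => [||x Gx].
- by rewrite /= addnCA.
- apply/row_freeP; exists (T n2 n1); rewrite /T.
  rewrite !(mul_col_mx, mul_row_col, mul_mx_row, mulmx0, mul0mx, mul1mx).
  rewrite !(row_mx0, addr0, add0r) !scalar_mx_block {1}/block_mx.
  by rewrite -[X in row_mx X (block_mx _ _ _ _)]col_mx0 -block_mxEh block_mxEv.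
rewrite /T /= !mul_block_col !(mul_col_mx, mul_row_block, mul_mx_row).
rewrite !(mulmx0, mul0mx, mul1mx, mulmx1, addr0, add0r, row_mx0).
by [].
Qed.

Lemma rsim_degree0 (n : nat) (rG : reprG n) : n = 0%N -> mx_rsim rG (grepr0 : representation C G).
Proof.
move=> n0; rewrite n0 in rG *; exists 1%:M => //.
  by rewrite row_free_unit unitmx1.
by move=> x _; rewrite mulmx1 mul1mx [LHS]flatmx0 [RHS]flatmx0.
Qed.

(** Complete reducibility: split off a simple submodule and recurse on a Maschke complement. *)
Lemma rsim_dsum n (rG : reprG n) : exists s, mx_rsim rG (dsum s).
Proof.
elim/ltn_ind: n rG => n IH rG.
have [n0|n0] := posnP n; first by exists [::]; apply: rsim_degree0.
have nz1 : (1%:M : 'M[C]_n) != 0 by rewrite -mxrank_eq0 mxrank1 -lt0n.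
have [U simU _] := dec_mxsimple_exists (mxmodule1 rG) nz1.
have modU := mxsimple_module simU.
have [W modW UW dxUW] := mx_Maschke_pchar rG pchar'G modU (submx1 U).
have irrU : mx_irreducible (submod_repr modU) by apply/submod_mx_irr.
have rankW : (\rank W < n)%N.
  have := mxdirectP dxUW; rewrite /= UW mxrank1 => nE.
  have [_ nzU _] := simU; move: nzU; rewrite -mxrank_eq0 -lt0n => rU.
  by rewrite [X in (_ < X)%N]nE -[X in (X < _)%N]add0n ltn_add2r.
have [s sW] := IH _ rankW (submod_repr modW).
exists (irr_comp iG (submod_repr modU) :: s).
apply: mx_rsim_trans (mx_rsim_sym (rsim_submod1 (mxmodule1 rG) (eqmx_refl _))) _.
apply: (mx_rsim_dadd (mxmodule1 rG) UW dxUW _ sW).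
exact: (rsim_irr_comp_pchar iG pchar'G irrU).
Qed.

Lemma perm_dsum s s' : perm_eq s s' -> mx_rsim (dsum s) (dsum s').
Proof.
elim: s s' => [|i s IH] s' /=.
  by rewrite perm_sym => /perm_nilP ->; apply: mx_rsim_refl.
move=> pss; have is' : i \in s' by rewrite -(perm_mem pss) mem_head.
have toFront t : i \in t -> mx_rsim (dsum (i :: rem i t)) (dsum t).
  elim: t => //= j t IHt; rewrite inE eq_sym.
  have [->|ij] /= := eqVneq j i; first by move=> _; apply: mx_rsim_refl.
  move=> it; have := dadd_swap (irr_of i) (irr_of j) (dsum (rem i t)).
  move/mx_rsim_trans; apply.
  exact: (@dadd_rsim (irr_of j) (dsum (i :: rem i t)) (irr_of j) (dsum t)
    (mx_rsim_refl _) (IHt it)).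
have pr : perm_eq s (rem i s').
  by rewrite -(perm_cons i) (perm_trans pss) // perm_to_rem.
have := @dadd_rsim (irr_of i) (dsum s) (irr_of i) (dsum (rem i s'))
  (mx_rsim_refl _) (IH _ pr).
by move/mx_rsim_trans; apply; exact: toFront.
Qed.

Definition psi i g : C := \tr (irr_repr i g).

Lemma trace_dsum s g : \tr (dsum s g) = \sum_(i <- s) psi i g.
Proof.
elim: s => [|i s IH]; first by rewrite big_nil /= mxtrace1.
by rewrite big_cons -IH dsum_cons /= mxtrace_block.
Qed.

Lemma det_dsum s g : \det (dsum s g) = \prod_(i <- s) \det (irr_repr i g).
Proof.
elim: s => [|i s IH]; first by rewrite big_nil /= det1.
by rewrite big_cons -IH dsum_cons /= det_ublock.
Qed.

Lemma det_rsim n1 n2 (r1 : reprG n1) (r2 : reprG n2) g :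
  mx_rsim r1 r2 -> \det (r1 g) = \det (r2 g).
Proof.
case=> B; move: r1 B => + + E; rewrite E => r1 B fB h.
have uB : B \in unitmx by rewrite -row_free_unit.
have := h g (in_setT g) => /(congr1 determinant); rewrite !det_mulmx mulrC.
by apply: mulfI; rewrite -unitfE -unitmxE.
Qed.

Lemma degree_dsum s : rdegree (dsum s) = (\sum_(i <- s) irr_degree i)%N.
Proof.
by elim: s => [|i s IH]; rewrite ?big_nil // big_cons -IH.
Qed.

Lemma cardG_neq0 : #|gT|%:R != 0 :> C.
Proof. by rewrite pnatr_eq0 -lt0n; apply/card_gt0P; exists 1%g. Qed.

Lemma repr_sum_hom n1 n2 (r1 : reprG n1) (r2 : reprG n2) (X : 'M_(n1, n2)) h :
  let T := \sum_g r1 g *m X *m r2 (g^-1)%g in r1 h *m T = T *m r2 h.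
Proof.
move=> T; rewrite /T mulmx_suml mulmx_sumr [RHS](reindex_inj (mulgI h)) /=.
apply: eq_bigr => g _; rewrite !mulmxA -repr_mxM ?in_setT //.
by rewrite -[RHS]mulmxA -repr_mxM ?in_setT // invMg mulgKV.
Qed.

Lemma irr_hom_eq0 i j (T : 'M_(irr_degree i, irr_degree j)) :
  (forall g, irr_repr i g *m T = T *m irr_repr j g) -> i != j -> T = 0.
Proof.
move=> hT; apply: contra_neq_eq => T0.
have /mx_irrP [di irri] := socle_irr i.
have /mx_irrP [dj irrj] := socle_irr j.
have kerT : kermx T = 0.
  apply/eqP; apply/negPn/negP => nz.
  have modk : mxmodule (irr_repr i) (kermx T).
    apply/mxmoduleP => g _; apply/sub_kermxP.
    by rewrite -mulmxA hT mulmxA mulmx_ker mul0mx.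
  have := irri _ modk nz; rewrite -sub1mx => /sub_kermxP; rewrite mul1mx => T0'.
  by rewrite T0' eqxx in T0.
have fT : row_free T by rewrite -kermx_eq0 kerT.
have imT : row_full <<T>>%MS.
  apply: irrj; last by rewrite -mxrank_eq0 genmxE mxrank_eq0.
  rewrite (eqmx_module _ (genmxE _)); apply/mxmoduleP => g _.
  by rewrite -hT submxMl.
have dij : irr_degree i = irr_degree j.
  have /eqP rT := fT; have := imT; rewrite /row_full genmxE => /eqP.
  exact: etrans (esym rT).
apply/eqP/socle_rsimP; exists T => // g _; exact: hT.
Qed.

Lemma irr_cent_scalar i (T : 'M_(irr_degree i)) :
  (forall g, irr_repr i g *m T = T *m irr_repr i g) -> is_scalar_mx T.
Proof.
move=> hT.
have absi := group_closure_closed_field (socle_irr i).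
by apply: (mx_abs_irr_cent_scalar absi); apply/centgmxP => g _; rewrite hT.
Qed.

Let hom_delta i j a b := \sum_g irr_repr i g *m delta_mx a b *m irr_repr j (g^-1)%g.

Let sum_psi_delta i j :
  \sum_g psi i g * psi j (g^-1)%g = \sum_a \sum_b @hom_delta i j a b a b.
Proof.
have entry n1 n2 (A : 'M[C]_n1) (B : 'M[C]_n2) a b :
    (A *m delta_mx a b *m B) a b = A a a * B b b.
  rewrite mxE (bigD1 b) //= big1 => [|k kb]; last first.
    rewrite mxE big1 ?mul0r // => l _; rewrite mxE (negbTE kb) andbF mulr0 //.
  rewrite addr0 mxE (bigD1 a) //= big1 => [|k ka]; last first.
    by rewrite mxE (negbTE ka) mulr0.
  by rewrite mxE !eqxx mulr1 addr0.
under eq_bigr => g _ do rewrite /psi /mxtrace mulr_suml.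
rewrite exchange_big; apply: eq_bigr => a _ /=.
under eq_bigr => g _ do rewrite mulr_sumr.
rewrite exchange_big; apply: eq_bigr => b _ /=.
by rewrite /hom_delta summxE; apply: eq_bigr => g _; rewrite entry.
Qed.

Lemma psi_orth i j :
  \sum_g psi i g * psi j (g^-1)%g = #|gT|%:R * (i == j)%:R.
Proof.
rewrite sum_psi_delta.
have [<-|ij] := eqVneq i j; last first.
  rewrite mulr0 big1 // => a _; rewrite big1 // => b _.
  rewrite (_ : hom_delta a b = 0) ?mxE //; apply: irr_hom_eq0 ij => g.
  exact: repr_sum_hom.
rewrite mulr1; pose T a b := @hom_delta i i a b.
have hT a b g : irr_repr i g *m T a b = T a b *m irr_repr i g.
  exact: repr_sum_hom.
have d0 : (irr_degree i)%:R != 0 :> C by rewrite pnatr_eq0 -lt0n irr_degree_gt0.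
(* By Schur's lemma the average [T a b] of an elementary matrix is scalar, and its trace determines
   it. *)
have Tab a b : T a b a b = #|gT|%:R / (irr_degree i)%:R * (a == b)%:R.
  have /is_scalar_mxP [c Tc] := irr_cent_scalar (hT a b).
  have : \tr (T a b) = #|gT|%:R * (a == b)%:R.
    rewrite /T /hom_delta raddf_sum /= (eq_bigr (fun=> (a == b)%:R)).
      by rewrite sumr_const mulr_natl.
    move=> g _; rewrite mxtrace_mulC mulmxA -repr_mxM ?in_setT // mulVg repr_mx1 mul1mx.
    rewrite /mxtrace (bigD1 a) //= big1 ?addr0 ?mxE ?eqxx // => k ka.
    by rewrite mxE (negbTE ka).
  rewrite Tc mxtrace_scalar mxE => E.
  have -> : c = #|gT|%:R / (irr_degree i)%:R * (a == b)%:R.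
    by apply: (mulIf d0); rewrite -[c *+ _]mulr_natr in E; rewrite E mulrAC mulfVK.
  by case: (a == b); rewrite ?mulr1n // mulr0n mulr0.
under eq_bigr => a _ do under eq_bigr => b _ do rewrite -/(T a b) Tab.
under eq_bigr => a _.
  rewrite -mulr_sumr (bigD1 a) //= eqxx big1 => [|b ba]; last first.
    by rewrite eq_sym (negbTE ba).
  rewrite addr0 mulr1; over.
by rewrite sumr_const card_ord -[LHS]mulr_natr mulfVK.
Qed.

Lemma sum_dsum_psi s j :
  \sum_g \tr (dsum s g) * psi j (g^-1)%g = #|gT|%:R * (count_mem j s)%:R.
Proof.
elim: s => [|i s IH].
  by rewrite mulr0 big1 // => g _; rewrite trace_dsum big_nil mul0r.
under eq_bigr => g _ do rewrite trace_dsum big_cons -trace_dsum mulrDl.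
by rewrite big_split /= IH psi_orth -mulrDr -natrD.
Qed.

Lemma trace_perm_eq s s' : (forall g, \tr (dsum s g) = \tr (dsum s' g)) ->
  perm_eq s s'.
Proof.
move=> E; rewrite /perm_eq; apply/allP => j _ /=.
rewrite -(eqr_nat C) -(inj_eq (mulfI cardG_neq0)) -!sum_dsum_psi.
by apply/eqP; apply: eq_bigr => g _; rewrite E.
Qed.

Lemma rsim_trace n1 n2 (r1 : reprG n1) (r2 : reprG n2) :
  (forall g, \tr (r1 g) = \tr (r2 g)) -> mx_rsim r1 r2.
Proof.
move=> E; have [s1 h1] := rsim_dsum r1; have [s2 h2] := rsim_dsum r2.
suff h : mx_rsim (dsum s1) (dsum s2).
  by apply: mx_rsim_trans h1 (mx_rsim_trans h (mx_rsim_sym h2)).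
apply/perm_dsum/trace_perm_eq => g.
by rewrite -(mxtrace_rsim h1) -?(mxtrace_rsim h2) ?in_setT.
Qed.

Lemma psi_inj i j : psi i =1 psi j -> i = j.
Proof.
move=> E; apply/eqP; have := psi_orth i j; rewrite (eq_bigr _ (fun g _ => congr1 (fun x => x * _) (E g))).
rewrite psi_orth eqxx => /(mulfI cardG_neq0) /eqP.
by rewrite eqr_nat; case: (i == j).
Qed.

Lemma psi1 i : psi i 1%g = (irr_degree i)%:R.
Proof. by rewrite /psi repr_mx1 mxtrace1. Qed.

Lemma norm1_irr n (rG : reprG n) :
  \sum_g \tr (rG g) * \tr (rG (g^-1)%g) = #|gT|%:R ->
  exists i, forall g, \tr (rG g) = psi i g.
Proof.
move=> nrm; have [s hs] := rsim_dsum rG.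
have trE g : \tr (rG g) = \tr (dsum s g) by rewrite (mxtrace_rsim hs) ?in_setT.
suff /eqP : size s == 1%N.
  case: s {hs} trE => [|i [|]] // trE _.
  by exists i => g; rewrite trE trace_dsum big_seq1.
(* Summed over the list with repetitions, the multiplicities give the sum of their squares, which is
   the norm of the character. *)
have sq : (\sum_(i <- s) count_mem i s = 1)%N.
  apply/eqP; rewrite -(eqr_nat C) -(inj_eq (mulfI cardG_neq0)) mulr1 natr_sum mulr_sumr.
  apply/eqP; rewrite -[RHS]nrm.
  under [RHS]eq_bigr => g _ do rewrite !trE (trace_dsum s (g^-1)%g) mulr_sumr.
  by rewrite exchange_big /=; apply: eq_bigr => i _; rewrite sum_dsum_psi.
case: s sq {hs trE} => [|i s]; first by rewrite big_nil.
have le : (size s <= \sum_(k <- s) count_mem k (i :: s))%N.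
  rewrite -sum1_size big_seq [leqRHS]big_seq; apply: leq_sum => j js.
  by rewrite -has_count has_pred1 inE js orbT.
by rewrite big_cons [count_mem i _]/= eqxx /=; move: le => /=; lia.
Qed.
End Representations.

(** * Linear characters as permutations of the irreducibles *)

Section LinearCharacters.
Variables (C : numClosedFieldType) (gT : finGroupType).
Notation G := [set: gT]%G.
Notation reprG := (mx_representation C G).
Notation iG := (DecSocleType (regular_repr C G) : irrType C G).
Notation psi := (@psi C gT).
Implicit Types (r : representation C G) (i j : iG) (s : {perm iG}).

Definition irr0 : iG := principal_comp iG.
Notation o := irr0.

Lemma degree_irr0 : irr_degree o = 1%N.
Proof. exact: degree_irr1. Qed.

Lemma psi_irr0 g : psi o g = 1.
Proof.
by rewrite /psi irr1_repr ?in_setT // mxtrace1; have -> := degree_irr1 iG.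
Qed.

Definition is_lin (l : gT -> C) :=
  l 1%g = 1 /\ forall g h, l (g * h)%g = l g * l h.

Lemma is_lin_neq0 l g : is_lin l -> l g != 0.
Proof.
move=> [l1 lM]; apply: contra_eq_neq (lM g (g^-1)%g) => ->.
by rewrite mulgV l1 mul0r oner_eq0.
Qed.

Lemma is_lin_inv l g : is_lin l -> l g * l (g^-1)%g = 1.
Proof. by move=> [l1 lM]; rewrite -lM mulgV. Qed.

Lemma scale_mx_repr l n (rG : reprG n) : is_lin l ->
  mx_repr G (fun g => l g *: rG g).
Proof.
move=> [l1 lM]; split=> [|g h gG hG]; first by rewrite l1 repr_mx1 scale1r.
by rewrite lM repr_mxM // -scalemxAl -scalemxAr scalerA.
Qed.

(** The factors [l g] and [l g^-1] cancel in the norm, so the twist is again irreducible. *)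
Lemma twist_exists l i : is_lin l -> exists k, forall g, psi k g = l g * psi i g.
Proof.
move=> ll; pose r := MxRepresentation (scale_mx_repr (irr_repr i) ll).
have tr g : \tr (r g) = l g * psi i g by rewrite /= linearZ.
have [|k E] := @norm1_irr C gT _ r; last by exists k => g; rewrite -E.
transitivity (\sum_g psi i g * psi i (g^-1)%g); last by rewrite psi_orth eqxx mulr1.
by apply: eq_bigr => h _; rewrite !tr mulrACA (is_lin_inv h ll) mul1r.
Qed.

Lemma det_lin_char n (rG : reprG n) : is_lin (fun g => \det (rG g)).
Proof.
split=> [|g h]; first by rewrite repr_mx1 det1.
by rewrite repr_mxM ?in_setT // det_mulmx.
Qed.

Lemma psi_lin i : irr_degree i = 1%N -> is_lin (psi i) /\ forall g, \det (irr_repr i g) = psi i g.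
Proof.
move=> di; have E g : \det (irr_repr i g) = psi i g.
  rewrite /psi; move: (irr_repr i g); rewrite di => A.
  by rewrite det_mx11 trace_mx11.
split=> //; have [l1 lM] := det_lin_char (irr_repr i).
by split=> [|g h]; rewrite -!E.
Qed.

(** For a linear [l] the default is never reached: twisting by [l] is injective on irreducibles,
    hence a permutation. *)
Definition twist (l : gT -> C) : {perm iG} :=
  odflt 1%g [pick s : {perm iG} |
    [forall j, [forall g, psi (s j) g == l g * psi j g]]].

Lemma twistE l j g : is_lin l -> psi (twist l j) g = l g * psi j g.
Proof.
move=> ll; rewrite /twist; case: pickP => [s /forallP /(_ j) /forallP /(_ g) /eqP //|none].
have [f fE] := choice (fun i => twist_exists i ll).
have fI : injective f.
  move=> i k fik; apply: psi_inj => h; apply: (mulfI (is_lin_neq0 h ll)).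
  by rewrite -!fE fik.
have := none (perm fI); case/negP; apply/forallP => i; apply/forallP => h.
by rewrite permE fE.
Qed.

(** A linear character is encoded by the permutation that tensoring with it induces on the
    irreducibles, and is recovered as [psi (s o)]. In this form the group acts on multiplicity
    vectors directly. *)
Definition lin_set : {set {perm iG}} :=
  [set s : {perm iG} | (irr_degree (s o) == 1%N) &&
           [forall j, [forall g, psi (s j) g == psi (s o) g * psi j g]]].

Lemma lin_setP s : reflect (irr_degree (s o) = 1%N /\
    forall j g, psi (s j) g = psi (s o) g * psi j g) (s \in lin_set).
Proof.
rewrite inE; apply: (iffP andP) => [[/eqP ds /forallP h]|[ds h]].
  by split=> // j g; have /forallP/(_ g)/eqP := h j.
split; first by rewrite ds.
by apply/forallP => j; apply/forallP => g; rewrite h.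
Qed.

Lemma degree_twist s j : irr_degree (s o) = 1%N ->
  (forall j g, psi (s j) g = psi (s o) g * psi j g) -> irr_degree (s j) = irr_degree j.
Proof.
move=> ds h; apply/eqP; rewrite -(eqr_nat C) -!psi1 h psi1 ds mul1r //.
Qed.

Lemma lin_set_group : group_set lin_set.
Proof.
apply/group_setP; split=> [|s t /lin_setP [ds hs] /lin_setP [dt ht]].
  apply/lin_setP; rewrite perm1; split=> [|j g]; first exact: degree_irr0.
  by rewrite perm1 psi_irr0 mul1r.
apply/lin_setP; rewrite permM; split=> [|j g]; first by rewrite (degree_twist _ dt).
by rewrite permM ht hs [in RHS]ht mulrA.
Qed.

Definition lin_group : {group {perm iG}} := Group lin_set_group.
Notation A := lin_group.

Lemma lin_groupE a j g : a \in A -> psi (a j) g = psi (a o) g * psi j g.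
Proof. by case/lin_setP. Qed.

Lemma lin_group_degree a j : a \in A -> irr_degree (a j) = irr_degree j.
Proof. by case/lin_setP => da ha; apply: degree_twist. Qed.

Lemma lin_group_lin a : a \in A -> is_lin (psi (a o)).
Proof. by case/lin_setP => /psi_lin []. Qed.

Lemma lin_group_reg : {in A &, forall a b : {perm iG}, a o = b o -> a = b}.
Proof.
move=> a b aA bA ab; apply/permP => j; apply: psi_inj => g.
by rewrite lin_groupE // ab -lin_groupE.
Qed.

Lemma lin_group_inj a b : a \in A -> b \in A -> psi (a o) =1 psi (b o) -> a = b.
Proof. by move=> aA bA /psi_inj; apply: lin_group_reg. Qed.

Lemma lin_groupM a b g : a \in A -> b \in A ->
  psi ((a * b)%g o) g = psi (a o) g * psi (b o) g.
Proof. by move=> aA bA; rewrite permM lin_groupE // mulrC. Qed.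

Lemma lin_groupX a n g : a \in A -> psi ((a ^+ n)%g o) g = psi (a o) g ^+ n.
Proof.
move=> aA; elim: n => [|n IH]; first by rewrite expg0 perm1 psi_irr0 expr0.
by rewrite expgS exprS lin_groupM ?groupX // IH.
Qed.

Lemma lin_group_abelian : abelian A.
Proof.
apply/centsP => a aA b bA; apply: lin_group_inj; rewrite ?groupM // => g.
by rewrite !lin_groupM // mulrC.
Qed.

Lemma twist_in l : is_lin l -> twist l \in A.
Proof.
move=> ll; have E g : psi (twist l o) g = l g by rewrite twistE // psi_irr0 mulr1.
apply/lin_setP; split=> [|j g]; last by rewrite E twistE.
apply/eqP; rewrite -(eqr_nat C) -psi1 E.
by case: ll => -> _.
Qed.

Lemma twist_irr0 l g : is_lin l -> psi (twist l o) g = l g.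
Proof. by move=> ll; rewrite twistE // psi_irr0 mulr1. Qed.

Lemma lin_group_lin1 i : irr_degree i = 1%N -> exists2 a : {perm iG}, a \in A & a o = i.
Proof.
move=> di; have [li _] := psi_lin di; exists (twist (psi i)); first exact: twist_in.
by apply: psi_inj => g; rewrite twist_irr0.
Qed.

Definition det_perm i : {perm iG} := twist (fun g => \det (irr_repr i g)).

Lemma det_perm_in i : det_perm i \in A.
Proof. exact/twist_in/det_lin_char. Qed.

Lemma det_permE i g : psi (det_perm i o) g = \det (irr_repr i g).
Proof. by rewrite twist_irr0 //; apply: det_lin_char. Qed.

Lemma det_perm_lin : {in A, forall a : {perm iG}, det_perm (a o) = a}.
Proof.
move=> a aA; apply: lin_group_inj => //; first exact: det_perm_in.
move=> g; rewrite det_permE; apply: (psi_lin _).2.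
by rewrite lin_group_degree // degree_irr0.
Qed.

(** Scaling a matrix of size [irr_degree i] by the value of a linear character multiplies its
    determinant by that power of the value. *)
Lemma det_perm_act : {in A, forall (a : {perm iG}) i,
  det_perm (a i) = (a ^+ irr_degree i * det_perm i)%g}.
Proof.
move=> a aA i; apply: lin_group_inj; rewrite ?groupM ?groupX ?det_perm_in // => g.
rewrite lin_groupM ?groupX ?det_perm_in // lin_groupX // !det_permE.
have ll := lin_group_lin aA.
have sim : mx_rsim (irr_repr (a i)) (MxRepresentation (scale_mx_repr (irr_repr i) ll)).
  by apply: rsim_trace => h; rewrite /= linearZ /= -/(psi (a i) h) lin_groupE.
by rewrite (det_rsim g sim) /= detZ.
Qed.

Lemma lin_group_prod (I : eqType) (t : seq I) (F : I -> {perm iG}) g :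
  (forall k : I, k \in t -> F k \in A) ->
  psi ((\prod_(i <- t) F i)%g o) g = \prod_(i <- t) psi (F i o) g.
Proof.
elim: t => [|i t IH] Ft; first by rewrite !big_nil perm1 psi_irr0.
have Ft' (j : I) : j \in t -> F j \in A by move=> jt; apply: Ft; rewrite inE jt orbT.
rewrite !big_cons lin_groupM ?IH //; first by apply: Ft; rewrite mem_head.
by rewrite big_seq; apply: group_prod => j jt; apply: Ft'.
Qed.

End LinearCharacters.

Local Open Scope sesquilinear_scope.

(** * Two-by-two matrices and unitary matrices *)

Lemma det_mx2 (R : comRingType) (A : 'M[R]_2) :
  \det A = A 0 0 * A 1 1 - A 0 1 * A 1 0.
Proof.
rewrite (expand_det_row _ 0) !big_ord_recl big_ord0 addr0 /cofactor !det_mx11 !mxE /=.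
rewrite expr0 expr1 mul1r mulN1r mulrN.
by congr (A _ _ * A _ _ - A _ _ * A _ _); apply: val_inj.
Qed.

Lemma mxtrace2 (R : pzRingType) (B : 'M[R]_2) : \tr B = B 0 0 + B 1 1.
Proof.
rewrite /mxtrace !big_ord_recl big_ord0 addr0.
by congr (_ + B _ _); apply: val_inj.
Qed.

Lemma mulmx2E (R : pzRingType) (A B : 'M[R]_2) i j :
  (A *m B) i j = A i 0 * B 0 j + A i 1 * B 1 j.
Proof.
rewrite mxE !big_ord_recl big_ord0 addr0.
by congr (_ + A _ _ * B _ _); apply: val_inj.
Qed.

(* Cayley-Hamilton for matrices of determinant [1] *)
Lemma add_inv_mx2 (R : comRingType) (A B : 'M[R]_2) :
  \det A = 1 -> A *m B = 1%:M -> A + B = (\tr A)%:M.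
Proof.
rewrite det_mx2 mxtrace2 => D AB.
have E i j : A i 0 * B 0 j + A i 1 * B 1 j = (i == j)%:R.
  by rewrite -mulmx2E AB mxE.
have := E 0 0; have := E 1 0; have := E 0 1; have := E 1 1; rewrite !eqxx /=.
have ord2 (i : 'I_2) : i = 0 \/ i = 1.
  by case: i => [[|[|]]] // h; [left | right]; apply: val_inj.
move=> E11 E01 E10 E00; apply/matrixP => i j; rewrite !mxE.
have -> : B i j = (A 0 0 + A 1 1) *+ (i == j) - A i j.
  move: D E11 E01 E10 E00; case: (ord2 i) => ->; case: (ord2 j) => -> /=;
  move: (A 0 0) (A 0 1) (A 1 0) (A 1 1) (B 0 0) (B 0 1) (B 1 0) (B 1 1);
  move=> a b c d e f k l D E11 E01 E10 E00; rewrite ?eqxx /= ?mulr1n ?mulr0n.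
  (* Cramer's rule for an entry of [B]; the last term, a multiple of [1 - \det A], vanishes. *)
  - transitivity (d * (a * e + b * k) - b * (c * e + d * k) + e * (1 - (a * d - b * c))).
      by ring.
    by rewrite E00 E10 D; ring.
  - transitivity (d * (a * f + b * l) - b * (c * f + d * l) + f * (1 - (a * d - b * c))).
      by ring.
    by rewrite E01 E11 D; ring.
  - transitivity (a * (c * e + d * k) - c * (a * e + b * k) + k * (1 - (a * d - b * c))).
      by ring.
    by rewrite E00 E10 D; ring.
  transitivity (a * (c * f + d * l) - c * (a * f + b * l) + l * (1 - (a * d - b * c))).
    by ring.
  by rewrite E01 E11 D; ring.
by rewrite addrC subrK.
Qed.

(** The matrix factors through the two-by-two one in scalar blocks, whose determinant is 1: by
    triangular factors if its corner is nonzero, and otherwise after adding the second block row to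
    the first. *)
Lemma det_kron2 (F : fieldType) n (a b c d : F) (P : 'M[F]_n) : a * d - b * c = 1 ->
  \det (block_mx (a *: P) (b *: P) (c *: P) (d *: P)) = \det P ^+ 2.
Proof.
move=> abcd.
have det1 x y z t : x != 0 -> x * t - y * z = 1 ->
    \det (block_mx x%:M y%:M z%:M t%:M : 'M[F]_(n + n)) = 1.
  move=> x0 E; have tE : t = (1 + y * z) / x by rewrite -E subrK mulrC mulKf.
  have -> : block_mx x%:M y%:M z%:M t%:M =
    block_mx 1%:M 0 (z / x)%:M 1%:M *m block_mx x%:M y%:M 0 x^-1%:M :> 'M[F]_(n + n).
    rewrite mulmx_block !(mul0mx, mulmx0, mul1mx, addr0, add0r) -!scalar_mxM -raddfD /=.
    by congr block_mx; congr (_%:M); rewrite ?tE; field.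
  by rewrite det_mulmx det_lblock det_ublock !det1 !det_scalar -exprMn mulfV // expr1n !mulr1.
have -> : block_mx (a *: P) (b *: P) (c *: P) (d *: P) =
   block_mx a%:M b%:M c%:M d%:M *m block_mx P 0 0 P.
  by rewrite mulmx_block !mul_scalar_mx !scaler0 !addr0 !add0r.
rewrite det_mulmx det_ublock -expr2.
suff -> : \det (block_mx a%:M b%:M c%:M d%:M : 'M[F]_(n + n)) = 1 by rewrite mul1r.
have [a0|a0] := eqVneq a 0; last exact: det1.
have c0 : c != 0.
  by apply: contra_eq_neq abcd => ->; rewrite a0 mul0r mulr0 subr0 eq_sym oner_eq0.
have := det1 (a + c) (b + d) c d; rewrite a0 add0r => /(_ c0) <-; last first.
  by rewrite -abcd a0; ring.
have -> : block_mx c%:M (b + d)%:M c%:M d%:M =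
   block_mx 1%:M 1%:M 0 1%:M *m block_mx 0%:M b%:M c%:M d%:M :> 'M[F]_(n + n).
  by rewrite mulmx_block !(mul0mx, mul1mx, addr0, add0r) -!raddfD /= add0r.
by rewrite det_mulmx det_ublock !matrix.det1 !mul1r.
Qed.

Section Unitary.
Variable C : numClosedFieldType.

Lemma mxtrace_mul_tC n (A : 'M[C]_n) : \tr (A *m A^t*) = \sum_i \sum_j `|A i j| ^+ 2.
Proof.
by apply: eq_bigr => i _; rewrite mxE; apply: eq_bigr => j _; rewrite !mxE normCK.
Qed.

Lemma mxtrace_mul_tC_eq0 n (A : 'M[C]_n) : \tr (A *m A^t*) = 0 -> A = 0.
Proof.
rewrite mxtrace_mul_tC => /eqP; rewrite psumr_eq0 => [/allP h|i _]; last first.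
  by apply: sumr_ge0 => j _; rewrite exprn_ge0.
apply/matrixP => i j; rewrite mxE; have := h i (mem_index_enum i).
rewrite psumr_eq0 => [/allP/(_ j (mem_index_enum j))|k _]; last by rewrite exprn_ge0.
by rewrite expf_eq0 normr_eq0 => /eqP.
Qed.

Lemma mxtrace_tC n (A : 'M[C]_n) : \tr (A^t*) = (\tr A)^*.
Proof. by rewrite /mxtrace rmorph_sum; apply: eq_bigr => i _; rewrite !mxE. Qed.

(** The squared Frobenius norm of [A - 1] is [n - \tr A - (\tr A)^* + n], which is 0. *)
Lemma unitary_trace_eq1 n (A : 'M[C]_n) : A \is unitarymx -> \tr A = n%:R -> A = 1%:M.
Proof.
move=> /unitarymxP uA trA; apply/eqP; rewrite -subr_eq0; apply/eqP.
apply: mxtrace_mul_tC_eq0; rewrite linearB /= map_mxB trmx1 map_mx1.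
rewrite mulmxBl !mulmxBr uA !mul1mx !mulmx1 !raddfB /= mxtrace_tC trA mxtrace1.
by rewrite conjC_nat !subrr addr0.
Qed.

End Unitary.

Lemma sum_count (T : zmodType) (I : finType) (s : seq I) (F : I -> T) :
  \sum_(i <- s) F i = \sum_j F j *+ count_mem j s.
Proof.
elim: s => [|i s IH]; first by rewrite big_nil big1.
rewrite big_cons IH /=; under [RHS]eq_bigr => j _ do rewrite mulrnDr.
rewrite big_split /=; congr (_ + _); rewrite (bigD1 i) //= eqxx big1 ?addr0 // => j ji.
by rewrite eq_sym (negbTE ji).
Qed.

Lemma prod_count (T : comRingType) (I : finType) (s : seq I) (F : I -> T) :
  \prod_(i <- s) F i = \prod_j F j ^+ count_mem j s.
Proof.
elim: s => [|i s IH]; first by rewrite big_nil big1.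
rewrite big_cons IH /=; under [RHS]eq_bigr => j _ do rewrite exprD.
rewrite big_split /=; congr (_ * _); rewrite (bigD1 i) //= eqxx big1 ?mulr1 // => j ji.
by rewrite eq_sym (negbTE ji).
Qed.

(** * The McKay graph of a subgroup of SU(2) *)

Section McKayData.
Variables (C : numClosedFieldType) (gT : finGroupType).
Notation G := [set: gT]%G.
Notation reprG := (mx_representation C G).
Notation iG := (DecSocleType (regular_repr C G) : irrType C G).
Notation psi := (@psi C gT).
Notation o := (irr0 C gT).
Notation A := (lin_group C gT).
Implicit Types i j : iG.
Variable V : reprG 2.
Hypotheses (V_unitary : forall g, V g \is unitarymx) (V_det : forall g, \det (V g) = 1)
  (V_inj : forall g, V g = 1%:M -> g = 1%g).

Definition tensor_mx n (rG : reprG n) g : 'M[C]_(n + n) :=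
  block_mx (V g 0 0 *: rG g) (V g 0 1 *: rG g) (V g 1 0 *: rG g) (V g 1 1 *: rG g).

Lemma tensor_mx_repr n (rG : reprG n) : mx_repr G (tensor_mx rG).
Proof.
split=> [|g h gG hG]; rewrite /tensor_mx.
  by rewrite !repr_mx1 !mxE /= !scale1r !scale0r -scalar_mx_block.
have VM (i j : 'I_2) : V (g * h)%g i j = V g i 0 * V h 0 j + V g i 1 * V h 1 j.
  rewrite repr_mxM // mxE !big_ord_recl big_ord0 addr0.
  by congr (_ + V g _ _ * V h _ _); apply: val_inj.
rewrite mulmx_block -!scalemxAl -!scalemxAr -!repr_mxM // !scalerA.
by rewrite -!scalerDl -!VM.
Qed.

Definition tensor n (rG : reprG n) := MxRepresentation (tensor_mx_repr rG).

Let tV g := \tr (V g).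

Lemma trace_tensor n (rG : reprG n) g : \tr (tensor rG g) = tV g * \tr (rG g).
Proof. by rewrite /= mxtrace_block !linearZ /= /tV mxtrace2 mulrDl. Qed.

Lemma det_tensor n (rG : reprG n) g : \det (tensor rG g) = \det (rG g) ^+ 2.
Proof. by rewrite /= det_kron2 // -det_mx2. Qed.

Lemma repr_add_inv g : V g + V (g^-1)%g = (tV g)%:M.
Proof.
apply: add_inv_mx2 => //.
by rewrite -repr_mxM ?in_setT // mulgV repr_mx1.
Qed.

(** This self-duality is what makes the McKay matrix symmetric. *)
Lemma trace_inv g : tV (g^-1)%g = tV g.
Proof.
have := congr1 mxtrace (repr_add_inv g); rewrite raddfD /= mxtrace_scalar mulr2n.
by rewrite -/(tV g) -/(tV g^-1) => /addrI.
Qed.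

Lemma trace_eq2 g : tV g = 2%:R -> g = 1%g.
Proof. by move=> E; apply/V_inj/unitary_trace_eq1. Qed.

Lemma tensor_dsum_exists i : exists s, mx_rsim (tensor (irr_repr i)) (dsum s).
Proof. exact: rsim_dsum. Qed.

Definition mckay_seq := projT1 (choice tensor_dsum_exists).
Lemma mckay_seqP i : mx_rsim (tensor (irr_repr i)) (dsum (mckay_seq i)).
Proof. by rewrite /mckay_seq; case: choice. Qed.

Definition mckay_mx i j := count_mem j (mckay_seq i).

Lemma mckay_trace i g : tV g * psi i g = \sum_j psi j g *+ mckay_mx i j.
Proof.
by rewrite -trace_tensor (mxtrace_rsim (mckay_seqP i)) ?in_setT // trace_dsum sum_count.
Qed.

Lemma mckay_det i g :
  \prod_j \det (irr_repr j g) ^+ mckay_mx i j = \det (irr_repr i g) ^+ 2.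
Proof. by rewrite -det_tensor (det_rsim g (mckay_seqP i)) det_dsum [RHS]prod_count. Qed.

Lemma mckay_mxE i j :
  \sum_g tV g * psi i g * psi j (g^-1)%g = #|gT|%:R * (mckay_mx i j)%:R.
Proof.
rewrite -sum_dsum_psi; apply: eq_bigr => g _.
by rewrite -(mxtrace_rsim (mckay_seqP i)) ?in_setT // trace_tensor.
Qed.

Lemma mckay_mx_sym i j : mckay_mx i j = mckay_mx j i.
Proof.
apply/eqP; rewrite -(eqr_nat C) -(inj_eq (mulfI (cardG_neq0 C gT))) -!mckay_mxE.
rewrite (reindex_inj invg_inj) /=; apply/eqP/eq_bigr => g _.
by rewrite trace_inv invgK mulrAC.
Qed.

Lemma mckay_mx_degree i :
  (\sum_j mckay_mx i j * irr_degree j = 2 * irr_degree i)%N.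
Proof.
apply/eqP; rewrite -(eqr_nat C) natrM -psi1 natr_sum.
have <- : tV 1%g = 2%:R by rewrite /tV repr_mx1 mxtrace1.
rewrite mckay_trace; apply/eqP/eq_bigr => j _.
by rewrite natrM -psi1 mulr_natl.
Qed.

Lemma mckay_mx_act : {in A, forall (a : {perm iG}) i j,
  mckay_mx (a i) (a j) = mckay_mx i j}.
Proof.
move=> a aA i j.
apply/eqP; rewrite -(eqr_nat C) -(inj_eq (mulfI (cardG_neq0 C gT))) -!mckay_mxE.
apply/eqP/eq_bigr => g _; rewrite (lin_groupE i g aA) (lin_groupE j _ aA).
have := is_lin_inv g (lin_group_lin aA).
move: (psi _ _) (psi _ _) (psi _ _) (psi _ _) => w x y z E.
by rewrite -[RHS]mulr1 -E; ring.
Qed.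

(* The polynomial in [tV] vanishing at all [tV g], [g != 1], is a multiple of
   the regular character, so it involves every irreducible. *)
Lemma mckay_connected (S : pred iG) : S o ->
  (forall i j, S i -> (0 < mckay_mx i j)%N -> S j) -> forall i, S i.
Proof.
move=> So Scl i.
(* Multiplication by [tV] follows the edges, so polynomials in [tV] only involve irreducibles in
   [S]. *)
have pow (p : {poly C}) : exists c : iG -> C, (forall j, ~~ S j -> c j = 0) /\
    forall g, p.[tV g] = \sum_j c j * psi j g.
  elim/poly_ind: p => [|p a [c [cS cE]]].
    by exists (fun=> 0); split=> // g; rewrite horner0 big1 // => j _; rewrite mul0r.
  exists (fun j => \sum_k c k * (mckay_mx k j)%:R + a * (j == o)%:R); split.
    move=> j nSj; rewrite big1 => [|k _]; last first.
      have [Sk|/cS ->] := boolP (S k); last by rewrite mul0r.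
      have [->|Mkj] := posnP (mckay_mx k j); first by rewrite mulr0.
      by rewrite (Scl k j Sk Mkj) in nSj.
    by have [jo|] := eqVneq j o; [rewrite jo So in nSj | rewrite mulr0 addr0].
  move=> g; rewrite hornerMXaddC cE mulr_suml.
  under [RHS]eq_bigr => j _ do rewrite mulrDl mulr_suml.
  rewrite big_split /=; congr (_ + _); last first.
    rewrite (bigD1 o) //= eqxx psi_irr0 !mulr1 big1 ?addr0 // => j jo.
    by rewrite (negbTE jo) mulr0 mul0r.
  rewrite exchange_big /=; apply: eq_bigr => k _.
  rewrite -mulrA [psi k g * _]mulrC mckay_trace mulr_sumr; apply: eq_bigr => j _.
  by rewrite -mulrA mulr_natl.
pose p : {poly C} := \prod_(g | g != 1%g) ('X - (tV g)%:P).
have [c [cS cE]] := pow p.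
have p0 g : g != 1%g -> p.[tV g] = 0.
  by move=> g1; rewrite /p (bigD1 g) //= hornerM hornerXsubC subrr mul0r.
have p1 : p.[tV 1%g] != 0.
  rewrite /p horner_prod; apply/prodf_neq0 => g g1; rewrite hornerXsubC subr_eq0.
  apply: contraNneq g1 => E; apply/eqP/trace_eq2; rewrite -E.
  by rewrite /tV repr_mx1 mxtrace1.
apply/negPn/negP => nSi.
(* The coefficient of a missing [i] is 0, yet the sum reduces to its nonzero term at [g = 1]. *)
have : \sum_g p.[tV g] * psi i (g^-1)%g = #|gT|%:R * c i.
  transitivity (\sum_j c j * \sum_g psi j g * psi i (g^-1)%g).
    under eq_bigr => g _ do rewrite cE mulr_suml.
    rewrite exchange_big /=; apply: eq_bigr => j _.
    by rewrite mulr_sumr; apply: eq_bigr => g _; rewrite mulrA.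
  rewrite (bigD1 i) //= psi_orth eqxx mulr1 mulrC big1 ?addr0 // => j ji.
  by rewrite psi_orth (negbTE ji) !mulr0.
rewrite (cS i nSi) mulr0 (bigD1 1%g) //= big1 => [|g g1]; last by rewrite p0 // mul0r.
rewrite addr0 invg1 psi1 => /eqP; rewrite mulf_eq0 (negbTE p1) pnatr_eq0 /=.
by rewrite -leqn0 leqNgt irr_degree_gt0.
Qed.

Lemma mckay_det_perm i (s : seq iG) : uniq s ->
  (forall j, (0 < mckay_mx i j)%N -> j \in s) ->
  (\prod_(j <- s) det_perm j ^+ mckay_mx i j = det_perm i ^+ 2)%g.
Proof.
move=> us ful.
have pA : (\prod_(j <- s) det_perm j ^+ mckay_mx i j)%g \in A.
  by apply: group_prod => j _; rewrite groupX // det_perm_in.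
apply: lin_group_inj => //; first by rewrite groupX // det_perm_in.
move=> g; rewrite lin_groupX ?det_perm_in // det_permE -mckay_det.
rewrite lin_group_prod => [|j _]; last by rewrite groupX // det_perm_in.
under eq_bigr => j _ do rewrite lin_groupX ?det_perm_in // det_permE.
rewrite [RHS](bigID (mem s)) /= [X in _ * X]big1 ?mulr1 => [|j js].
  by rewrite big_uniq.
by have [->|/ful] := posnP (mckay_mx i j); rewrite ?expr0 // (negbTE js).
Qed.

Theorem mckay_count n :
  #|[set m in mult_set (fun i : iG => irr_degree i) n |
      det_mult (@det_perm C gT) m == 1%g]| =
  #|[set orbit (mult_action iG n) A m |
      m in mult_set (fun i : iG => irr_degree i) n]|.
Proof.
have [e eP] : exists e, dual_pairing (C := C) (fun i : iG => irr_degree i) A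
    (@det_perm C gT) e.
  apply: (@mckay_pairing C _ (fun i : iG => irr_degree i) o mckay_mx).
  - exact: irr_degree_gt0.
  - by move=> a aA i; apply: lin_group_degree.
  - exact: det_perm_in.
  - exact: lin_group_reg.
  - exact: lin_group_lin1.
  - exact: degree_irr0.
  - exact: det_perm_lin.
  - exact: mckay_mx_sym.
  - exact: mckay_mx_degree.
  - exact: mckay_connected.
  - exact: mckay_mx_act.
  - exact: det_perm_act.
  - exact: mckay_det_perm.
  exact: lin_group_abelian.
apply: det_count eP _.
- exact: irr_degree_gt0.
- by move=> a aA i; apply: lin_group_degree.
- exact: det_perm_in.
- exact: lin_group_reg.
- exact: lin_group_lin1.
- exact: degree_irr0.
exact: det_perm_lin.
Qed.

End McKayData.

(** * Unitary representations *)

Section PositiveRoot.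
Variables (C : numClosedFieldType) (n : nat).
Implicit Types (H T : 'M[C]_n).

Lemma tCM m1 m2 m3 (X : 'M[C]_(m1, m2)) (Y : 'M[C]_(m2, m3)) :
  (X *m Y)^t* = Y^t* *m X^t*.
Proof. by rewrite trmx_mul map_mxM. Qed.

Lemma row_norm_gt0 (u : 'rV[C]_n) : u != 0 -> 0 < (u *m u^t*) 0 0.
Proof.
move=> u0; rewrite mxE; have h i : 0 <= u 0 i * (u^t*) i 0.
  by rewrite !mxE -normCK exprn_ge0.
rewrite lt_def sumr_ge0 // andbT; apply: contra u0.
rewrite psumr_eq0 => [/allP E|i _]; last exact: h.
apply/eqP/matrixP => i j; rewrite ord1 mxE; apply/eqP.
have := E j (mem_index_enum j); rewrite !mxE -normCK expf_eq0 normr_eq0.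
by [].
Qed.

(** [S] takes the roots of the eigenvalues of [H] in a unitary eigenbasis; being a function of [H],
    it commutes with all that commutes with [H]. *)
Lemma positive_root H : H^t* = H ->
    (forall u : 'rV[C]_n, u != 0 -> 0 < (u *m H *m u^t*) 0 0) ->
  exists S : 'M[C]_n, [/\ S \in unitmx, S^t* = S, S *m S = H &
    forall X, X *m H = H *m X -> X *m S = S *m X].
Proof.
move=> Hh pos.
have /orthomx_spectralP HE : H \is normalmx by apply/normalmxP; rewrite Hh.
set P := spectralmx H in HE; set d := spectral_diag H in HE.
have uP : P \is unitarymx := spectral_unitarymx H.
have PV : invmx P = P^t* := invmx_unitary uP.
have PP : P *m P^t* = 1%:M by apply/unitarymxP.
have PP' : P^t* *m P = 1%:M by apply: mulmx1C.
rewrite PV in HE.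
have d0 i : 0 < d 0 i.
  have E : diag_mx d = P *m H *m P^t*.
    by rewrite HE !mulmxA PP mul1mx -!mulmxA PP mulmx1.
  have := pos (row i P); have -> : row i P *m H *m (row i P)^t* = (diag_mx d i i)%:M.
    rewrite E [LHS]mx11_scalar; congr (_%:M).
    by rewrite -row_mul !mxE; apply: eq_bigr => k _; rewrite !mxE.
  rewrite mxE eqxx mulr1n mxE eqxx mulr1n; apply.
  apply/eqP => /(congr1 (fun v => v *m P^t*)); rewrite mul0mx -row_mul PP => /matrixP /(_ 0 i).
  by rewrite !mxE eqxx => /eqP; rewrite oner_eq0.
pose s : 'rV[C]_n := \row_i sqrtC (d 0 i).
have sE : diag_mx s *m diag_mx s = diag_mx d.
  rewrite mulmx_diag; congr diag_mx; apply/rowP => i.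
  by rewrite !mxE -expr2 sqrtCK.
pose S := P^t* *m diag_mx s *m P.
have SS : S *m S = H.
  rewrite /S HE -!mulmxA; congr (_ *m _).
  by rewrite [P *m (_ *m _)]mulmxA PP mul1mx !mulmxA sE.
exists S; split=> //.
- have uPC : P^t* \is unitarymx by rewrite trmxC_unitary.
  rewrite !unitmx_mul (unitarymx_unit uP) (unitarymx_unit uPC) andbT /=.
  rewrite unitmxE det_diag unitfE; apply/prodf_neq0 => i _.
  by rewrite mxE sqrtC_eq0 gt_eqF.
- rewrite /S !tCM trmxCK mulmxA; congr (_ *m _ *m _).
  apply/matrixP => i j; rewrite !mxE eq_sym.
  have [->|_] := eqVneq i j; last by rewrite !mulr0n conjC0.
  by rewrite !mulr1n conj_Creal // realE sqrtC_ge0 ltW.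
move=> X XH; pose Y := P *m X *m P^t*.
have XE : X = P^t* *m Y *m P by rewrite /Y -!mulmxA PP' mulmx1 !mulmxA PP' mul1mx.
have YD : Y *m diag_mx d = diag_mx d *m Y.
  have -> : diag_mx d = P *m H *m P^t*.
    by rewrite HE !mulmxA PP mul1mx -!mulmxA PP mulmx1.
  rewrite /Y -!mulmxA ![P^t* *m (P *m _)]mulmxA PP' !mul1mx.
  by rewrite [X *m (H *m _)]mulmxA XH !mulmxA.
(* Where an entry of [Y] is nonzero the two eigenvalues agree, and so do their roots. *)
have YS : Y *m diag_mx s = diag_mx s *m Y.
  move: Y YD {XE} => Y YD.
  apply/matrixP => i j; have /matrixP/(_ i j) := YD.
  rewrite !mul_mx_diag !mul_diag_mx !mxE => /eqP.
  have [->|y0 /eqP] := eqVneq (Y i j) 0; first by rewrite !mul0r !mulr0.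
  by rewrite [d 0 i * _]mulrC => /(mulfI y0) ->; rewrite mulrC.
move: Y XE YS {YD} => Y XE YS.
rewrite XE /S -!mulmxA ![P *m (P^t* *m _)]mulmxA PP !mul1mx.
by rewrite [Y *m (_ *m _)]mulmxA YS !mulmxA.
Qed.

End PositiveRoot.

Section UnitaryRepresentations.
Variables (C : numClosedFieldType) (gT : finGroupType).
Notation G := [set: gT]%G.
Notation reprG := (mx_representation C G).
Notation iG := (DecSocleType (regular_repr C G) : irrType C G).
Notation psi := (@psi C gT).
Notation A := (lin_group C gT).
Notation mults n := (mult_set (fun i : iG => irr_degree i) n).
Variable n : nat.
Implicit Types (r : reprG n) (m : {ffun iG -> 'I_n.+1}).

(** The unitary part of the polar decomposition of an intertwiner [T]: [T *m T^t*] commutes with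
    [r1], hence so does its root, and dividing by the root still intertwines. *)
Lemma unitary_rsim r1 r2 : (forall g, r1 g \is unitarymx) ->
    (forall g, r2 g \is unitarymx) -> mx_rsim r1 r2 ->
  exists2 T : 'M[C]_n, T \is unitarymx & forall g, r1 g *m T = T *m r2 g.
Proof.
move=> u1 u2 [T _ fT hT]; have uT : T \in unitmx by rewrite -row_free_unit.
have {}hT g : r1 g *m T = T *m r2 g by apply: hT; rewrite in_setT.
have pos (u : 'rV[C]_n) : u != 0 -> 0 < (u *m (T *m T^t*) *m u^t*) 0 0.
  move=> u0; rewrite mulmxA -mulmxA -tCM; apply: row_norm_gt0.
  by apply: contra u0 => /eqP E; rewrite -[u](mulmxK uT) E mul0mx.
have [|S [uS Sh SS SX]] := positive_root _ pos; first by rewrite tCM trmxCK.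
have SVh : (invmx S)^t* = invmx S by rewrite trmx_inv map_invmx Sh.
exists (invmx S *m T).
  apply/unitarymxP; rewrite tCM SVh -mulmxA [T *m _]mulmxA -SS.
  by rewrite -[S *m S *m _]mulmxA mulmxV // mulmx1 mulVmx.
move=> g; have /SX E : r1 g *m (T *m T^t*) = T *m T^t* *m r1 g.
  have /unitarymxP U2 := u2 g; have /unitarymxP/mulmx1C U1 := u1 g.
  rewrite -[LHS]mulmx1 -[X in _ *m X = _]U1 mulmxA; congr (_ *m _).
  by rewrite mulmxA hT -!mulmxA -tCM hT tCM !mulmxA -[T *m _ *m _]mulmxA U2 mulmx1.
have SV : r1 g *m invmx S = invmx S *m r1 g.
  by rewrite -[LHS](mulKmx uS) [S *m (_ *m _)]mulmxA -E -mulmxA mulmxV // mulmx1.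
by rewrite mulmxA SV -!mulmxA hT.
Qed.

(** Weyl's averaging trick: conjugating by the square root of the invariant form [H] makes [r]
    unitary. *)
Lemma unitarizable r : exists r' : reprG n,
  (forall g, r' g \is unitarymx) /\ mx_rsim r r'.
Proof.
pose H := \sum_g r g *m (r g)^t*.
have rH h : r h *m H *m (r h)^t* = H.
  rewrite /H mulmx_sumr mulmx_suml [RHS](reindex_inj (mulgI h)) /=.
  by apply: eq_bigr => g _; rewrite repr_mxM ?in_setT // tCM !mulmxA.
have Hh : H^t* = H.
  rewrite /H raddf_sum /= raddf_sum /=; apply: eq_bigr => g _.
  by rewrite tCM trmxCK.
have pos (u : 'rV[C]_n) : u != 0 -> 0 < (u *m H *m u^t*) 0 0.
  move=> u0; rewrite /H mulmx_sumr mulmx_suml summxE.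
  have ug g : 0 < (u *m (r g *m (r g)^t*) *m u^t*) 0 0.
    rewrite mulmxA -mulmxA -tCM; apply: row_norm_gt0.
    apply: contra u0 => /eqP E.
    by rewrite -[u](mulmxK (repr_mx_unit r (in_setT g))) E mul0mx.
  rewrite (bigD1 1%g) //=; apply: ltr_pwDl; first exact: ug.
  by apply: sumr_ge0 => g _; apply: ltW.
have [S [uS Sh SS _]] := positive_root Hh pos.
have SVh : (invmx S)^t* = invmx S by rewrite trmx_inv map_invmx Sh.
have uSV : invmx S \in unitmx by rewrite unitmx_inv.
exists (rconj_repr r uSV); split=> [g|]; last first.
  exists S => //; first by rewrite row_free_unit.
  by move=> g _; rewrite /= /rconj_mx invmxK !mulmxA mulmxV // mul1mx.
apply/unitarymxP; rewrite /= /rconj_mx invmxK !tCM SVh Sh.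
rewrite -!mulmxA [S *m (S *m _)]mulmxA SS [H *m _]mulmxA [r g *m _]mulmxA [r g *m _]mulmxA rH.
by rewrite -SS -!mulmxA mulmxV // mulmx1 mulVmx.
Qed.

Lemma mult_exists r : exists m, [/\ m \in mults n,
  forall g, \tr (r g) = \sum_i psi i g *+ m i &
  forall g, \det (r g) = \prod_i \det (irr_repr i g) ^+ m i].
Proof.
have [s hs] := rsim_dsum r.
have dn : (\sum_(i : iG) irr_degree i * count_mem i s = n)%N.
  rewrite [in RHS](mxrank_rsim hs) degree_dsum.
  have := @sum_count int _ s (fun i => (irr_degree i)%:Z).
  rewrite -[LHS](big_morph Posz (fun _ _ => erefl) erefl) => h.
  apply/eqP; rewrite -eqz_nat h raddf_sum /=; apply/eqP/eq_bigr => i _.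
  by rewrite -mulr_natr natz PoszM.
have le i : (count_mem i s < n.+1)%N.
  rewrite ltnS -[leqRHS]dn (bigD1 i) //=; apply: leq_trans (leq_addr _ _).
  by rewrite leq_pmull // irr_degree_gt0.
exists [ffun i => Ordinal (le i)]; split.
- by rewrite inE -[X in _ == X]dn; apply/eqP/eq_bigr => i _; rewrite ffunE.
- move=> g; rewrite (mxtrace_rsim hs) ?in_setT // trace_dsum sum_count.
  by apply: eq_bigr => i _; rewrite ffunE.
move=> g; rewrite (det_rsim g hs) det_dsum prod_count.
by apply: eq_bigr => i _; rewrite ffunE.
Qed.

Lemma mult_inj m m' :
  (forall g, \sum_i psi i g *+ m i = \sum_i psi i g *+ m' i) -> m = m'.
Proof.
have proj m0 j : \sum_g (\sum_i psi i g *+ m0 i) * psi j (g^-1)%g =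
    #|gT|%:R * (nat_of_ord (m0 j))%:R.
  under eq_bigr => g _ do rewrite mulr_suml.
  rewrite exchange_big /= (bigD1 j) //= [X in _ + X]big1 ?addr0 => [|i ij].
    under eq_bigr => g _ do rewrite mulrnAl.
    by rewrite sumrMnl psi_orth eqxx mulr1 [RHS]mulr_natr.
  under eq_bigr => g _ do rewrite mulrnAl.
  by rewrite sumrMnl psi_orth (negbTE ij) mulr0 mul0rn.
move=> E; apply/ffunP => j; apply/val_inj/eqP; rewrite /= -(eqr_nat C).
rewrite -(inj_eq (mulfI (cardG_neq0 C gT))) -!proj; apply/eqP/eq_bigr => g _.
by rewrite E.
Qed.

Lemma repr_of_mult m : m \in mults n -> exists r,
  (forall g, r g \is unitarymx) /\ forall g, \tr (r g) = \sum_i psi i g *+ m i.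
Proof.
rewrite inE => /eqP dm.
pose s : seq iG := flatten [seq nseq (m i) i | i <- enum iG].
have cs j : count_mem j s = m j.
  rewrite /s count_flatten -map_comp.
  rewrite sumnE big_map big_enum /= (bigD1 j) //= count_nseq /= eqxx mul1n.
  rewrite big1 ?addn0 // => i ij; rewrite count_nseq /= (negbTE ij) mul0n //.
have ds : rdegree (dsum s) = n.
  rewrite degree_dsum -[RHS]dm /s big_flatten big_map big_enum /=.
  by apply: eq_bigr => i _; rewrite big_nseq iter_addn_0.
have [r rs] : exists r, mx_rsim r (dsum s).
  move: ds (mx_repr_of_repr (dsum s)) => -> r.
  by exists r; apply: mx_rsim_refl.
have [r' [ur' rr']] := unitarizable r; exists r'; split=> // g.
rewrite -(mxtrace_rsim rr') ?in_setT // (mxtrace_rsim rs) ?in_setT //.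
by rewrite trace_dsum sum_count; apply: eq_bigr => i _; rewrite cs.
Qed.

End UnitaryRepresentations.

(** * Lifting projective representations *)

Section Projective.
Variables (C : numClosedFieldType) (gT : finGroupType) (n : nat) (s : gT -> 'M[C]_n).
Variable alpha : gT -> gT -> C.
Hypotheses (n_gt0 : (0 < n)%N) (s_unit : forall g, s g \in unitmx)
  (s_mul : forall g h, s g *m s h = alpha g h *: s (g * h)%g).

Lemma scale_unit_inj (X : 'M[C]_n) a b : X \in unitmx -> a *: X = b *: X -> a = b.
Proof.
move=> uX /(congr1 (mulmx^~ (invmx X))); rewrite -!scalemxAl mulmxV // !scalemx1.
by move=> /matrixP /(_ (Ordinal n_gt0) (Ordinal n_gt0)); rewrite !mxE eqxx.
Qed.

Lemma alpha_neq0 g h : alpha g h != 0.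
Proof.
apply/eqP => E; have := s_mul g h; rewrite E scale0r => /(congr1 (mulmx (invmx (s g)))).
rewrite mulKmx // mulmx0 => E'; have := s_unit h.
rewrite E' -[0](scale0r (s g)) => _.
have := @scale_unit_inj (s h) 1 0 (s_unit h); rewrite E' !scaler0 => /(_ erefl) /eqP.
by rewrite oner_eq0.
Qed.

(** The [k]-th power of the cocycle [alpha] is trivial on [H]. For [k = 1] this says that
    [l g *: s g] is multiplicative on [H]. *)
Definition coboundary_on (H : {set gT}) k := exists2 l : gT -> C, (forall g, l g != 0) &
  {in H &, forall g h, alpha g h ^+ k * l g * l h = l (g * h)%g}.

(* The classical transfer argument, with the determinant of the induced
   projective representation replaced by a product over cosets. *)
Lemma coboundary_transfer (H : {group gT}) : coboundary_on H 1 ->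
  coboundary_on setT #|[set: gT] : H|%g.
Proof.
move=> [l l0 lH].
have lHs h h' : h \in H -> h' \in H ->
    (l h *: s h) *m (l h' *: s h') = l (h * h')%g *: s (h * h')%g.
  move=> hH h'H; rewrite -scalemxAl -scalemxAr s_mul !scalerA -lH // expr1.
  by congr (_ *: _); ring.
pose r (x : gT) := repr (H :* x)%g.
pose hx x := (x * (r x)^-1)%g.
have hxH x : hx x \in H.
  have := mem_repr_rcoset H x; rewrite -/(r x) => /rcosetP [y yH E].
  by rewrite /hx E invMg mulgA mulgV mul1g groupV.
have rM h x : h \in H -> r (h * x)%g = r x.
  by move=> hH; rewrite /r rcosetM (rcoset_id hH).
pose t x := (l (hx x) *: s (hx x)) *m s (r x).
pose mu x := l (hx x) * alpha (hx x) (r x).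
have tE x : t x = mu x *: s x.
  by rewrite /t -scalemxAl s_mul scalerA /hx mulgKV.
have mu0 x : mu x != 0 by rewrite mulf_neq0 ?alpha_neq0.
have tM h x : h \in H -> t (h * x)%g = (l h *: s h) *m t x.
  move=> hH; rewrite /t mulmxA lHs ?hxH // rM //.
  by rewrite (_ : hx (h * x)%g = h * hx x)%g // /hx rM // mulgA.
pose c x g := mu x * alpha x g / mu (x * g)%g.
have cE x g : t x *m s g = c x g *: t (x * g)%g.
  by rewrite !tE -scalemxAl s_mul !scalerA /c mulfVK.
have tu x : t x \in unitmx by rewrite tE unitmxZ ?unitfE.
have cH h x g : h \in H -> c (h * x)%g g = c x g.
  move=> hH; apply: (@scale_unit_inj (t (h * x * g)%g)) => //.
  by rewrite -cE tM // -mulmxA cE -scalemxAr -tM // mulgA.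
have cM x g g' : c x g * c (x * g)%g g' = alpha g g' * c x (g * g')%g.
  apply: (@scale_unit_inj (t (x * g * g')%g)) => //.
  rewrite -scalerA -cE scalemxAl -cE -mulmxA s_mul -scalemxAr cE scalerA mulgA //.
have c0 x g : c x g != 0 by rewrite !mulf_neq0 ?invr_eq0 ?alpha_neq0.
pose R := rcosets H [set: gT].
(* Multiplying the relations [cM] over all cosets raises [alpha] to the index of [H]. *)
pose B g := \prod_(D in R) c (repr D) g.
have B0 g : B g != 0 by apply/prodf_neq0 => D _.
have Bmul g g' : B g * B g' = alpha g g' ^+ #|[set: gT] : H|%g * B (g * g')%g.
  have -> : B g' = \prod_(D in R) c (repr D * g)%g g'.
    rewrite /B (reindex_inj (can_inj (rcosetK g))) /=.
    have RE D : (D :* g \in R)%g = (D \in R).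
      apply/rcosetsP/rcosetsP => [[x _ E]|[x _ ->]]; last first.
        by exists (x * g)%g; rewrite ?in_setT // rcosetM.
      by exists (x * g^-1)%g; rewrite ?in_setT // rcosetM -E rcosetK.
    apply: eq_big => D; first by rewrite RE.
    rewrite RE => /rcosetsP [x _ ->]; rewrite -rcosetM.
    have /rcosetP [y yH ->] := mem_repr_rcoset H (x * g)%g.
    have /rcosetP [z zH ->] := mem_repr_rcoset H x.
    by rewrite (cH y) // -(mulgA z x g) (cH z).
  rewrite /B -big_split /=; under eq_bigr => D _ do rewrite cM.
  by rewrite big_split /= prodr_const.
exists (fun g => (B g)^-1) => [g|g g' _ _]; first by rewrite invr_eq0.
rewrite -mulrA -invfM Bmul invfM mulrA mulfV ?mul1r //.
by rewrite expf_neq0 // alpha_neq0.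
Qed.

(** By Euclidean division, the exponents that trivialize [alpha] are multiples of the least one; a
    prime divisor of it would divide them all. *)
Lemma coboundary_coprime :
  (forall p, prime p -> exists2 k, ~~ (p %| k)%N & coboundary_on setT k) ->
  coboundary_on setT 1.
Proof.
move=> hp; pose P k := (0 < k)%N && `[< coboundary_on setT k >].
have exP : exists k, P k.
  have [k k2 ck] := hp 2 isT; exists k; apply/andP; split; last exact/asboolP.
  by case: k k2 {ck}.
case: (ex_minnP exP) => e /andP [e0 /asboolP [l l0 le]] mine.
have dvd k : coboundary_on setT k -> (e %| k)%N.
  move=> [l' l'0 l'k]; rewrite /dvdn; apply/negPn/negP => nz.
  have lt : (k %% e < e)%N by rewrite ltn_mod.
  suff : P (k %% e)%N by move/mine; rewrite leqNgt lt.
  rewrite /P lt0n nz; apply/asboolP.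
  exists (fun g => l' g / l g ^+ (k %/ e)) => [g|g h gG hG].
    by rewrite mulf_neq0 // invr_eq0 expf_neq0.
  have aE : alpha g h ^+ k = (alpha g h ^+ e) ^+ (k %/ e) * alpha g h ^+ (k %% e).
    by rewrite {1}(divn_eq k e) exprD mulnC exprM.
  rewrite -l'k // -(le g h) // aE !exprMn.
  have a0 : (alpha g h ^+ e) ^+ (k %/ e) != 0 by rewrite !expf_neq0 ?alpha_neq0.
  have g0 : l g ^+ (k %/ e) != 0 by rewrite expf_neq0.
  have h0 : l h ^+ (k %/ e) != 0 by rewrite expf_neq0.
  by field; rewrite a0 g0 h0.
have [e1|e1] := leqP e 1.
  have <- : e = 1%N by apply/eqP; rewrite eqn_leq e1.
  by exists l.
have [k pk ck] := hp _ (pdiv_prime e1).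
by case/negP: pk; apply: dvdn_trans (pdiv_dvd e) (dvd _ ck).
Qed.

(** The fibre above [g] in the central extension by nonzero scalars that [s] defines. *)
Definition over g (t : 'M[C]_n) := exists2 z, z != 0 & t = z *: s g.

Lemma overM g h t u : over g t -> over h u -> over (g * h)%g (t *m u).
Proof.
move=> [z z0 ->] [w w0 ->]; exists (z * w * alpha g h).
  by rewrite !mulf_neq0 ?alpha_neq0.
by rewrite -scalemxAl -scalemxAr s_mul !scalerA.
Qed.

Lemma overZ g t c : c != 0 -> over g t -> over g (c *: t).
Proof. by move=> c0 [z z0 ->]; exists (c * z); rewrite ?mulf_neq0 // scalerA. Qed.

Lemma over_unit g t : over g t -> t \in unitmx.
Proof. by move=> [z z0 ->]; rewrite unitmxZ ?unitfE. Qed.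

Lemma over_self g : over g (s g).
Proof. by exists 1; rewrite ?oner_eq0 // scale1r. Qed.

Lemma over_scale g t u : over g t -> over g u -> exists2 c, c != 0 & t = c *: u.
Proof.
move=> [z z0 ->] [w w0 ->]; exists (z / w); first by rewrite mulf_neq0 ?invr_eq0.
by rewrite scalerA mulfVK.
Qed.

Lemma over1 : over 1%g 1%:M.
Proof.
have := s_mul 1%g 1%g; rewrite mulg1 => E.
have E' : s 1%g = alpha 1%g 1%g *: 1%:M.
  by rewrite -[LHS](mulmxK (s_unit 1%g)) E -scalemxAl mulmxV.
exists (alpha 1%g 1%g)^-1; first by rewrite invr_eq0 alpha_neq0.
by rewrite E' scalerA mulVf ?alpha_neq0 // scale1r.
Qed.

(** A multiplicative set of lifts that reaches all of [H] and has only 1 above 1 contains a single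
    lift of each element of [H], so the extension splits over [H]. *)
Lemma coboundary_section (H : {group gT}) (T : gT -> 'M[C]_n -> Prop) :
    (forall g t, T g t -> over g t) ->
    (forall g, g \in H -> exists t, T g t) ->
    (forall g h t u, T g t -> T h u -> T (g * h)%g (t *m u)) ->
    (forall t, T 1%g t -> t = 1%:M) ->
  coboundary_on H 1.
Proof.
move=> Tover Tex TM T1.
have ex g : exists l, l != 0 /\ (g \in H -> T g (l *: s g)).
  case: (boolP (g \in H)) => [/Tex [t Tt]|_]; last by exists 1; rewrite oner_eq0.
  by have [z z0 E] := Tover _ _ Tt; exists z; rewrite -E.
have [l lP] := choice ex; exists l => [g|g h gH hH]; first by case: (lP g).
have TH g' : g' \in H -> T g' (l g' *: s g') by case: (lP g').
have ghH : (g * h)%g \in H by rewrite groupM.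
have Tgh := TM _ _ _ _ (TH g gH) (TH h hH).
have giH : ((g * h)^-1)%g \in H by rewrite groupV.
have := TM _ _ _ _ Tgh (TH _ giH); have := TM _ _ _ _ (TH _ ghH) (TH _ giH).
rewrite mulgV => /T1 E1 /T1 E2.
have : (l g *: s g) *m (l h *: s h) = l (g * h)%g *: s (g * h)%g.
  apply: (can_inj (mulmxK (over_unit (Tover _ _ (TH _ giH))))).
  by rewrite E1 E2.
rewrite -scalemxAl -scalemxAr s_mul !scalerA => /(scale_unit_inj (s_unit _)) <-.
by rewrite expr1; ring.
Qed.

End Projective.

(** * Lifting cyclic and generalized quaternion groups *)

Section ProjectiveLift.
Variables (C : numClosedFieldType) (gT : finGroupType) (n : nat) (s : gT -> 'M[C]_n.+1).
Variable alpha : gT -> gT -> C.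
Hypotheses (s_unit : forall g, s g \in unitmx)
  (s_mul : forall g h, s g *m s h = alpha g h *: s (g * h)%g).

Notation over := (over s).

Let overM g h (t u : 'M[C]_n.+1) : over g t -> over h u -> over (g * h)%g (t * u).
Proof. exact: (overM (ltn0Sn n) s_unit s_mul). Qed.

Lemma overX g t i : over g t -> over (g ^+ i)%g (t ^+ i).
Proof.
move=> gt; elim: i => [|i IH]; last by rewrite expgS exprS; apply: overM.
by rewrite expg0 expr0; apply: (over1 (ltn0Sn n) s_unit s_mul).
Qed.

Lemma over_root g t N : (0 < N)%N -> (g ^+ N = 1)%g -> over g t ->
  exists2 u, over g u & u ^+ N = 1.
Proof.
move=> N0 gN gt; have := overX N gt; rewrite gN => tN.
have o1 := over1 (ltn0Sn n) s_unit s_mul.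
have [c c0 E] := over_scale tN o1.
exists (N.-root c^-1 *: t).
  by apply: overZ gt; rewrite rootC_eq0 // invr_eq0.
by rewrite exprZn rootCK // E scalerA mulVf // scale1r.
Qed.

Lemma expg_eq1_expr (R : pzRingType) a (t : R) N i : #[a]%g = N -> t ^+ N = 1 ->
  ((a : gT) ^+ i = 1)%g -> t ^+ i = 1.
Proof.
move=> oa tN /eqP; rewrite -order_dvdn oa => /dvdnP [q ->].
by rewrite mulnC exprM tN expr1n.
Qed.

Lemma coboundary_cyclic a : coboundary_on alpha <[a]>%g 1.
Proof.
have [t at_ tN] := over_root (order_gt0 a) (expg_order a) (over_self s a).
apply: (coboundary_section (ltn0Sn n) s_unit s_mul (T := fun g u =>
  exists i, g = (a ^+ i)%g /\ u = t ^+ i)).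
- by move=> g u [i [-> ->]]; apply: overX.
- by move=> g /cycleP [i ->]; exists (t ^+ i); exists i.
- move=> g h u v [i [-> ->]] [j [-> ->]]; exists (i + j)%N.
  by rewrite expgD exprD.
move=> u [i [/esym ai ->]]; exact: expg_eq1_expr (erefl _) tN ai.
Qed.

Lemma coboundary_quaternion (H : {group gT}) a x k : (0 < k)%N ->
    #[a]%g = (2 * k)%N -> (x * a = a^-1 * x)%g -> (x * x = a ^+ k)%g ->
    x \notin <[a]>%g ->
    (forall g, g \in H -> exists i j, g = (a ^+ i * x ^+ j)%g) ->
  coboundary_on alpha H 1.
Proof.
move=> k0 oa xa xx xna Hgen; set N := (2 * k)%N in oa.
have N0 : (0 < N)%N by rewrite muln_gt0.
have aN : (a ^+ N = 1)%g by rewrite -oa expg_order.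
have ai : (a^-1 = a ^+ N.-1)%g.
  by apply: (mulgI a); rewrite mulgV -expgS prednK.
have [b ab bN] := over_root N0 aN (over_self s a).
have xb : over (x * a)%g (s x * b) := overM (over_self s x) ab.
have bx : over (x * a)%g (b ^+ N.-1 * s x).
  by rewrite xa ai; apply: overM (over_self s x); apply: overX.
have [c c0 E] := over_scale xb bx.
(* Conjugation by [s x] inverts [b] up to the scalar [c]; rescaling [b] by this root absorbs it. *)
pose m := sqrtC c^-1.
have m0 : m != 0 by rewrite sqrtC_eq0 invr_eq0.
have m2 : m * m = c^-1 by rewrite -expr2 sqrtCK.
pose t := m *: b; have at_ : over a t by apply: overZ.
have bVb : b ^+ N.-1 * b = 1 by rewrite -exprSr prednK.
have tV : t * (m^-1 *: b ^+ N.-1) = 1.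
  by rewrite -scalerAl -scalerAr scalerA mulfV // scale1r -exprS prednK.
(* conjugation by [s x] inverts [t] *)
have txt : t * s x * t = s x.
  rewrite /t -!scalerAl -scalerAr scalerA m2 -mulrA E -scalerAr scalerA mulVf //.
  by rewrite scale1r mulrA -exprS prednK // bN mul1r.
have tXxt i : t ^+ i * s x * t ^+ i = s x.
  elim: i => [|i IH]; first by rewrite !expr0 mul1r mulr1.
  rewrite {1}exprSr exprS !mulrA -(mulrA (t ^+ i) t (s x)).
  by rewrite -(mulrA (t ^+ i) (t * s x) t) txt.
have [d d0 xxE] := over_scale (overM (over_self s x) (over_self s x))
   (eq_ind_r (fun g => over g _) (overX k at_) xx).
(* [s x] commutes with its square, a multiple of [t ^+ k]. As it also inverts [t ^+ k], the power
   [t ^+ N] is 1. *)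
have xtk : s x * t ^+ k = t ^+ k * s x.
  have E2 : s x * (s x * s x) = s x * s x * s x by rewrite mulrA.
  by move: E2; rewrite xxE -scalerAr -scalerAl => /(scalerI d0).
have t2k : t ^+ N = 1.
  have ux : s x \is a GRing.unit by apply: s_unit.
  apply: (mulIr ux); rewrite mul1r -[RHS](tXxt k) -mulrA xtk mulrA -exprD.
  by rewrite addnn -mul2n.
pose y := sqrtC d^-1 *: s x.
have yx : over x y by apply: overZ (over_self s x); rewrite sqrtC_eq0 invr_eq0.
have yy : y * y = t ^+ k.
  by rewrite -scalerAl -scalerAr scalerA -expr2 sqrtCK xxE scalerA mulVf // scale1r.
have yt i : y * t ^+ i = t ^+ (N.-1 * i) * y.
  have tt : t ^+ (N.-1 * i) * t ^+ i = 1.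
    by rewrite -exprD -{2}[i]mul1n -mulnDl addn1 prednK // exprM t2k expr1n.
  rewrite /y -scalerAl -scalerAr; congr (_ *: _).
  by rewrite -{2}(tXxt i) !mulrA tt mul1r.
have xat i : (x * a ^+ i = a ^+ (N.-1 * i) * x)%g.
  rewrite expgM -ai; elim: i => [|i IH]; first by rewrite !expg0 mulg1 mul1g.
  by rewrite !expgSr mulgA IH -!mulgA xa.
have shift j i : exists k', (x ^+ j * a ^+ i = a ^+ k' * x ^+ j)%g /\
    y ^+ j * t ^+ i = t ^+ k' * y ^+ j.
  elim: j i => [|j IH] i; first by exists i; rewrite !expg0 !expr0 !mulg1 !mul1g mulr1 mul1r.
  have [k1 [E1 E2]] := IH (N.-1 * i)%N; exists k1.
  rewrite !expgSr !exprSr -mulgA xat mulgA E1 -mulrA yt mulrA E2.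
  by rewrite mulgA mulrA.
apply: (coboundary_section (ltn0Sn n) s_unit s_mul (T := fun g u =>
  exists i j, g = (a ^+ i * x ^+ j)%g /\ u = t ^+ i * y ^+ j)).
- by move=> g u [i [j [-> ->]]]; apply: overM; apply: overX.
- by move=> g /Hgen [i [j ->]]; exists (t ^+ i * y ^+ j), i, j.
- move=> g h u v [i [j [-> ->]]] [i' [j' [-> ->]]].
  have [k' [E1 E2]] := shift j i'; exists (i + k')%N, (j + j')%N; split.
    by rewrite expgD expgD -!mulgA [(x ^+ j * (_ * _))%g]mulgA E1 !mulgA.
  rewrite -[LHS]/(t ^+ i * y ^+ j * (t ^+ i' * y ^+ j')).
  by rewrite !exprD -!mulrA [y ^+ j * (_ * _)]mulrA E2 !mulrA.
move=> u [i [j [/esym ax ->]]].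
(* [x] lies outside [<[a]>], so a trivial product has even [j] and reduces to a power of [a]
   alone. *)
have [q jE] : exists q, j = (2 * q)%N.
  exists j./2; apply/eqP; rewrite -{1}[j]odd_double_half -mul2n.
  case jo : (odd j); last by rewrite add0n.
  case/negP: xna; have : (x ^+ j)%g \in <[a]>%g.
    have -> : (x ^+ j = (a ^+ i)^-1)%g by apply/esym/eqP; rewrite eq_invg_mul ax.
    by rewrite groupV mem_cycle.
  rewrite -(odd_double_half j) jo add1n expgS -mul2n expgM.
  by rewrite groupMr // expgS expg1 xx groupX // mem_cycle.
move: ax; rewrite jE !expgM !exprM [(x ^+ 2)%g]expgS expg1 xx.
rewrite [y ^+ 2]expr2 yy -expgM -expgD -exprM -exprD.
exact: expg_eq1_expr oa t2k.
Qed.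

End ProjectiveLift.

(** * Abelian subgroups and Sylow subgroups in $SU(2)$ *)

Section SU2Subgroups.
Variables (C : numClosedFieldType) (gT : finGroupType).
Notation G := [set: gT]%G.
Notation reprG := (mx_representation C G).
Variable V : reprG 2.
Hypotheses (V_unitary : forall g, V g \is unitarymx) (V_det : forall g, \det (V g) = 1)
  (V_inj : forall g, V g = 1%:M -> g = 1%g).

Let VM g h : V (g * h)%g = V g *m V h.
Proof. by rewrite repr_mxM ?in_setT. Qed.

Let V1 : V 1%g = 1%:M.
Proof. exact: repr_mx1. Qed.

Lemma repr_injective : injective V.
Proof.
move=> g h gh; apply: (mulIg h^-1%g); rewrite mulgV; apply: V_inj.
by rewrite VM gh -VM mulgV V1.
Qed.

Lemma det_sub1 g : \det (V g - 1%:M) = 2%:R - \tr (V g).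
Proof.
rewrite det_mx2 mxtrace2 !mxE /= mulr1n mulr0n !subr0.
have := V_det g; rewrite det_mx2 => D.
move: D; move: (V g 0 0) (V g 0 1) (V g 1 0) (V g 1 1) => a b c d D.
transitivity (a * d - b * c + 1 - (a + d)); first by ring.
by rewrite D; ring.
Qed.

Lemma det_sub1_eq0 g : \det (V g - 1%:M) = 0 -> g = 1%g.
Proof.
rewrite det_sub1 => /eqP; rewrite subr_eq0 => /eqP E.
exact: (trace_eq2 V_unitary V_inj (esym E)).
Qed.

Lemma fixed_vector g (u : 'rV[C]_2) : u != 0 -> u *m V g = u -> g = 1%g.
Proof.
move=> u0 ug; apply: det_sub1_eq0; apply/eqP/det0P; exists u => //.
by rewrite mulmxBr mulmx1 ug subrr.
Qed.

(** Only the identity fixes a nonzero vector, so any simple submodule is faithful; an abelian group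
    with a faithful irreducible representation is cyclic. *)
Lemma abelian_subgroup_cyclic (B : {group gT}) : abelian B -> cyclic B.
Proof.
move=> abB; pose rB := subg_repr V (subsetT B).
have [U simU _] := dec_mxsimple_exists (mxmodule1 rB) (matrix_nonzero1 _ _).
have modU := mxsimple_module simU.
have irrU : mx_irreducible (submod_repr modU) by apply/submod_mx_irr.
apply: mx_faithful_irr_abelian_cyclic irrU abB.
rewrite /mx_faithful rker_submod; apply/subsetP => g; rewrite inE => /andP [gB /eqP Ug].
rewrite inE; apply/eqP/(@fixed_vector g (nz_row U)).
  by rewrite nz_row_eq0; case: simU.
rewrite /nz_row; case: pickP => [i _|_]; last by rewrite mul0mx.
by rewrite -row_mul -[V g]/(rB g) Ug.
Qed.

(* [V b + V b^-1] and [V a + V a^-1] are the same scalar, so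
   [(V a - V b) (V a - V b^-1) = 0]; one factor is [0] when the other is
   invertible. *)
Lemma commuting_same_trace (a b : gT) : commute a b -> \tr (V a) = \tr (V b) ->
  b = a \/ b = (a^-1)%g.
Proof.
move=> ab tab; have [->|ne] := eqVneq b a; [by left | right].
have ca := repr_add_inv V_det a; have cb := repr_add_inv V_det b.
have Vab : V a *m V b = V b *m V a by rewrite -!VM ab.
have Z : (V a - V b) *m (V a - V (b^-1)%g) = 0.
  have -> : V (b^-1)%g = (\tr (V b))%:M - V b by rewrite -cb addrC addKr.
  have Vaa : V a *m V a = \tr (V a) *: V a - 1%:M.
    have -> : (1%:M : 'M[C]_2) = V a *m V (a^-1)%g by rewrite -VM mulgV V1.
    by rewrite -[\tr _ *: _]mul_mx_scalar -ca mulmxDr addrK.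
  have Vbb : V b *m V b = \tr (V b) *: V b - 1%:M.
    have -> : (1%:M : 'M[C]_2) = V b *m V (b^-1)%g by rewrite -VM mulgV V1.
    by rewrite -[\tr _ *: _]mul_mx_scalar -cb mulmxDr addrK.
  rewrite mulmxBl !mulmxBr Vaa Vbb !mul_mx_scalar Vab tab.
  move: (_ *: V a) (_ *: V b) (V b *m V a) (1%:M) => p q r t.
  by rewrite subKr opprB [p - t + _]addrC addrA subrK subrr.
have E : V a - V b = V b *m (V (b^-1 * a)%g - 1%:M).
  by rewrite mulmxBr mulmx1 -VM mulKVg.
have u1 : V a - V b \in unitmx.
  rewrite E unitmx_mul repr_mx_unit ?in_setT //= unitmxE unitfE.
  apply: contra ne => /eqP /det_sub1_eq0 /eqP.
  by rewrite -eq_invg_mul invgK.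
have := congr1 (mulmx (invmx (V a - V b))) Z; rewrite mulKmx // mulmx0.
by move=> /eqP; rewrite subr_eq0 => /eqP /repr_injective ->; rewrite invgK.
Qed.

(** If [g] is its own inverse, [V g + V g^-1] being scalar makes [V g] scalar. *)
Lemma involution_central (g h : gT) : (g * g = 1)%g -> commute g h.
Proof.
move=> gg; have gi : (g^-1 = g)%g by apply/eqP; rewrite eq_invg_mul gg.
have := repr_add_inv V_det g; rewrite gi -mulr2n => E.
apply: repr_injective; rewrite !VM.
suff -> : V g = (2^-1 * \tr (V g))%:M by rewrite scalar_mxC.
have n2 : (2%:R : C) != 0 by rewrite pnatr_eq0.
by rewrite -scale_scalar_mx -E -scaler_nat scalerA mulVf // scale1r.
Qed.

Section Lift.
Variables (n : nat) (s : gT -> 'M[C]_n.+1) (alpha : gT -> gT -> C).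
Hypotheses (s_unit : forall g, s g \in unitmx)
  (s_mul : forall g h, s g *m s h = alpha g h *: s (g * h)%g).

(* A [p]-subgroup of [SU(2)] is cyclic or generalized quaternion. *)
Lemma coboundary_pgroup (p : nat) (P : {group gT}) : (p.-group P)%g ->
  coboundary_on alpha P 1.
Proof.
move=> pP.
(* In a [p]-group a maximal normal abelian subgroup is its own centralizer. *)
have [B maxB _] : {B : {group gT} | maxgroup B (fun H : {group gT} => (H <| P)%g && abelian H) & (1%G : {group gT}) \subset B}.
  by apply: maxgroup_exists; rewrite normal1 abelian1.
have SB := max_SCN pP maxB; have [nBP cB] := SCN_P SB.
have /cyclicP [a Ba] := abelian_subgroup_cyclic (SCN_abelian SB).
have [PB|] := boolP (P \subset B).
  have -> : P :=: <[a]>%g by rewrite -Ba; apply/eqP; rewrite eqEsubset PB normal_sub.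
  exact: coboundary_cyclic.
case/subsetPn => x xP xB.
have aB : a \in B by rewrite Ba cycle_id.
have centB y : y \in P -> commute y a -> y \in B.
  by move=> yP ya; rewrite -cB inE yP Ba cent_cycle; apply/cent1P.
(* Conjugation preserves the trace, so it fixes or inverts [a]; what fixes [a] lies in [B]. *)
have inv y : y \in P -> y \notin B -> (a ^ y = a^-1)%g.
  move=> yP yB; have ayB : (a ^ y)%g \in B by rewrite memJ_norm // (subsetP (normal_norm nBP)).
  have cay : commute a (a ^ y)%g by apply: (centsP (SCN_abelian SB)).
  have trE : \tr (V a) = \tr (V (a ^ y)%g).
    by rewrite conjgE VM mxtrace_mulC VM -mulmxA -VM mulgV V1 mulmx1.
  have [ay|//] := commuting_same_trace cay trE.
  by case/negP: yB; apply: centB => //; apply/commute_sym/commgP/conjg_fixP.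
have xa : (x * a = a^-1 * x)%g.
  have : ((a^-1) ^ x = a)%g by rewrite conjVg inv // invgK.
  by rewrite conjgE => {1}<-; rewrite mulKVg.
have nxB : (x^-1)%g \notin B by rewrite groupV.
have centB' y : y \in P -> (a ^ y = a)%g -> y \in B.
  by move=> yP ay; apply: centB => //; apply/commute_sym/commgP/conjg_fixP.
have xxB : (x * x)%g \in B.
  by apply: centB'; rewrite ?groupM // conjgM inv // conjVg inv // invgK.
have := xxB; rewrite Ba => /cyclePmin [k kN xx].
have k0 : (0 < k)%N.
  rewrite lt0n; apply: contraNneq xB => k0; rewrite k0 expg0 in xx.
  apply: centB => //; exact: involution_central.
(* [a ^+ k = x * x] is both fixed and inverted by [x], so [a ^+ (2 * k) = 1], while [0 < k <
   #[a]]. *)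
have oa : #[a]%g = (2 * k)%N.
  have : (a ^+ (2 * k) = 1)%g.
    have : ((a ^+ k) ^ x = a ^+ k)%g by rewrite -xx conjgE -mulgA mulKg.
    rewrite conjXg inv // expVgn => E.
    by rewrite mul2n -addnn expgD -{1}E mulVg.
  move/eqP; rewrite -order_dvdn => /dvdnP [[|[|q]]]; [lia | lia | nia].
apply: (coboundary_quaternion s_unit s_mul k0 oa xa xx); first by rewrite -Ba.
move=> g gP; have [gB|gB] := boolP (g \in B).
  move: gB; rewrite Ba => /cycleP [i ->]; exists i, 0%N.
  by rewrite expg0 mulg1.
have : (g * x^-1)%g \in B.
  apply: centB'; first by rewrite groupM // groupV.
  by rewrite conjgM inv // conjVg inv ?groupV // invgK.
rewrite Ba => /cycleP [i E]; exists i, 1%N.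
by rewrite expg1 -E mulgKV.
Qed.

Lemma coboundary_SU2 : coboundary_on alpha setT 1.
Proof.
apply: (coboundary_coprime (ltn0Sn n) s_unit s_mul) => p pr.
have [P sylP] := Sylow_exists p G.
exists #|[set: gT] : P|%g.
  by rewrite -p'natE //; case/and3P: sylP.
apply: (coboundary_transfer (ltn0Sn n) s_unit s_mul).
exact: coboundary_pgroup (pHall_pgroup sylP).
Qed.
End Lift.

End SU2Subgroups.

(** * Unitary lifts of projective representations *)

Section ProjectiveLifting.
Variables (C : numClosedFieldType) (gT : finGroupType).
Notation G := [set: gT]%G.
Notation reprG := (mx_representation C G).
Variable V : reprG 2.
Hypotheses (V_unitary : forall g, V g \is unitarymx) (V_det : forall g, \det (V g) = 1)
  (V_inj : forall g, V g = 1%:M -> g = 1%g).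

Lemma is_lin_norm (l : gT -> C) g : is_lin l -> `|l g| = 1.
Proof.
move=> [l1 lM]; have lX k : l (g ^+ k)%g = l g ^+ k.
  by elim: k => [|k IH]; rewrite ?expg0 ?expr0 // expgS exprS lM IH.
apply/eqP; rewrite -(@pexpr_eq1 _ _ #[g]%g) ?order_gt0 // -normrX -lX.
by rewrite expg_order l1 normr1.
Qed.

Lemma det_unitary_norm n (A : 'M[C]_n) : A \is unitarymx -> `|\det A| = 1.
Proof.
move/unitarymxP => /(congr1 determinant); rewrite det_mulmx det_map_mx det_tr det1.
by rewrite -normCK => /eqP; rewrite pexpr_eq1 // => /eqP.
Qed.

Lemma projective_lift n (s : gT -> 'M[C]_n) : (0 < n)%N ->
    (forall g, s g \is unitarymx) ->
    (forall g h, exists z, s g *m s h = z *: s (g * h)%g) ->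
  exists f : reprG n, (forall g, f g \is unitarymx) /\
    forall g, exists z, `|z| = 1 /\ f g = z *: s g.
Proof.
case: n s => // n s _ su sm.
have s_unit g : s g \in unitmx := unitarymx_unit (su g).
have [al alE] := choice (fun p : gT * gT => sm p.1 p.2).
have s_mul g h : s g *m s h = al (g, h) *: s (g * h)%g by exact: (alE (g, h)).
have [l l0 lM] := coboundary_SU2 V_unitary V_det V_inj s_unit s_mul.
have mul g h : (l g *: s g) *m (l h *: s h) = l (g * h)%g *: s (g * h)%g.
  rewrite -scalemxAl -scalemxAr s_mul !scalerA -lM ?in_setT // expr1.
  by congr (_ *: _); ring.
have frepr : mx_repr G (fun g => l g *: s g).
  split=> [|g h _ _]; last by rewrite mul.
  have u1 : l 1%g *: s 1%g \in unitmx by rewrite unitmxZ ?unitfE.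
  by have := mul 1%g 1%g; rewrite mulg1 => /(congr1 (mulmx (invmx (l 1%g *: s 1%g))));
    rewrite mulKmx // mulVmx.
pose f := MxRepresentation frepr.
(* The determinants of [f g] and of [s g] both have modulus 1, hence so does a power of [l g]. *)
have ln g : `|l g| = 1.
  have := is_lin_norm g (det_lin_char f); rewrite /= detZ normrM normrX.
  by rewrite (det_unitary_norm (su g)) mulr1 => /eqP; rewrite pexpr_eq1 // => /eqP.
exists f; split=> g; last by exists (l g).
apply/unitarymxP; rewrite /= linearZ /= map_mxZ -scalemxAl -scalemxAr scalerA.
by rewrite -normCK ln expr1n scale1r; apply/unitarymxP.
Qed.

End ProjectiveLifting.

(** * Classes of homomorphisms *)

From mathcomp Require Import generic_quotient finmap complex.
From mathcomp Require Import classical_sets cardinality reals.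

Section Multiplicities.
Variables (C : numClosedFieldType) (gT : finGroupType).
Notation G := [set: gT]%G.
Notation reprG := (mx_representation C G).
Notation iG := (DecSocleType (regular_repr C G) : irrType C G).
Notation psi := (@psi C gT).
Notation A := (lin_group C gT).
Notation o := (irr0 C gT).
Notation mults n := (mult_set (fun i : iG => irr_degree i) n).
Variable n : nat.
Implicit Types (r : reprG n) (m : {ffun iG -> 'I_n.+1}).

Definition mult r : {ffun iG -> 'I_n.+1} := projT1 (cid (mult_exists r)).

Lemma mult_in r : mult r \in mults n.
Proof. by rewrite /mult; case: cid => m []. Qed.

Lemma mult_trace r g : \tr (r g) = \sum_i psi i g *+ mult r i.
Proof. by rewrite /mult; case: cid => m []. Qed.

Lemma mult_det r g : \det (r g) = \prod_i \det (irr_repr i g) ^+ mult r i.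
Proof. by rewrite /mult; case: cid => m []. Qed.

Lemma multP r m : (forall g, \tr (r g) = \sum_i psi i g *+ m i) -> mult r = m.
Proof. by move=> E; apply: mult_inj => g; rewrite -mult_trace E. Qed.

Lemma mult_eq r r' : mult r = mult r' <-> forall g, \tr (r g) = \tr (r' g).
Proof.
split=> [E g|E]; first by rewrite !mult_trace E.
by apply: multP => g; rewrite E mult_trace.
Qed.

Lemma det_mult_eq1 m : det_mult (@det_perm C gT) m = 1%g <->
  forall g, \prod_i \det (irr_repr i g) ^+ m i = 1.
Proof.
have E g : psi (det_mult (@det_perm C gT) m o) g = \prod_i \det (irr_repr i g) ^+ m i.
  rewrite lin_group_prod => [|i _]; last by rewrite groupX // det_perm_in.
  by apply: eq_bigr => i _; rewrite lin_groupX ?det_perm_in // det_permE.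
have inA : det_mult (@det_perm C gT) m \in A.
  by apply: group_prod => i _; rewrite groupX // det_perm_in.
split=> [D g|D]; first by rewrite -E D perm1 psi_irr0.
apply: lin_group_inj; rewrite ?group1 // => g.
by rewrite E D perm1 psi_irr0.
Qed.

Lemma mult_twist r r' (a : {perm iG}) : a \in A ->
  mult r' = mult_perm (mult r) a <->
  forall g, \tr (r' g) = psi (a o) g * \tr (r g).
Proof.
move=> aA.
have E g : psi (a o) g * \tr (r g) = \sum_i psi i g *+ mult_perm (mult r) a i.
  rewrite mult_trace mulr_sumr [RHS](reindex_inj (@perm_inj _ a)) /=.
  by apply: eq_bigr => i _; rewrite mulrnAr -lin_groupE // ffunE permK.
split=> [D g|D]; first by rewrite E -D mult_trace.
by apply: multP => g; rewrite D E.
Qed.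

Lemma mult_orbit r r' : orbit (mult_action iG n) A (mult r) =
    orbit (mult_action iG n) A (mult r') <->
  exists2 l, is_lin l & forall g, \tr (r' g) = l g * \tr (r g).
Proof.
split=> [E|[l ll E]].
  have : mult r' \in orbit (mult_action iG n) A (mult r) by rewrite E orbit_refl.
  case/orbitP => a aA /esym /(mult_twist _ _ aA) D.
  by exists (psi (a o)) => //; apply: lin_group_lin.
apply/eqP; rewrite eq_sym; apply/eqP/orbit_eqP/orbitP.
exists (twist l); first exact: twist_in.
by apply/esym/(mult_twist _ _ (twist_in ll)) => g; rewrite twist_irr0.
Qed.

End Multiplicities.

(** [phi] is a complete invariant, so the classes are its fibres. Finiteness is stated as well
    because [fset_set] of an infinite set is empty. *)
Lemma class_count (T : Type) (K : finType) (E : T -> T -> Prop) (phi : T -> K)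
    (K0 : {set K}) : (forall f f', E f f' <-> phi f = phi f') ->
    (forall k, k \in K0 <-> exists f, phi f = k) ->
  let D := range (fun f => [set f' | E f f']%classic) in
  finite_set D /\ #|` fset_set D|%fset = #|K0|.
Proof.
move=> EP K0P D; pose g k := [set f' | phi f' = k]%classic.
have DE : D = [set` [fset g k | k in K0]%fset]%classic.
  apply/seteqP; split=> X /=.
    move=> [f _ <-]; apply/imfsetP; exists (phi f); first by apply/K0P; exists f.
    by apply/seteqP; split=> f' /=; [move/EP | move=> h; apply/EP].
  move=> /imfsetP [k /= /K0P [f <-] ->]; exists f => //.
  by apply/seteqP; split=> f' /=; [move/EP | move=> h; apply/EP].
rewrite DE; split; first exact: finite_fset.
rewrite set_fsetK card_in_imfset /= -?cardE // => k k' /K0P [f fk] _ gk.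
by have : g k f by []; rewrite gk => <-.
Qed.

Section FiniteCopy.
Variables (T : groupType) (fT : finite_set [set: T]).

(** The proof of finiteness is a parameter of the copy, so that the finite group structure can be
    attached to the type. *)
Definition fin_copy of finite_set [set: T] := T : Type.
Notation F := (fin_copy fT).
HB.instance Definition _ := Choice.on F.
HB.instance Definition _ := Group.on F.

Let e : seq T := enum_fset (fset_set [set: T]).
Let e_all x : x \in e.
Proof. by have := in_fset_set fT x; rewrite in_setT. Qed.

Let index_eK : pcancel (fun x : F => index (x : T) e)
  (fun k => if (k < size e)%N then Some (nth (1%g : T) e k : F) else None).
Proof. by move=> x; rewrite index_mem e_all nth_index. Qed.

HB.instance Definition _ := isCountable.Build F index_eK.

Let fin_copy_axiom : Finite.axiom (e : seq F).
Proof. by apply: Finite.uniq_enumP; [exact: fset_uniq | move=> x; rewrite e_all]. Qed.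
HB.instance Definition _ := isFinite.Build F fin_copy_axiom.
HB.instance Definition _ := Finite.on F.
End FiniteCopy.

Local Open Scope complex_scope.
Local Open Scope quotient_scope.

Lemma multiplicative1 (G H : groupType) (f : {multiplicative G -> H}) : f 1%g = 1%g.
Proof. by apply: (mulgI (f 1%g)); rewrite -gmulfM !mulg1. Qed.

Section HomClasses.
Variables (R : realType) (n : nat).
Hypothesis n_gt0 : (0 < n)%N.
Variables (T : groupType) (fT : finite_set [set: T]%classic).
Notation C := R[i].
Notation gT := (fin_copy fT).
Notation G := [set: gT]%G.
Notation reprG := (mx_representation C G).
Notation iG := (DecSocleType (regular_repr C G) : irrType C G).
Notation A := (lin_group C gT).
Notation mults := (mult_set (fun i : iG => irr_degree i) n).

Lemma SU_mx_repr (f : {multiplicative T -> SU R n}) :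
  mx_repr G (fun g : gT => val (val (f g)) : 'M[C]_n).
Proof.
have f1 : f (1%g : T) = 1%g by apply: multiplicative1.
have fM (g h : T) : f (g * h)%g = (f g * f h)%g by apply: gmulfM.
split=> [|g h _ _]; first exact: (congr1 (fun x => val (val x)) f1).
exact: (congr1 (fun x => val (val x)) (fM g h)).
Qed.
Definition SU_repr f := MxRepresentation (SU_mx_repr f).

Lemma SU_repr_unitary f g : SU_repr f g \is unitarymx.
Proof. exact: valP (val (f g)). Qed.

Lemma SU_repr_det f g : \det (SU_repr f g) = 1.
Proof. exact/eqP/(valP (f g)). Qed.

Definition SU_mult f := mult (SU_repr f).

Lemma multiplicative_of_repr (H : groupType) (h : T -> H) :
  (forall x y, h (x * y)%g = (h x * h y)%g) -> exists f : {multiplicative T -> H}, f =1 h.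
Proof.
move=> hM; pose f : {multiplicative T -> H} := HB.pack h (isMultiplicative.Build T H h hM).
by exists f.
Qed.

Lemma scale_unitary (c : C) (X : 'M[C]_n) : `|c| = 1 -> X \is unitarymx ->
  c *: X \is unitarymx.
Proof.
move=> c1 /unitarymxP uX; apply/unitarymxP.
by rewrite linearZ /= map_mxZ -scalemxAl -scalemxAr scalerA -normCK c1 expr1n scale1r.
Qed.

Lemma special_scalar (X : 'M[C]_n) : X \is unitarymx ->
  exists c : C, `|c| = 1 /\ \det (c *: X) = 1.
Proof.
move=> uX; have dX := det_unitary_norm uX; exists (n.-root (\det X)^-1).
rewrite detZ rootCK // mulVf; last by rewrite -normr_eq0 dX oner_eq0.
by split=> //; rewrite norm_rootC normfV dX invr1 rootC1.
Qed.

(** Equal traces give a unitary intertwiner; a scalar factor brings its determinant to 1 without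
    changing the conjugation. *)
Lemma SU_conj_hom f f' : conj_hom f f' <-> SU_mult f = SU_mult f'.
Proof.
rewrite mult_eq; split=> [[c cE] g|E].
  rewrite /= (cE g) /= mxtrace_mulC mulmxA.
  have /unitarymxP/mulmx1C -> : val (val c) \is unitarymx := valP (val c).
  by rewrite mul1mx.
have [X uX XE] := unitary_rsim (SU_repr_unitary f') (SU_repr_unitary f)
  (rsim_trace (fun g => esym (E g))).
have [c [c1 dcX]] := special_scalar uX.
have ucX := scale_unitary c1 uX.
pose u : U R n := Sub (c *: X) ucX.
have su : u \in @Defs.special R n by rewrite inE /= dcX.
pose v : SU R n := Sub u su.
exists v => x; apply: (mulIg v); rewrite mulgKV; apply/val_inj/val_inj => /=.
by have := XE x; rewrite -scalemxAl -scalemxAr => /= ->.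
Qed.

Lemma SU_mult_surj m :
  m \in [set m in mults | det_mult (@det_perm C gT) m == 1%g] <->
  exists f, SU_mult f = m.
Proof.
rewrite inE; split=> [/andP [mn /eqP /det_mult_eq1 dm]|[f <-]]; last first.
  rewrite mult_in; apply/eqP/det_mult_eq1 => g.
  by rewrite -mult_det SU_repr_det.
have [r [ur rE]] := repr_of_mult mn.
have rm := multP rE.
have sr (g : T) : (Sub (r g) (ur g) : U R n) \in @Defs.special R n.
  by rewrite inE /= mult_det rm dm.
have [|f fE] := @multiplicative_of_repr (SU R n) (fun g => Sub (Sub (r g) (ur g) : U R n) (sr g) : SU R n).
  by move=> x y; apply/val_inj/val_inj => /=; rewrite -repr_mxM ?in_setT.
exists f; apply: multP => g; rewrite -rE /=; congr (\tr _).
by rewrite fE.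
Qed.

Section PUClasses.
Variable V : mx_representation C G 2.
Hypotheses (V_unitary : forall g, V g \is unitarymx) (V_det : forall g, \det (V g) = 1)
  (V_inj : forall g, V g = 1%:M -> g = 1%g).

Definition PU_lifts (f : T -> PU R n) (r : reprG n) :=
  forall g : gT, exists u : U R n, \pi_(PU R n) u = f g /\ r g = val u.

Lemma PU_lift_exists (f : {multiplicative T -> PU R n}) : exists r, PU_lifts f r.
Proof.
pose s (g : gT) : 'M[C]_n := val (repr (f g) : U R n).
have su g : s g \is unitarymx by apply: valP.
have [|r [ur rs]] := @projective_lift C gT V V_unitary V_det V_inj n s n_gt0 su.
  move=> g h.
  have : \pi_(PU R n) (U_mul (repr (f g)) (repr (f h))) = \pi_(PU R n) (repr (f (g * h)%g)).
    by rewrite pi_PU_mul !reprK -[RHS]/(f ((g : T) * h)%g) gmulfM.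
  by move/eqmodP/asboolP => [z [_ E]]; exists z; rewrite /s -E.
exists r => g; exists (Sub (r g) (ur g)); split=> //.
rewrite -[RHS]reprK; apply/eqmodP/asboolP.
by have [z [z1 E]] := rs g; exists z.
Qed.

Definition PU_repr (f : {multiplicative T -> PU R n}) := projT1 (cid (PU_lift_exists f)).
Lemma PU_reprE (f : {multiplicative T -> PU R n}) : PU_lifts f (PU_repr f).
Proof. by rewrite /PU_repr; case: cid. Qed.

Lemma PU_lifts_unitary f r g : PU_lifts f r -> r g \is unitarymx.
Proof. by move=> /(_ g) [u [_ ->]]; apply: valP. Qed.

Definition PU_orbit (f : {multiplicative T -> PU R n}) := orbit (mult_action iG n) A (mult (PU_repr f)).

Lemma unitary_nonzero_scale (X : 'M[C]_n) z w : X \is unitarymx ->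
  z *: X = w *: X -> z = w.
Proof. by move/unitarymx_unit; apply: scale_unit_inj. Qed.

Lemma projective_twist (r r' : reprG n) (X : 'M[C]_n) : X \is unitarymx ->
    (forall g, r g \is unitarymx) ->
    (forall g, exists z, r' g *m X = z *: (X *m r g)) ->
  exists2 l, is_lin l & forall g, r' g *m X = l g *: (X *m r g).
Proof.
move=> uX ur h; have [l lE] := choice h; exists l => //; split=> [|g g'].
  apply: (@unitary_nonzero_scale X) => //.
  by have := lE 1%g; rewrite !repr_mx1 mul1mx mulmx1 scale1r => <-.
apply: (@unitary_nonzero_scale (X *m r (g * g')%g)).
  exact: mul_unitarymx uX (ur _).
rewrite -lE !repr_mxM ?in_setT // -mulmxA lE -scalemxAr mulmxA lE -scalemxAl scalerA.
by rewrite mulrC mulmxA.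
Qed.

(** A conjugation in $PU(n)$ conjugates the lifts up to scalars, which form a linear character.
    Arbitrary lifts are allowed so that a given representation can be compared with the chosen
    [PU_repr]. *)
Lemma PU_conj_hom_lifts (f f' : {multiplicative T -> PU R n}) r r' :
    PU_lifts f r -> PU_lifts f' r' ->
  conj_hom f f' <-> orbit (mult_action iG n) A (mult r) = orbit (mult_action iG n) A (mult r').
Proof.
move=> fr fr'; rewrite mult_orbit; split=> [[c cE]|[l ll E]].
  pose X : U R n := repr c; have uX : val X \is unitarymx := valP X.
  have ur g := PU_lifts_unitary g fr.
  have [|l ll lE] := @projective_twist r r' (val X) uX ur.
    move=> g; have [u [uf ->]] := fr g; have [u' [uf' ->]] := fr' g.
    have : \pi_(PU R n) (U_mul u' X) = \pi_(PU R n) (U_mul X u).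
      rewrite !pi_PU_mul uf uf' /X reprK.
      by rewrite -[LHS]/(f' g * c)%g -[RHS]/(c * f g)%g cE mulgKV.
    by move/eqmodP/asboolP => [z [_ E]]; exists z.
  exists l => // g.
  have -> : r' g = l g *: (val X *m r g *m (val X)^t*).
    by rewrite scalemxAl -lE -mulmxA; move/unitarymxP: uX => ->; rewrite mulmx1.
  rewrite linearZ /= mxtrace_mulC mulmxA.
  by move/unitarymxP/mulmx1C: uX => ->; rewrite mul1mx.
pose rl := MxRepresentation (scale_mx_repr r ll).
have url g : rl g \is unitarymx.
  by apply: scale_unitary (PU_lifts_unitary g fr); apply: is_lin_norm.
have [|X uX XE] := unitary_rsim (fun g => PU_lifts_unitary g fr') url.
  by apply: rsim_trace => g; rewrite E /= linearZ.
pose x : U R n := Sub X uX; exists (\pi_(PU R n) x) => g.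
apply: (mulIg (\pi_(PU R n) x)); rewrite mulgKV.
have [u [<- ru]] := fr g; have [u' [<- ru']] := fr' g.
rewrite -[LHS]/(PU_mul (\pi_(PU R n) u') (\pi_(PU R n) x)).
rewrite -[RHS]/(PU_mul (\pi_(PU R n) x) (\pi_(PU R n) u)) -!pi_PU_mul.
apply/eqmodP/asboolP; exists (l g); split; first exact: (is_lin_norm (g : gT) ll).
by have := XE g; rewrite ru' /= ru -scalemxAr.
Qed.

Lemma PU_conj_hom (f f' : {multiplicative T -> PU R n}) : conj_hom f f' <-> PU_orbit f = PU_orbit f'.
Proof. exact: PU_conj_hom_lifts (PU_reprE f) (PU_reprE f'). Qed.

Lemma PU_orbit_surj (O : {set {ffun iG -> 'I_n.+1}}) :
  O \in [set orbit (mult_action iG n) A m | m in mults] <->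
  exists f, PU_orbit f = O.
Proof.
split=> [/imsetP [m mn ->]|[f <-]]; last by apply: imset_f; exact: mult_in.
have [r [ur rE]] := repr_of_mult mn.
have [|f fE] := @multiplicative_of_repr (PU R n) (fun g => \pi_(PU R n) (Sub (r g) (ur g) : U R n)).
  move=> x y; rewrite -[RHS]/(PU_mul _ _) -pi_PU_mul; congr (\pi_(PU R n) _).
  by apply: val_inj; rewrite /= -repr_mxM ?in_setT.
have fr : PU_lifts f r by move=> g; exists (Sub (r g) (ur g)); rewrite fE.
exists f; rewrite -(multP rE); apply: (PU_conj_hom_lifts (PU_reprE f) fr).1.
by exists 1%g => x; rewrite mul1g invg1 mulg1.
Qed.

Theorem hom_classes_count :
  [/\ finite_set (hom_classes T (SU R n)), finite_set (hom_classes T (PU R n)) &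
      num_hom_classes T (SU R n) = num_hom_classes T (PU R n)].
Proof.
have [fS cS] := class_count SU_conj_hom SU_mult_surj.
have [fP cP] := class_count PU_conj_hom PU_orbit_surj.
split=> //; rewrite /num_hom_classes /hom_classes cS cP.
exact: (mckay_count V_unitary V_det V_inj).
Qed.

End PUClasses.
End HomClasses.

Local Open Scope classical_set_scope.

Lemma finite_subgroup (G : groupType) (S : groupClosed G) :
  finite_set [set x | x \in S] -> finite_set [set: subgroup S].
Proof.
move=> fS; apply: (@sub_finite_set _ _ (val @^-1` [set x | x \in S])).
  by move=> x _; exact: (valP x).
by apply: finite_preimage fS => x y _ _; apply: val_inj.
Qed.

Theorem theorem3p17 (R : realType) (n : nat) (hn : (0 < n)%N)
    (Gam : groupClosed (SU R 2)) (finGam : finite_set [set A | A \in Gam]) :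
  [/\ finite_set (hom_classes (subgroup Gam) (SU R n)),
      finite_set (hom_classes (subgroup Gam) (PU R n)) &
      num_hom_classes (subgroup Gam) (SU R n)
        = num_hom_classes (subgroup Gam) (PU R n)].
Proof.
have fT := finite_subgroup finGam.
(* The inclusion of [Gam] is the faithful two-dimensional representation behind the McKay graph. *)
have [i iE] := @multiplicative_of_repr (subgroup Gam) (SU R 2)
  (fun g => val g) (fun g h => erefl).
apply: (@hom_classes_count R n hn _ fT (SU_repr fT i)) => g.
- exact: SU_repr_unitary.
- exact: SU_repr_det.
move=> g1; do 3!apply: val_inj; rewrite -iE; exact: g1.
Qed.
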